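(* Let $M$ be a complete noncompact Riemannian manifold, $o\in M$ a fixed point, $K\subset M$ a nonempty compact set, $p>1$, and let $A$ satisfy the structure conditions (S) with exponent $p$. Let $u,v\in C(\overline{M\setminus K})\cap C^1(M\setminus K)$ be weak solutions of $$\operatorname{div}\left(\frac{A(|\nabla u|)}{|\nabla u|}\nabla u\right)=0\quad\text{in } M\setminus K .$$ Assume that $$\sup_k\Big(\max_{\mathcal{R}_{R_1^k,R_2^k}}|u|\Big)^p\operatorname{cap}_p(R_1^k,R_2^k)\quad\text{and}\quad \sup_k\Big(\max_{\mathcal{R}_{R_1^k,R_2^k}}|v|\Big)^p\operatorname{cap}_p(R_1^k,R_2^k)$$ are finite for some sequences $(R_1^k)$ and $(R_2^k)$ such that $R_2^k>R_1^k\to\infty$. If $u\le v$ on $\partial K$, then $u\le v$ in $M\setminus K$.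
   Context: Riemannian manifolds are connected. $B(o,R)$ is the open geodesic ball. For $R_2>R_1>0$, $\mathcal{R}_{R_1,R_2}=B(o,R_2)\setminus\overline{B(o,R_1)}$ is the annulus centered at $o$; maxima over annuli are understood as suprema, and are only considered for annuli on which the functions are defined (which is the case for $k$ large). Structure conditions (S) with exponent $p$: $A\in C[0,+\infty)\cap C^1(0,+\infty)$ and there are constants $\alpha\in(0,1]$, $\beta\ge1$, $D_1,D_2>0$ such that $A(0)=0$, $A(s)>0$ for $s>0$; $\alpha A(s)\le sA'(s)\le\beta A(s)$ for all $s>0$; and $D_1s^{p-1}\le A(s)\le D_2s^{p-1}$ for all $s\ge0$. For tangent vectors put $\mathcal{A}(0)=0$ and $\mathcal{A}(\mathbf v)=\frac{A(|\mathbf v|)}{|\mathbf v|}\mathbf v$ for $\mathbf v\ne0$. A function $u\in C^1(M\setminus K)$ is a weak solution of the equation if $\int_{M\setminus K}\nabla\varphi\cdot\mathcal{A}(\nabla u)\,dx=0$ for all $\varphi\in C_c^1(M\setminus K)$. $p$-capacity: for $\Omega\subset M$ open and $E\subset\Omega$, $\operatorname{cap}_p(E;\Omega)=\inf\{\int_\Omega|\nabla v|^p\,dx: v\in C_c^\infty(M),\ v=1\text{ in }E,\ \operatorname{supp}(v)\subset\Omega\}$, and $\operatorname{cap}_p(R_1,R_2)=\operatorname{cap}_p(B(o,R_1);B(o,R_2))$. *)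

(* Defs.v *)
From HB Require Import structures.
From mathcomp Require Import all_boot all_order all_algebra.
From mathcomp Require Import all_classical all_reals all_analysis.

Set Implicit Arguments.
Unset Strict Implicit.
Unset Printing Implicit Defensive.

Import Order.TTheory GRing.Theory Num.Theory.
Import numFieldNormedType.Exports.

Local Open Scope classical_set_scope.
Local Open Scope ring_scope.

(* Lebesgue measure on R^n is built on [n.-tuple R], which carries the product
   sigma-algebra: the Dirac mass for n = 0, then the image of the product with
   the one-dimensional Lebesgue measure under [cons]. *)
Section lebesgue_tuple.
Context {R : realType}.

Definition tuple_cons n (z : R * n.-tuple R) : n.+1.-tuple R :=
  [tuple of z.1 :: z.2].

Lemma measurable_tuple_cons n : measurable_fun setT (@tuple_cons n).
Proof.
exact: (measurable_cons (@measurable_fst _ _ _ _) (@measurable_snd _ _ _ _)).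
Qed.

Section successor.
Variables (n : nat) (m : {sigma_finite_measure set (n.-tuple R) -> \bar R}).

Definition lebesgue_tupleS : set (n.+1.-tuple R) -> \bar R :=
  pushforward (lebesgue_measure \x m)%E (@tuple_cons n).

Let lebesgue_tupleS0 : lebesgue_tupleS set0 = 0%E.
Proof. by rewrite /lebesgue_tupleS /pushforward preimage_set0 measure0. Qed.

Let lebesgue_tupleS_ge0 A : (0 <= lebesgue_tupleS A)%E.
Proof. by rewrite /lebesgue_tupleS /pushforward integral_ge0. Qed.

Let lebesgue_tupleS_sigma_additive : semi_sigma_additive lebesgue_tupleS.
Proof.
have mcons A : measurable A -> measurable (@tuple_cons n @^-1` A).
  by move=> mA; rewrite -[X in measurable X]setTI; exact: measurable_tuple_cons.
move=> F mF tF mUF; rewrite /lebesgue_tupleS /pushforward preimage_bigcup.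
apply: measure_semi_sigma_additive.
- by move=> k; exact: mcons.
- apply/trivIsetP => /= i j _ _ ij; rewrite -preimage_setI.
  by move/trivIsetP : tF => /(_ _ _ _ _ ij) ->//; rewrite preimage_set0.
- by rewrite -preimage_bigcup; exact: mcons.
Qed.

HB.instance Definition _ := isMeasure.Build _ _ _ lebesgue_tupleS
  lebesgue_tupleS0 lebesgue_tupleS_ge0 lebesgue_tupleS_sigma_additive.

Let lebesgue_tupleS_sigma_finite : sigma_finite setT lebesgue_tupleS.
Proof.
have /sigma_finiteP[F [TF ndF Foo]] := sigma_finiteT (@lebesgue_measure R).
have /sigma_finiteP[G [TG ndG Goo]] := sigma_finiteT m.
pose uncons (t : n.+1.-tuple R) := (thead t, [tuple of behead t]).
have consK z : uncons (tuple_cons z) = z.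
  by case: z => x t; congr pair => //; apply: val_inj.
exists (fun k => uncons @^-1` (F k `*` G k)).
  rewrite -preimage_bigcup (_ : \bigcup_k _ = setT) ?preimage_setT//.
  rewrite -subTset => -[x y] _.
  have [k _ Fkx] : (\bigcup_k F k) x by rewrite -TF.
  have [l _ Gly] : (\bigcup_k G k) y by rewrite -TG.
  exists (maxn k l) => //; split.
    by move: x Fkx; exact/subsetPset/ndF/leq_maxl.
  by move: y Gly; exact/subsetPset/ndG/leq_maxr.
move=> k; have [mFk Fkoo] := Foo k; have [mGk Gkoo] := Goo k; split.
  rewrite -[X in measurable X]setTI.
  have muncons : measurable_fun setT uncons.
    apply: measurable_fun_pair; first exact: measurable_tnth.
    exact: measurable_behead.
  by apply: muncons => //; exact: measurableX.
rewrite /lebesgue_tupleS /pushforward -comp_preimage.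
rewrite (_ : uncons \o _ = id); last by apply/funext => z; exact: consK.
by rewrite preimage_id product_measure1E// lte_mul_pinfty// ge0_fin_numE//.
Qed.

HB.instance Definition _ := Measure_isSigmaFinite.Build _ _ _ lebesgue_tupleS
  lebesgue_tupleS_sigma_finite.

End successor.

Fixpoint lebesgue_tuple n : {sigma_finite_measure set (n.-tuple R) -> \bar R} :=
  match n with
  | 0 => \d_ [tuple]
  | n'.+1 => lebesgue_tupleS (lebesgue_tuple n')
  end.

End lebesgue_tuple.

Definition row_of_tuple (R : realType) n (t : n.-tuple R) : 'rV[R]_n :=
  \row_i tnth t i.

Section smooth.
Context {R : realType} {n : nat} {W : normedModType R}.

(* [f] is of class C^k on [U]; meant for [U] open. *)
Fixpoint is_Ck (k : nat) (U : set 'rV[R]_n) (f : 'rV[R]_n -> W) : Prop :=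
  (forall z, U z -> {for z, continuous f}) /\
  match k with
  | 0 => True
  | k'.+1 => forall i : 'I_n,
      (forall z, U z -> derivable f z (delta_mx 0 i)) /\
      is_Ck k' U (fun z => 'D_(delta_mx 0 i) f z)
  end.

Definition is_smooth (U : set 'rV[R]_n) (f : 'rV[R]_n -> W) : Prop :=
  forall k, is_Ck k U f.

End smooth.

(* A connected Riemannian manifold of dimension [n], given by a smooth atlas
   indexed by [chart]: [coord c] is a homeomorphism from the open set [dom c]
   onto an open subset of R^n with inverse [param c] (both are total functions
   with junk values elsewhere), and [metric c] is the Gram matrix of the metric
   in the coordinates of [c].  Vectors are rows, and ['J f z] acts on the right,
   so [metric] transforms as a covariant 2-tensor. *)
Record riemannianManifold (R : realType) (n : nat) := RiemannianManifold {
  carrier :> ptopologicalType ;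
  chart : Type ;
  dom : chart -> set carrier ;
  coord : chart -> carrier -> 'rV[R]_n ;
  param : chart -> 'rV[R]_n -> carrier ;
  chart_at : carrier -> chart ;
  metric : chart -> 'rV[R]_n -> 'M[R]_n ;
  manifold_hausdorff : hausdorff_space carrier ;
  manifold_second_countable : @second_countable carrier ;
  manifold_connected : connected [set: carrier] ;
  dom_chart_at : forall x, dom (chart_at x) x ;
  dom_open : forall c, open (dom c) ;
  coord_open : forall c, open (coord c @` dom c) ;
  coordK : forall c x, dom c x -> param c (coord c x) = x ;
  coord_continuous : forall c x, dom c x -> {for x, continuous (coord c)} ;
  param_continuous : forall c z, (coord c @` dom c) z ->
    {for z, continuous (param c)} ;
  transition_smooth : forall c d,
    is_smooth (coord c @` (dom c `&` dom d)) (coord d \o param c) ;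
  metric_smooth : forall c, is_smooth (coord c @` dom c) (metric c) ;
  metric_sym : forall c z, (coord c @` dom c) z -> (metric c z)^T = metric c z ;
  metric_posdef : forall c z, (coord c @` dom c) z ->
    forall v : 'rV[R]_n, v != 0 -> 0 < (v *m metric c z *m v^T) 0 0 ;
  metric_transition : forall c d z, (coord c @` (dom c `&` dom d)) z ->
    let J := 'J (coord d \o param c) z in
    metric c z = J *m metric d (coord d (param c z)) *m J^T
}.

Section manifold.
Context {R : realType} {n : nat} (M : riemannianManifold R n).

(* A tangent vector at [x] is the row of its components in [chart_at x]. *)
Definition gram (x : M) : 'M[R]_n :=
  metric (chart_at x) (coord (chart_at x) x).

Definition tinner (x : M) (v w : 'rV[R]_n) : R := (v *m gram x *m w^T) 0 0.

Definition tnorm (x : M) (v : 'rV[R]_n) : R := Num.sqrt (tinner x v v).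

Definition differential (f : M -> R) (x : M) : 'rV[R]_n :=
  \row_i 'D_(delta_mx 0 i) (f \o param (chart_at x)) (coord (chart_at x) x).

Definition grad (f : M -> R) (x : M) : 'rV[R]_n :=
  differential f x *m invmx (gram x).

Definition Ck_on (k : nat) (D : set M) (f : M -> R) : Prop :=
  forall c, is_Ck k (coord c @` (dom c `&` D)) (f \o param c).

Definition smooth_on (D : set M) (f : M -> R) : Prop :=
  forall k, Ck_on k D f.

Definition supp (f : M -> R) : set M := closure [set x | f x != 0].

(* C^k functions with compact support in the open set [D], extended by 0. *)
Definition Ck_compact (k : nat) (D : set M) (f : M -> R) : Prop :=
  [/\ Ck_on k setT f, compact (supp f) & supp f `<=` D].

Definition boundary (D : set M) : set M := closure D `\` interior D.

Definition velocity (g : R -> M) (t : R) : 'rV[R]_n :=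
  derive1 (coord (chart_at (g t)) \o g) t.

Definition C1_curve (g : R -> M) (a b : R) : Prop :=
  forall t, a <= t <= b ->
    {for t, continuous g} /\
    forall c, dom c (g t) ->
      (\forall s \near t, derivable (coord c \o g) s 1) /\
      {for t, continuous (derive1 (coord c \o g))}.

Definition curve_length (g : R -> M) (a b : R) : R :=
  \int[lebesgue_measure]_(t in `[a, b]) tnorm (g t) (velocity g t).

(* [piecewise_C1_length x y l]: some piecewise C^1 curve from [x] to [y] has
   length [l]; such a curve is a finite concatenation of C^1 curves. *)
Inductive piecewise_C1_length : M -> M -> R -> Prop :=
| piecewise_C1_nil x : piecewise_C1_length x x 0
| piecewise_C1_cons g a b y l : a <= b -> C1_curve g a b ->
    piecewise_C1_length (g b) y l ->
    piecewise_C1_length (g a) y (curve_length g a b + l).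

Definition gdist (x y : M) : R := inf [set l | piecewise_C1_length x y l].

Definition gball (o : M) (r : R) : set M := [set x | gdist o x < r].

Definition annulus (o : M) (r1 r2 : R) : set M :=
  gball o r2 `\` closure (gball o r1).

Definition metrically_complete : Prop :=
  forall s : nat -> M,
    (forall e : R, 0 < e -> exists N, forall i j, (N <= i)%N -> (N <= j)%N ->
       gdist (s i) (s j) < e) ->
    exists x, (fun i => gdist (s i) x) @ \oo --> (0 : R).

Definition borel : Type := g_sigma_algebraType (@open M).

End manifold.

HB.instance Definition _ (R : realType) n (M : riemannianManifold R n) :=
  Measurable.on (borel M).

Section analysis.
Context {R : realType} {n : nat} (M : riemannianManifold R n).

(* The Riemannian volume is the Borel measure with density sqrt(det g) with
   respect to Lebesgue measure in every chart; as [M] is second countable, this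
   determines it. *)
Definition is_riemannian_volume (vol : {measure set (borel M) -> \bar R}) : Prop :=
  forall (c : chart M) (D : set (borel M)), measurable D -> D `<=` dom c ->
    vol D = (\int[lebesgue_tuple n]_(t in [set t | (coord c @` D) (row_of_tuple t)])
               (Num.sqrt (\det (metric c (row_of_tuple t))))%:E)%E.

Variable vol : {measure set (borel M) -> \bar R}.

(* Infimum of the empty set is +oo. *)
Definition capacity (p : R) (E Omega : set M) : \bar R :=
  ereal_inf [set (\int[vol]_(x in Omega) ((tnorm x (grad f x)) `^ p)%:E)%E
            | f in [set f : M -> R | [/\ smooth_on setT f, compact (supp f),
                      forall x, E x -> f x = 1 & supp f `<=` Omega]]].

Definition capacity_balls (p : R) (o : M) (r1 r2 : R) : \bar R :=
  capacity p (gball o r1) (gball o r2).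

(* [(sup |u|)^p cap_p] on the annulus of radii [r1] and [r2]. *)
Definition growth (p : R) (o : M) (u : M -> R) (r1 r2 : R) : \bar R :=
  ((ereal_sup [set `|u x|%:E | x in annulus o r1 r2]) `^ p
    * capacity_balls p o r1 r2)%E.

Definition flux (A : R -> R) (x : M) (v : 'rV[R]_n) : 'rV[R]_n :=
  if v == 0 then 0 else (A (tnorm x v) / tnorm x v) *: v.

Definition weak_solution (A : R -> R) (D : set M) (u : M -> R) : Prop :=
  Ck_on 1 D u /\
  forall phi : M -> R, Ck_compact 1 D phi ->
    (\int[vol]_(x in D) (tinner x (grad phi x) (flux A x (grad u x)))%:E)%E = 0%E.

End analysis.

Definition structure_conditions (R : realType) (p : R) (A : R -> R) : Prop :=
  [/\ {within `[0, +oo[, continuous A},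
      forall s, 0 < s -> derivable A s 1 /\ {for s, continuous (derive1 A)} &
      exists alpha beta D1 D2 : R,
        [/\ 0 < alpha <= 1, 1 <= beta, 0 < D1 & 0 < D2] /\
        [/\ A 0 = 0,
            forall s, 0 < s -> 0 < A s,
            forall s, 0 < s -> alpha * A s <= s * derive1 A s <= beta * A s &
            forall s, 0 <= s -> D1 * s `^ (p - 1) <= A s <= D2 * s `^ (p - 1)]].

(* Main.v *)
(** If [u - v] takes a value [c > 0], put [e = c / 2]; by the boundary inequality the
    set [{u - v > e}] stays away from [K].  Functions almost realising the capacities,
    composed with a C^1 step, are cut-offs [eta] equal to 1 on larger and larger balls
    for which the integral of [((|u| + |v|) |grad eta|)^p] stays bounded.  Through the
    Caccioppoli inequality this gives [u] and [v] finite p-energy away from [K].  Test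
    both equations with [eta T(u - v)], where [T] is bounded, vanishes on [t <= e] and
    increases strictly beyond: by Young's inequality the error is controlled by a small
    multiple of the previous integral plus the energy outside a large ball, so it tends
    to 0, and the strict monotonicity of the flux yields [grad u = grad v] wherever
    [u - v > e].  Hence [{u - v = c}] is open and closed in [M], so it is all of [M],
    although [K] is nonempty.

    That the capacities are finite and that [u] and [v] are bounded on annuli rests on
    the relative compactness of balls (Hopf-Rinow): a ball of radius [r] which is not
    relatively compact contains the centre of a ball of radius [3 r / 4] which is not
    either, and iterating produces a Cauchy sequence without limit. *)
Require Import Defs.
From HB Require Import structures.
From mathcomp Require Import all_boot all_order all_algebra finmap.
From mathcomp Require Import all_classical all_reals all_analysis.
From mathcomp Require Import measurable_realfun lra ring.

Set Implicit Arguments.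
Unset Strict Implicit.
Unset Printing Implicit Defensive.

Import Order.TTheory GRing.Theory Num.Theory.
Import numFieldNormedType.Exports.

Local Open Scope classical_set_scope.
Local Open Scope ring_scope.

(** The equations can only be tested with C^1 functions of compact support off [K], and this shapes
    the auxiliary functions. Competitors for the capacity may leave [0,1], so they are clamped by a
    C^1 step; its derivative is at most 4, whence the factor [4 ^ p] in the bounds. The level [e] is
    positive since [u <= v] alone would let the support of the truncated difference reach [K]. Near
    [K] the gradients may have infinite energy, so every energy carries a weight [zeta ^+ q] that
    vanishes around [K]; an integer [q >= p] is what Young's inequality asks of such a weight.

    The capacity bounds make the cut-off integral bounded but not small. Smallness is bought in
    Young's inequality: with weights [d ^ (1 - p)] and [d], a large [d] shrinks the cut-off term,
    and the price [d] multiplies an energy tail, which tends to 0 once the total energy is known to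
    be finite. The test function must also be dominated by [|u| + |v|], the quantity that the
    hypotheses control; hence a truncation with [T t <= |t|]. The identity of gradients first holds
    almost everywhere, and becomes pointwise because nonempty open sets have positive volume. *)

Local Notation coord := Defs.coord.

(** * Functions of class C^k on R^n *)

Section continuous_pointwise.
Context {R : realType} {T : topologicalType}.
Implicit Types (f g : T -> R) (x : T).

Lemma continuousM_for f g x : {for x, continuous f} -> {for x, continuous g} ->
  {for x, continuous (fun y => f y * g y)}.
Proof. exact: continuousM. Qed.

Lemma continuousD_for f g x : {for x, continuous f} -> {for x, continuous g} ->
  {for x, continuous (fun y => f y + g y)}.
Proof. exact: continuousD. Qed.

Lemma continuousB_for f g x : {for x, continuous f} -> {for x, continuous g} ->
  {for x, continuous (fun y => f y - g y)}.
Proof. exact: continuousB. Qed.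

Lemma continuous_cst_for (c : R) x : {for x, continuous (fun _ : T => c)}.
Proof. exact: cvg_cst. Qed.

End continuous_pointwise.

Section continuous_big.
Context {R : realType} {T : topologicalType} {I : Type}.

Lemma continuous_sum_for (r : seq I) (P : pred I) (F : I -> T -> R) x :
  (forall i, P i -> {for x, continuous (F i)}) ->
  {for x, continuous (fun y => \sum_(i <- r | P i) F i y)}.
Proof.
move=> cF; apply: (@cvg_big R I +%R 0 P _ _ _ r F (fun i => F i x)) => //.
exact: add_continuous.
Qed.

Lemma continuous_prod_for (r : seq I) (P : pred I) (F : I -> T -> R) x :
  (forall i, P i -> {for x, continuous (F i)}) ->
  {for x, continuous (fun y => \prod_(i <- r | P i) F i y)}.
Proof.
move=> cF; apply: (@cvg_big R I *%R 1 P _ _ _ r F (fun i => F i x)) => //.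
exact: mul_continuous.
Qed.

End continuous_big.

Section line_derivative.
Context {R : realType} {V W : normedModType R}.

Lemma line_growth (f : V -> W) (y v : V) (t : R) :
  (fun h : R => h^-1 *: (((fun s : R => f (s *: v + y)) \o shift t) (h *: 1) -
     f (t *: v + y))) =
  (fun h : R => h^-1 *: ((f \o shift (t *: v + y)) (h *: v) - f (t *: v + y))).
Proof.
apply/funext => h /=; congr (_ *: (f _ - _)).
by rewrite scaler1 scalerDl addrA.
Qed.

Lemma is_derive_line (f : V -> W) (y v : V) (t : R) :
  derivable f (t *: v + y) v ->
  is_derive t 1 (fun s : R => f (s *: v + y)) ('D_v f (t *: v + y)).
Proof.
move=> df; apply: DeriveDef; first by rewrite /derivable line_growth.
by rewrite /derive line_growth.
Qed.

End line_derivative.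

(** * Continuous partial derivatives imply differentiability *)

Section C1_differentiable.
Context {R : realType}.

(** Mean value theorem on the line through [y]. The symmetric range [|t| <= |a|] serves both signs
    of [a]. With [m] the derivative at a base point it bounds the error of the linear approximation;
    with [m = e = 0] it gives constancy. *)
Lemma mvt_dir (V : normedModType R) (f : V -> R) (y v : V) (m e a : R) :
  (forall t : R, `|t| <= `|a| -> derivable f (t *: v + y) v /\
     `|'D_v f (t *: v + y) - m| <= e) ->
  `|f (a *: v + y) - f y - a * m| <= e * `|a|.
Proof.
move=> H.
pose g (s : R) := f (s *: v + y).
have dg (t : R) : `|t| <= `|a| -> is_derive t 1 g ('D_v f (t *: v + y)).
  by move=> /H[? _]; exact: is_derive_line.
have cg (t : R) : `|t| <= `|a| -> {for t, continuous g}.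
  by move=> /dg gd; apply/differentiable_continuous/derivable1_diffP.
have key (b c : R) : b <= c -> (forall s : R, b <= s <= c -> `|s| <= `|a|) ->
   exists2 s : R, `|s| <= `|a| & g c - g b = 'D_v f (s *: v + y) * (c - b).
  move=> bc bca.
  have [||s sbc ->] := @MVT_segment R g (fun s => 'D_v f (s *: v + y)) b c bc.
  - by move=> x /[!in_itv]/= /andP[/ltW bx /ltW xc]; apply: dg; rewrite bca// bx.
  - apply/continuous_in_subspaceT => x /[!inE]/= /[!in_itv]/= ?.
    by apply: cg; exact: bca.
  exists s => //; apply: bca; by move: sbc; rewrite in_itv.
have g0 : g 0 = f y by rewrite /g scale0r add0r.
suff [s sa E] : exists2 s : R, `|s| <= `|a| & g a - g 0 = 'D_v f (s *: v + y) * a.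
  rewrite -/(g a) -g0 E [a * m]mulrC -mulrBl normrM ler_wpM2r//.
  by have [] := H _ sa.
have [a0|a0] := leP 0 a.
  have [|s sa E] := key 0 a a0; last by exists s => //; rewrite E subr0.
  by move=> s /andP[s0 sa]; rewrite !ger0_norm.
have [|s sa E] := key a 0 (ltW a0).
  by move=> s /andP[sa s0]; rewrite !ler0_norm// ?lerN2// ltW.
exists s => //; rewrite -[LHS]opprB E sub0r; ring.
Qed.

Variable n : nat.
Implicit Types (f : 'rV[R]_n -> R) (z h : 'rV[R]_n).

(** The corners of the path from 0 to [h] that changes one coordinate at a time. *)
Definition row_prefix k h : 'rV[R]_n := \row_i (if (i < k)%N then h 0 i else 0).

Lemma rV_norm_le z (e : R) : 0 <= e -> (forall i, `|z 0 i| <= e) -> `|z| <= e.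
Proof.
move=> e0 H; rewrite [leLHS]/Num.Def.normr/= mx_normrE.
by apply/bigmax_leP; split=> // -[i j] _ /=; rewrite ord1.
Qed.

Lemma rV_coord_le z i : `|z 0 i| <= `|z|.
Proof.
by rewrite [leRHS]/Num.Def.normr/= mx_normrE; apply: (le_bigmax _ _ (0, i)).
Qed.

Lemma row_prefixS k h (i : 'I_n) : k = i :> nat ->
  row_prefix k.+1 h = h 0 i *: delta_mx 0 i + row_prefix k h.
Proof.
move=> ki; apply/rowP => j; rewrite !mxE ltnS ki eqxx/=.
have [->|ij] := eqVneq j i; first by rewrite leqnn ltnn addr0 mulr1.
by rewrite mulr0 add0r leq_eqVlt (negbTE ij : (_ == _ :> nat) = false).
Qed.

(** Walk from [z] to [h + z] parallel to the axes: on each leg only one coordinate moves, so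
    [mvt_dir] compares the increment with one partial derivative at [z]. Summing over the legs gives
    the linear approximation. *)
Lemma C1_differential f z :
  (\forall y \near z, forall i, derivable f y (delta_mx 0 i)) ->
  (forall i, {for z, continuous (fun y => 'D_(delta_mx 0 i) f y)}) ->
  differentiable f z /\
  forall h, 'd f z h = \sum_i h 0 i * 'D_(delta_mx 0 i) f z.
Proof.
move=> df cf.
pose L h := \sum_i h 0 i * 'D_(delta_mx 0 i) f z.
have linL : linear L.
  move=> a x y; rewrite /L scaler_sumr -big_split/=; apply: eq_bigr => i _.
  by rewrite !mxE mulrDl scalerAl.
pose Ll := GRing.isLinear.Build _ _ _ _ L linL.
pose LL : {linear 'rV[R]_n -> R} := HB.pack L Ll.
have contL : continuous LL.
  move=> x; apply: continuous_sum_for => i _; apply: continuousM_for.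
    exact: coord_continuous.
  exact: continuous_cst_for.
have E (e : R) : 0 < e ->
    \forall h \near (0 : 'rV[R]_n), `|f (h + z) - f z - LL h| <= e * `|h|.
  move=> e0.
  (* Each of the [n] legs contributes an error [e' * |h|]; dividing by [n.+1] also covers dimension
     0. *)
  pose e' := e / n.+1%:R.
  have e'0 : 0 < e' by rewrite divr_gt0.
  have : \forall y \near z, forall i, derivable f y (delta_mx 0 i) /\
      `|'D_(delta_mx 0 i) f y - 'D_(delta_mx 0 i) f z| <= e'.
    have : \forall y \near z, forall i,
        `|'D_(delta_mx 0 i) f y - 'D_(delta_mx 0 i) f z| <= e'.
      apply: (@filter_forall _ _ (fun i y =>
        `|'D_(delta_mx 0 i) f y - 'D_(delta_mx 0 i) f z| <= e') (nbhs z) (nbhs_filter z)) => i.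
      have /cvgrPdist_le /(_ _ e'0) := cf i.
      by apply: filterS => y; rewrite distrC.
    by move: df; apply: filterS2 => y ? ? i; split.
  move=> /nbhs_ballP[d /= d0 Hd].
  near=> h.
  have hd : `|h| < d.
    near: h; apply/nbhs_ballP; exists d => // x; rewrite -ball_normE/=.
    by rewrite sub0r normrN.
  have key k : (k <= n)%N -> `|f (row_prefix k h + z) - f z -
      \sum_(i < n | (i < k)%N) h 0 i * 'D_(delta_mx 0 i) f z| <= k%:R * (e' * `|h|).
    elim: k => [_|k ih kn].
      rewrite big_pred0// subr0 (_ : row_prefix 0 h = 0).
        by rewrite add0r subrr normr0 mul0r.
      by apply/rowP => j; rewrite !mxE.
    pose i := Ordinal kn.
    rewrite (bigD1 i)//= (eq_bigl (fun j : 'I_n => (j < k)%N)); last first.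
      move=> j; rewrite ltnS leq_eqVlt -(inj_eq val_inj)/=.
      by case: eqVneq => // [->|]; rewrite ?ltnn// andbT.
    rewrite (@row_prefixS k h i)// -[_ + _ + z]addrA.
    set y := row_prefix k h + z; set S := \sum_(j < n | _) _.
    set Di := 'D_(delta_mx 0 i) f z.
    have -> : f (h 0 i *: delta_mx 0 i + y) - f z - (h 0 i * Di + S) =
      (f (h 0 i *: delta_mx 0 i + y) - f y - h 0 i * Di) + (f y - f z - S).
      by ring.
    apply: (le_trans (ler_normD _ _)).
    rewrite -natr1 mulrDl mul1r addrC; apply: lerD; first exact/ih/ltnW.
    apply: (@le_trans _ _ (e' * `|h 0 i|)); last first.
      by rewrite ler_wpM2l// ?rV_coord_le// ltW.
    apply: mvt_dir => t ta; apply: Hd; rewrite -ball_normE/=.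
    apply: le_lt_trans hd; apply: rV_norm_le => // j.
    rewrite !mxE eqxx/= -/i.
    have [->|ji] := eqVneq j i.
      rewrite ltnn add0r mulr1 opprD addrA addrAC subrr add0r normrN.
      exact: le_trans (rV_coord_le h i).
    rewrite mulr0n mulr0 add0r opprD addrA addrAC subrr add0r normrN.
    by case: ifP => _; rewrite ?normr0//; exact: rV_coord_le.
  have := key n (leqnn n).
  rewrite (_ : row_prefix n h = h); last by apply/rowP => j; rewrite !mxE ltn_ord.
  rewrite (eq_bigl xpredT); last by move=> i; rewrite ltn_ord.
  move=> H; apply: (le_trans H); rewrite mulrA ler_wpM2r// /e' mulrCA.
  by rewrite ger_pMr// ler_pdivrMr// mul1r ler_nat.
have dE : ('d f z : 'rV[R]_n -> R) = LL.
  apply: diff_unique => //; apply/eqaddoP => e e0.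
  by apply: filterS (E e e0) => h; rewrite /= opprD addrA.
split; last by move=> h; rewrite dE.
apply/diff_locallyP; rewrite dE; split => //; apply/eqaddoP => e e0.
by apply: filterS (E e e0) => h; rewrite /= opprD addrA.
Unshelve. all: by end_near. Qed.

End C1_differentiable.

(** * Chain rules *)

Section derivative_composition.
Context {R : realType}.

(** [T] is only known to be derivable in the direction [v]. Restricted to the line through [x] it
    becomes a differentiable function of one variable, to which the chain rule for differentials
    applies. *)
Lemma is_derive_comp_diff (V U W : normedModType R) (T : V -> U) (f : U -> W)
    (x v : V) : derivable T x v -> differentiable f (T x) ->
  is_derive x v (f \o T) ('d f (T x) ('D_v T x)).
Proof.
move=> dT df.
pose g (t : R) := T (t *: v + x).
have gx : g 0 = T x by rewrite /g scale0r add0r.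
have dT0 : derivable T (0 *: v + x) v by rewrite scale0r add0r.
have [dg] := is_derive_line dT0; rewrite -/g scale0r add0r => dgE.
have dg' : differentiable g 0 by exact/derivable1_diffP.
have dfg : differentiable (f \o g) 0.
  by apply: differentiable_comp => //; rewrite gx.
have dfT : derivable (f \o T) x v.
  by apply/derivable1P; exact: diff_derivable.
apply: DeriveDef => //.
have dfT0 : derivable (f \o T) (0 *: v + x) v by rewrite scale0r add0r.
have [_] := is_derive_line dfT0; rewrite scale0r add0r => <-.
rewrite deriveE// -dgE deriveE//.
by rewrite (@diff_comp _ _ _ _ g f) /= ?gx.
Qed.

Lemma is_derive_comp1 (V : normedModType R) (f : V -> R) (F : R -> R) (G : R)
    (x v : V) : derivable f x v -> is_derive (f x) 1 F G ->
  is_derive x v (F \o f) (G * 'D_v f x).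
Proof.
move=> df dF.
have dF' : differentiable F (f x) by apply/derivable1_diffP.
have := is_derive_comp_diff df dF'.
rewrite [in X in is_derive _ _ _ X](_ : 'D_v f x = 'D_v f x *: (1 : R)); last first.
  by rewrite [RHS]mulr1.
rewrite linearZ/= -(deriveE _ dF') derive_val => H.
by apply: is_derive_eq H _; rewrite mulrC.
Qed.

Lemma is_derive_inv (y : R) : y != 0 ->
  is_derive y 1 (fun t : R => t^-1) (- (y^-1 * y^-1)).
Proof.
move=> y0; apply: DeriveDef; first by apply: (@derivableV _ _ id).
rewrite (@deriveV _ _ id)//= derive_id expr2 invfM.
by rewrite [_ *: _]mulr1.
Qed.

End derivative_composition.

(** * Stability of the classes C^k *)

Section is_Ck_theory.
Context {R : realType} {n : nat}.
Implicit Types (U : set 'rV[R]_n).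

Section vector_valued.
Context {W : normedModType R}.
Implicit Types (f g : 'rV[R]_n -> W).

Lemma is_Ck_continuous k U f z : is_Ck k U f -> U z -> {for z, continuous f}.
Proof. by case: k => [|k] [+ _]; exact. Qed.

Lemma is_Ck1P U f : is_Ck 1 U f <-> forall z, U z ->
  [/\ {for z, continuous f}, forall i, derivable f z (delta_mx 0 i) &
   forall i, {for z, continuous (fun y => 'D_(delta_mx 0 i) f y)}].
Proof.
split=> [[cf df] z Uz|H].
  by split => // [|i|i]; [exact: cf|exact: (df i).1|exact: ((df i).2).1].
split=> [z /H[]//|i]; split=> [z /H[]//|].
by split => // z /H[].
Qed.

Lemma is_CkW k U f : is_Ck k.+1 U f -> is_Ck k U f.
Proof.
elim: k f => [|k ih] f; first by case.
move=> [cf df]; split=> // i; split; first exact: (df i).1.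
exact/ih/(df i).2.
Qed.

Lemma is_Ck_sub k U U' f : U' `<=` U -> is_Ck k U f -> is_Ck k U' f.
Proof.
move=> UU'; elim: k f => [|k ih] f; first by case=> cf _; split=> // z /UU'/cf.
move=> [cf df]; split=> [z /UU'/cf//|i]; split; last exact/ih/(df i).2.
by move=> z /UU'; exact: (df i).1.
Qed.

Lemma is_CkU k U U' f : is_Ck k U f -> is_Ck k U' f -> is_Ck k (U `|` U') f.
Proof.
elim: k f => [|k ih] f.
  by move=> [cf _] [cf' _]; split=> // z [/cf|/cf'].
move=> [cf df] [cf' df']; split=> [z [/cf|/cf']//|i]; split.
  by move=> z [/(df i).1|/(df' i).1].
exact: ih (df i).2 (df' i).2.
Qed.

Lemma open_near_eq U f g z : open U -> U z -> (forall y, U y -> f y = g y) ->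
  \forall y \near z, f y = g y.
Proof.
move=> oU Uz fg; apply: filterS (open_nbhs_nbhs (conj oU Uz)).
by move=> y /fg.
Qed.

Lemma continuous_near_eq (T S : topologicalType) (f1 f2 : T -> S) z :
  (\forall y \near z, f1 y = f2 y) -> {for z, continuous f1} ->
  {for z, continuous f2}.
Proof.
move=> fg cf; rewrite /prop_for /continuous_at -(nbhs_singleton fg).
by apply: cvg_trans cf; apply: near_eq_cvg.
Qed.

Lemma continuous_for_ext (T S : topologicalType) (f1 f2 : T -> S) z :
  f1 =1 f2 -> {for z, continuous f1} -> {for z, continuous f2}.
Proof. by move=> /funext ->. Qed.

Lemma is_Ck_eq k U f g : open U -> (forall y, U y -> f y = g y) ->
  is_Ck k U f -> is_Ck k U g.
Proof.
move=> oU; elim: k f g => [|k ih] f g fg.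
  move=> [cf _]; split=> // z Uz; apply: continuous_near_eq (cf z Uz).
  exact: open_near_eq fg.
move=> [cf df]; split.
  move=> z Uz; apply: continuous_near_eq (cf z Uz).
  exact: open_near_eq fg.
move=> i; split.
  move=> z Uz; apply: near_eq_derivable ((df i).1 z Uz).
  exact: open_near_eq fg.
apply: ih ((df i).2) => z Uz; apply: near_eq_derive.
exact: open_near_eq fg.
Qed.

Lemma is_Ck_cst k U (c : W) : is_Ck k U (cst c).
Proof.
elim: k c => [|k ih] c; first by split=> // z _; exact: cst_continuous.
split=> [z _|i]; first exact: cst_continuous.
split=> [z _|]; first exact: derivable_cst.
rewrite (_ : (fun z => _) = cst 0); first exact: ih.
by apply/funext => z; rewrite derive_cst.
Qed.

Lemma is_CkD k U f g : open U -> is_Ck k U f -> is_Ck k U g ->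
  is_Ck k U (fun z => f z + g z).
Proof.
move=> oU; elim: k f g => [|k ih] f g [cf df] [cg dg].
  split=> // z Uz; exact: continuousD (cf _ Uz) (cg _ Uz).
split=> [z Uz|i]; first exact: continuousD (cf _ Uz) (cg _ Uz).
split=> [z Uz|].
  exact: derivableD ((df i).1 z Uz) ((dg i).1 z Uz).
apply: is_Ck_eq (ih _ _ ((df i).2) ((dg i).2)) => // z Uz.
exact: esym (deriveD ((df i).1 z Uz) ((dg i).1 z Uz)).
Qed.

End vector_valued.

Implicit Types (f g : 'rV[R]_n -> R).

Lemma is_CkM k U f g : open U -> is_Ck k U f -> is_Ck k U g ->
  is_Ck k U (fun z => f z * g z).
Proof.
move=> oU; elim: k f g => [|k ih] f g Cf Cg.
  split=> // z Uz; apply: continuousM_for.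
    exact: is_Ck_continuous Cf Uz.
  exact: is_Ck_continuous Cg Uz.
have [[cf df] [cg dg]] := (Cf, Cg).
split=> [z Uz|i]; first exact: continuousM (cf _ Uz) (cg _ Uz).
split=> [z Uz|].
  exact: derivableM ((df i).1 z Uz) ((dg i).1 z Uz).
apply: (@is_Ck_eq _ _ _ (fun z => f z * 'D_(delta_mx 0 i) g z +
    g z * 'D_(delta_mx 0 i) f z)) => //.
  move=> z Uz; rewrite -[RHS]/('D_(delta_mx 0 i) (f * g) z).
  by rewrite deriveM//; [exact: (df i).1|exact: (dg i).1].
apply: is_CkD => //; apply: ih => //; try exact: is_CkW.
  exact: (dg i).2.
exact: (df i).2.
Qed.

(** One order is gained from the derivative [G] of [F], whose composition with [f] is handled
    separately. With [k = 0] this serves profiles that are C^1 but not smooth, and since [G] is only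
    tested on values of [f] it also serves the inverse away from 0. *)
Lemma is_Ck_compS k U f (F G : R -> R) : open U ->
  (forall z, U z -> is_derive (f z) 1 F (G (f z))) ->
  is_Ck k.+1 U f -> is_Ck k U (G \o f) -> is_Ck k.+1 U (F \o f).
Proof.
move=> oU dF Cf CG; have [cf df] := Cf.
have dFf i z : U z -> is_derive z (delta_mx 0 i) (F \o f)
    (G (f z) * 'D_(delta_mx 0 i) f z).
  by move=> Uz; apply: is_derive_comp1; [exact: (df i).1|exact: dF].
split=> [z Uz|i].
  apply: continuous_comp (cf z Uz) _.
  by have dFz := dF z Uz; apply/differentiable_continuous/derivable1_diffP.
split=> [z Uz|]; first by have := dFf i z Uz; move=> [].
apply: (@is_Ck_eq _ _ _ (fun z => G (f z) * 'D_(delta_mx 0 i) f z)) => //.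
  by move=> z Uz; have := dFf i z Uz => -[].
by apply: is_CkM => //; exact: (df i).2.
Qed.

(* A set of functions of one variable that is stable under derivation consists
   of smooth functions. *)
Definition derivation_stable (F : set (R -> R)) :=
  forall f : R -> R, F f ->
  exists2 g : R -> R, F g & forall t : R, is_derive t 1 f (g t).

Lemma is_Ck_comp k U f (Fam : set (R -> R)) F : open U ->
  derivation_stable Fam -> Fam F -> is_Ck k U f -> is_Ck k U (F \o f).
Proof.
move=> oU Fs; elim: k F => [|k ih] F FF Cf.
  have [G _ dF] := Fs _ FF.
  split=> // z Uz; apply: continuous_comp; first exact: is_Ck_continuous Cf Uz.
  exact/differentiable_continuous/derivable1_diffP.
have [G FG dF] := Fs _ FF.
apply: is_Ck_compS (Cf) _ => //; apply: ih => //; exact: is_CkW.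
Qed.

Lemma is_CkV k U f : open U -> (forall z, U z -> f z != 0) ->
  is_Ck k U f -> is_Ck k U (fun z => (f z)^-1).
Proof.
move=> oU f0; elim: k => [|k ih] Cf.
  split=> // z Uz; apply: continuousV; first exact: f0.
  exact: is_Ck_continuous Cf Uz.
rewrite -[X in is_Ck _ _ X]/((fun t : R => t^-1) \o f).
apply: (@is_Ck_compS _ _ _ _ (fun t => - (t^-1 * t^-1))) => //.
  by move=> z Uz; apply: is_derive_inv; exact: f0.
rewrite (_ : _ \o f = (fun z => (-1) * ((f z)^-1 * (f z)^-1))); last first.
  by apply/funext => z /=; rewrite mulN1r.
apply: is_CkM => //; first exact: is_Ck_cst.
by apply: is_CkM => //; apply: ih; exact: is_CkW.
Qed.

Lemma is_Ck_prod k U (I : Type) (r : seq I) (f : I -> 'rV[R]_n -> R) : open U ->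
  (forall i, is_Ck k U (f i)) -> is_Ck k U (fun z => \prod_(i <- r) f i z).
Proof.
move=> oU Cf; elim: r => [|i r ih].
  rewrite (_ : (fun z => _) = cst 1); first exact: is_Ck_cst.
  by apply/funext => z; rewrite big_nil.
rewrite (_ : (fun z => _) = (fun z => f i z * \prod_(i <- r) f i z)); last first.
  by apply/funext => z; rewrite big_cons.
exact: is_CkM.
Qed.

Lemma is_Ck_coord m m' k U (T : 'rV[R]_n -> 'M[R]_(m, m')) i j : open U ->
  is_Ck k U T -> is_Ck k U (fun z => T z i j).
Proof.
have cc (S : 'rV[R]_n -> 'M[R]_(m, m')) z : {for z, continuous S} ->
    {for z, continuous (fun y => S y i j)}.
  move=> cS; apply: (@continuous_comp _ _ _ S (fun M : 'M[R]_(m, m') => M i j)) => //.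
  exact: coord_continuous.
move=> oU; elim: k T => [|k ih] T [cT dT].
  by split=> // z Uz; apply: cc; exact: cT.
split=> [z Uz|l]; first by apply: cc; exact: cT.
split=> [z Uz|].
  by have /derivable_mxP := (dT l).1 z Uz.
apply: is_Ck_eq (ih _ (dT l).2) => // z Uz.
by rewrite derive_mx ?mxE//; exact: (dT l).1.
Qed.

Lemma is_Ck1_differential U f z : open U -> is_Ck 1 U f -> U z ->
  differentiable f z /\
  forall h, 'd f z h = \sum_i h 0 i * 'D_(delta_mx 0 i) f z.
Proof.
move=> oU Cf Uz; apply: C1_differential.
  apply: filterS (open_nbhs_nbhs (conj oU Uz)) => y Uy i.
  by have [] := (is_Ck1P U f).1 Cf y Uy.
by have [] := (is_Ck1P U f).1 Cf z Uz.
Qed.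

Lemma is_Ck1_differentiable_mx m U (T : 'rV[R]_n -> 'rV[R]_m) z : open U ->
  is_Ck 1 U T -> U z -> differentiable T z.
Proof.
move=> oU CT Uz.
rewrite (_ : T = \sum_i (fun y => T y 0 i *: delta_mx 0 i : 'rV_m)); last first.
  apply/funext => y; rewrite fct_sumE [LHS]row_sum_delta.
  by [].
apply: differentiable_sum => i; apply: differentiableZl.
by have [] := is_Ck1_differential oU (is_Ck_coord 0 i oU CT) Uz.
Qed.

(** Balls are convex, so the segment from [z] to [y] stays inside and [mvt_dir] applies with error
    0. *)
Lemma zero_partials_cst U f z (d : R) : open U -> is_Ck 1 U f ->
  ball z d `<=` U ->
  (forall y i, ball z d y -> 'D_(delta_mx 0 i) f y = 0) ->
  forall y, ball z d y -> f y = f z.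
Proof.
move=> oU Cf zU f0 y zy.
have zt (t : R) : `|t| <= `|1 : R| -> ball z d (t *: (y - z) + z).
  rewrite normr1 -ball_normE/= => t1.
  rewrite opprD addrCA subrr addr0 normrN normrZ.
  move: zy; rewrite -ball_normE/= distrC; apply: le_lt_trans.
  by rewrite ler_piMl.
have H (t : R) : `|t| <= `|1 : R| -> derivable f (t *: (y - z) + z) (y - z) /\
    `|'D_(y - z) f (t *: (y - z) + z) - 0| <= 0.
  move=> t1; have [df dfE] := is_Ck1_differential oU Cf (zU _ (zt t t1)).
  split; first exact: diff_derivable.
  rewrite deriveE// dfE big1 ?subrr ?normr0// => i _.
  by rewrite f0 ?mulr0//; exact: zt.
have := mvt_dir H.
by rewrite scale1r subrK mulr0 subr0 mul0r normr_le0 subr_eq0 => /eqP.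
Qed.

End is_Ck_theory.

Section matrix_continuity.
Context {R : realType} {T : topologicalType}.

Lemma continuous_det_for n (A : T -> 'M[R]_n) x :
  (forall i j, {for x, continuous (fun y => A y i j)}) ->
  {for x, continuous (fun y => \det (A y))}.
Proof.
move=> cA; apply: continuous_sum_for => s _; apply: continuousM_for.
  exact: continuous_cst_for.
by apply: continuous_prod_for => i _; exact: cA.
Qed.

Lemma continuous_invmx_for n (A : T -> 'M[R]_n) x i j :
  (\forall y \near x, A y \in unitmx) ->
  (forall i j, {for x, continuous (fun y => A y i j)}) ->
  {for x, continuous (fun y => invmx (A y) i j)}.
Proof.
move=> uA cA.
apply: (@continuous_near_eq _ _ (fun y => (\det (A y))^-1 * cofactor (A y) j i)).
  by apply: filterS uA => y uAy; rewrite /invmx uAy !mxE.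
apply: continuousM_for.
  apply: continuousV; last exact: continuous_det_for.
  by have := nbhs_singleton uA; rewrite unitmxE unitfE.
apply: continuousM_for; first exact: continuous_cst_for.
apply: continuous_det_for => k l.
by rewrite (_ : (fun y => _) = (fun y => A y (lift j k) (lift i l)))//;
  apply/funext => y; rewrite !mxE.
Qed.

Lemma continuous_mulmx_for m n p (A : T -> 'M[R]_(m, n)) (B : T -> 'M[R]_(n, p)) x :
  (forall i j, {for x, continuous (fun y => A y i j)}) ->
  (forall i j, {for x, continuous (fun y => B y i j)}) ->
  forall i j, {for x, continuous (fun y => (A y *m B y) i j)}.
Proof.
move=> cA cB i j.
rewrite (_ : (fun y => _) = (fun y => \sum_k A y i k * B y k j)); last first.
  by apply/funext => y; rewrite mxE.
by apply: continuous_sum_for => k _; exact: continuousM_for.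
Qed.

Lemma continuous_entry_for m n (A : T -> 'M[R]_(m, n)) x i j :
  {for x, continuous A} -> {for x, continuous (fun y => A y i j)}.
Proof.
move=> cA; apply: (@continuous_comp _ _ _ A (fun M : 'M[R]_(m, n) => M i j)) => //.
exact: coord_continuous.
Qed.

End matrix_continuity.

(** * Charts and gradients *)

Section charts.
Context {R : realType} {n : nat} (M : riemannianManifold R n).
Implicit Types (c d : chart M) (x y : M) (D : set M) (f g h : M -> R).

Lemma nbhs_dom c x : dom c x -> nbhs x (dom c).
Proof. by move=> cx; apply: open_nbhs_nbhs; split=> //; exact: dom_open. Qed.

Lemma coord_image c D x : dom c x -> D x -> (coord c @` (dom c `&` D)) (coord c x).
Proof. by move=> cx Dx; exists x. Qed.

Lemma coord_image_dom c x : dom c x -> (coord c @` dom c) (coord c x).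
Proof. by move=> cx; exists x. Qed.

Lemma param_continuous_at c x : dom c x -> {for coord c x, continuous (param c)}.
Proof. by move=> cx; apply: param_continuous; exact: coord_image_dom. Qed.

Lemma near_param c x (P : set M) : dom c x -> nbhs x P ->
  \forall z \near coord c x, P (param c z).
Proof.
move=> cx Px; have := param_continuous_at cx.
by apply; rewrite /= coordK.
Qed.

Lemma near_coord c x (P : set 'rV[R]_n) : dom c x -> nbhs (coord c x) P ->
  \forall y \near x, P (coord c y).
Proof. by move=> cx Px; exact: (Defs.coord_continuous cx). Qed.

Lemma open_coord_image c D : open D -> open (coord c @` (dom c `&` D)).
Proof.
move=> oD; rewrite openE => _ [x [cx Dx] <-].
have oI : nbhs (coord c x) (coord c @` dom c).
  by apply: open_nbhs_nbhs; split; [exact: coord_open|exact: coord_image_dom].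
have Dn : nbhs x (dom c `&` D).
  by apply: filterI; [exact: nbhs_dom|exact: open_nbhs_nbhs].
have := near_param cx Dn; rewrite /interior/=; apply: filterS2 oI => z [y cy <-].
by rewrite coordK// => -[_ Dy]; exists y.
Qed.

Lemma coord_imageI c D x : (coord c @` (dom c `&` D)) (coord c x) ->
  dom c x -> D x.
Proof.
by move=> [y [cy Dy] yx] cx; rewrite -(coordK cx) -yx coordK.
Qed.

Section Ck_on_theory.
Variable k : nat.

Lemma Ck_on_sub D D' f : D' `<=` D -> Ck_on k D f -> Ck_on k D' f.
Proof.
by move=> DD Cf c; apply: is_Ck_sub (Cf c) => _ [x [cx /DD Dx] <-]; exists x.
Qed.

Lemma Ck_onU D D' f : Ck_on k D f -> Ck_on k D' f -> Ck_on k (D `|` D') f.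
Proof.
move=> Cf Cf' c; apply: is_Ck_sub (is_CkU (Cf c) (Cf' c)).
by move=> _ [x [cx [Dx|Dx]] <-]; [left|right]; exists x.
Qed.

Lemma Ck_on_eq D f g : open D -> (forall x, D x -> f x = g x) ->
  Ck_on k D f -> Ck_on k D g.
Proof.
move=> oD fg Cf c; apply: is_Ck_eq (Cf c); first exact: open_coord_image.
by move=> _ [x [cx Dx] <-] /=; rewrite coordK//; exact: fg.
Qed.

Lemma Ck_on_cst D (a : R) : Ck_on k D (cst a).
Proof. by move=> c; exact: is_Ck_cst. Qed.

Lemma Ck_onD D f g : open D -> Ck_on k D f -> Ck_on k D g ->
  Ck_on k D (fun x => f x + g x).
Proof. by move=> oD Cf Cg c; apply: is_CkD => //; exact: open_coord_image. Qed.

Lemma Ck_onM D f g : open D -> Ck_on k D f -> Ck_on k D g ->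
  Ck_on k D (fun x => f x * g x).
Proof. by move=> oD Cf Cg c; apply: is_CkM => //; exact: open_coord_image. Qed.

Lemma Ck_onV D f : open D -> (forall x, D x -> f x != 0) ->
  Ck_on k D f -> Ck_on k D (fun x => (f x)^-1).
Proof.
move=> oD f0 Cf c; apply: is_CkV (Cf c); first exact: open_coord_image.
by move=> _ [x [cx Dx] <-] /=; rewrite coordK//; exact: f0.
Qed.

Lemma Ck_on_comp D f (Fam : set (R -> R)) F : open D ->
  derivation_stable Fam -> Fam F -> Ck_on k D f -> Ck_on k D (F \o f).
Proof.
move=> oD FamS FF Cf c.
by apply: (@is_Ck_comp _ _ _ _ (f \o param c) Fam) => //; exact: open_coord_image.
Qed.

(** [D] and the complement of the support are open and cover the manifold, and [f] is 0 on the
    second. Regularity checked in [D] thus yields global test functions. *)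
Lemma Ck_on_supp D f : Ck_on k D f -> supp f `<=` D -> Ck_on k setT f.
Proof.
move=> Cf fD.
have oS : open (~` supp f) by apply/closed_openC/closed_closure.
apply: (@Ck_on_sub (D `|` ~` supp f)).
  by move=> x _; case: (pselect (supp f x)) => [/fD|]; [left|right].
apply: Ck_onU => //.
apply: (@Ck_on_eq _ (cst 0)) (Ck_on_cst _ _) => // x /= fx.
apply/esym/eqP; apply: contra_notT fx => fx.
exact: subset_closure.
Qed.

End Ck_on_theory.

Lemma Ck_onX k D f m : open D -> Ck_on k D f -> Ck_on k D (fun x => f x ^+ m).
Proof.
move=> oD Cf; elim: m => [|m ih].
  rewrite (_ : (fun x => _) = cst 1); first exact: Ck_on_cst.
  by apply/funext => x; rewrite expr0.
rewrite (_ : (fun x => _) = (fun x => f x * f x ^+ m)); first exact: Ck_onM.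
by apply/funext => x; rewrite exprS.
Qed.

Lemma C1_on_comp D f (F G : R -> R) : open D ->
  (forall t : R, is_derive t 1 F (G t)) -> continuous G ->
  Ck_on 1 D f -> Ck_on 1 D (F \o f).
Proof.
move=> oD dF cG Cf c.
apply: (@is_Ck_compS _ _ _ _ (f \o param c) _ G) => //.
  exact: open_coord_image.
split=> // z Dz; apply: continuous_comp; last exact: cG.
exact: is_Ck_continuous (Cf c) Dz.
Qed.

Lemma continuous_param_coord (S : topologicalType) (F : M -> S) c x : dom c x ->
  {for coord c x, continuous (F \o param c)} -> {for x, continuous F}.
Proof.
move=> cx cF; apply: (@continuous_near_eq _ _ ((F \o param c) \o coord c)).
  by apply: filterS (nbhs_dom cx) => y cy /=; rewrite coordK.
by apply: continuous_comp => //; exact: Defs.coord_continuous.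
Qed.

Lemma Ck_on_continuous k D f x : Ck_on k D f -> D x -> {for x, continuous f}.
Proof.
move=> Cf Dx; have cx := dom_chart_at x.
apply: (continuous_param_coord cx); apply: is_Ck_continuous (Cf _) _.
exact: coord_image.
Qed.

End charts.

(** * Gradients and their independence of the chart *)

Section gradient.
Context {R : realType} {n : nat} (M : riemannianManifold R n).
Implicit Types (c d : chart M) (x y : M) (D : set M) (f g h : M -> R).

(** The differential read in a fixed chart, whereas [differential] at [x] refers to [chart_at x], a
    choice that may jump from point to point. *)
Definition partials c f x : 'rV[R]_n :=
  \row_i 'D_(delta_mx 0 i) (f \o param c) (coord c x).

Lemma metric_unit c x : dom c x -> metric c (coord c x) \in unitmx.
Proof.
move=> cx; rewrite -row_free_unit -kermx_eq0; apply/eqP/row_matrixP => i.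
rewrite row0; apply/eqP; apply/negP => /negP ki.
have := metric_posdef (coord_image_dom cx) ki.
by rewrite -row_mul mulmx_ker row0 mul0mx mxE ltxx.
Qed.

Let trans c d := coord d \o param c.

Lemma transition_at c d x : dom c x -> dom d x ->
  [/\ trans c d (coord c x) = coord d x, differentiable (trans c d) (coord c x) &
   metric c (coord c x) = 'J (trans c d) (coord c x) *m metric d (coord d x) *m
                          ('J (trans c d) (coord c x))^T].
Proof.
move=> cx dx; split; first by rewrite /trans/= coordK.
  apply: (@is_Ck1_differentiable_mx _ _ _ (coord c @` (dom c `&` dom d))).
  - exact/open_coord_image/dom_open.
  - exact: transition_smooth.
  - exact: coord_image.
have := @metric_transition _ _ M c d (coord c x) (coord_image cx dx).
by rewrite /= coordK.
Qed.

Lemma partials_transition c d f D x : dom c x -> dom d x -> open D -> D x ->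
  Ck_on 1 D f ->
  partials c f x = partials d f x *m ('J (trans c d) (coord c x))^T.
Proof.
move=> cx dx oD Dx Cf.
have [Tx dT _] := transition_at cx dx.
have Id : (coord d @` (dom d `&` D)) (coord d x) by exact: coord_image.
have [df dfE] := is_Ck1_differential (open_coord_image oD) (Cf d) Id.
apply/rowP => i; rewrite !mxE.
have -> : 'D_(delta_mx 0 i) (f \o param c) (coord c x) =
    'D_(delta_mx 0 i) ((f \o param d) \o trans c d) (coord c x).
  apply: near_eq_derive.
  have := near_param cx (nbhs_dom dx).
  by apply: filterS => z dz /=; rewrite coordK.
have dTi : derivable (trans c d) (coord c x) (delta_mx 0 i) by exact: diff_derivable.
have := @is_derive_comp_diff _ _ _ _ (trans c d) (f \o param d) _ _ dTi.
rewrite Tx => /(_ df)[_ ->]; rewrite dfE; apply: eq_bigr => j _.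
rewrite !mxE mulrC; congr (_ * _).
by rewrite deriveEjacobian// -rowE !mxE.
Qed.

Definition gprod f h x : R := tinner x (grad f x) (grad h x).

Lemma gprod_grad f h x : gprod f h x =
  (differential f x *m invmx (gram x) *m (differential h x)^T) 0 0.
Proof.
rewrite /gprod /tinner /grad; set df := differential f x; set dh := differential h x.
have gu : gram x \in unitmx by apply: metric_unit; exact: dom_chart_at.
have gs : (gram x)^T = gram x.
  rewrite /gram; apply: Defs.metric_sym; exact: coord_image_dom (dom_chart_at x).
by rewrite trmx_mul trmx_inv gs !mulmxA mulmxKV.
Qed.

(** Differentials change by the transposed Jacobian and the metric by [J H J^T], so the Jacobians
    cancel. Having one formula in a fixed chart around [x] is what makes [gprod] continuous despite
    the arbitrary choice of [chart_at]. *)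
Lemma gprod_chart c f h D x : dom c x -> open D -> D x ->
  Ck_on 1 D f -> Ck_on 1 D h ->
  gprod f h x =
  (partials c f x *m invmx (metric c (coord c x)) *m (partials c h x)^T) 0 0.
Proof.
move=> cx oD Dx Cf Ch; rewrite gprod_grad.
set d := chart_at x; have dx : dom d x by exact: dom_chart_at.
rewrite -[differential f x]/(partials d f x) -[differential h x]/(partials d h x).
rewrite /gram -/d.
have [_ _ gE] := transition_at cx dx.
rewrite (partials_transition cx dx oD Dx Cf) (partials_transition cx dx oD Dx Ch).
move: gE; set J := 'J _ _; set G := metric c _; set H := metric d _ => gE.
have Gu : G \in unitmx by exact: metric_unit.
have Hu : H \in unitmx by exact: metric_unit.
have Ju : J \in unitmx.
  by move: Gu; rewrite gE -mulmxA unitmx_mul => /andP[].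
have JTu : J^T \in unitmx by rewrite unitmx_tr.
have -> : invmx G = invmx J^T *m invmx H *m invmx J.
  apply: (can_inj (mulKmx Gu)); rewrite mulmxV// gE !mulmxA.
  by rewrite mulmxK// mulmxK// mulmxV.
by rewrite trmx_mul trmxK !mulmxA mulmxK// mulmxKV.
Qed.

Lemma gprod_continuous f h D x : open D -> D x -> Ck_on 1 D f -> Ck_on 1 D h ->
  {for x, continuous (gprod f h)}.
Proof.
move=> oD Dx Cf Ch; have cx := dom_chart_at x; set c := chart_at x in cx *.
pose Dp g z : 'rV[R]_n := \row_i 'D_(delta_mx 0 i) (g \o param c) z.
pose Ga z := (Dp f z *m invmx (metric c z) *m (Dp h z)^T) 0 0.
have nD : \forall y \near x, (dom c `&` D) y.
  by apply: filterI; [exact: nbhs_dom|exact: open_nbhs_nbhs].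
apply: (@continuous_near_eq _ _ (Ga \o coord c)).
  apply: filterS nD => y [cy Dy] /=.
  by rewrite (gprod_chart cy oD Dy Cf Ch).
apply: continuous_comp; first exact: Defs.coord_continuous.
have Ix : (coord c @` (dom c `&` D)) (coord c x) by exact: coord_image.
have cDp g : Ck_on 1 D g -> forall i j, {for coord c x, continuous (fun z => Dp g z i j)}.
  move=> Cg i j; have [_ _ /(_ j)] := (is_Ck1P _ _).1 (Cg c) _ Ix.
  by apply: continuous_for_ext => z; rewrite mxE.
apply: continuous_mulmx_for.
  apply: continuous_mulmx_for; first exact: cDp.
  move=> i j; apply: continuous_invmx_for.
    have : nbhs (coord c x) (coord c @` dom c).
      by apply: open_nbhs_nbhs; split; [exact: coord_open|exact: coord_image_dom].
    by apply: filterS => _ [y cy <-]; exact: metric_unit.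
  move=> k l; apply: continuous_entry_for.
  have := @metric_smooth _ _ M c 0 => -[+ _]; apply; exact: coord_image_dom.
move=> i j; have := cDp _ Ch j i.
by apply: continuous_for_ext => z; rewrite [in RHS]mxE.
Qed.

End gradient.

(** * The inner product on tangent spaces *)

Section tangent_inner_product.
Context {R : realType} {n : nat} (M : riemannianManifold R n).
Implicit Types (x : M) (v w : 'rV[R]_n).

Lemma tinnerDl x v w u : tinner x (v + w) u = tinner x v u + tinner x w u.
Proof. by rewrite /tinner !mulmxDl mxE. Qed.

Lemma tinnerZl x a v w : tinner x (a *: v) w = a * tinner x v w.
Proof. by rewrite /tinner -!scalemxAl mxE. Qed.

Lemma gram_tr x : (gram x)^T = gram x.
Proof. by rewrite /gram; apply: Defs.metric_sym; exact: coord_image_dom (dom_chart_at x). Qed.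

Lemma tinnerC x v w : tinner x v w = tinner x w v.
Proof.
transitivity ((v *m gram x *m w^T)^T 0 0); first by rewrite [RHS]mxE.
by rewrite !trmx_mul trmxK gram_tr mulmxA.
Qed.

Lemma tinnerDr x v w u : tinner x u (v + w) = tinner x u v + tinner x u w.
Proof. by rewrite tinnerC tinnerDl !(tinnerC _ u). Qed.

Lemma tinnerZr x a v w : tinner x w (a *: v) = a * tinner x w v.
Proof. by rewrite tinnerC tinnerZl (tinnerC _ w). Qed.

Lemma tinner0r x v : tinner x v 0 = 0.
Proof. by rewrite -(scale0r v) tinnerZr mul0r. Qed.

Lemma tinnerNr x v w : tinner x w (- v) = - tinner x w v.
Proof. by rewrite -scaleN1r tinnerZr mulN1r. Qed.

Lemma tinnerNl x v w : tinner x (- v) w = - tinner x v w.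
Proof. by rewrite -scaleN1r tinnerZl mulN1r. Qed.

Lemma tinner_gt0 x v : v != 0 -> 0 < tinner x v v.
Proof. exact/metric_posdef/coord_image_dom/dom_chart_at. Qed.

Lemma tinner_ge0 x v : 0 <= tinner x v v.
Proof.
have [->|/(tinner_gt0 x)/ltW//] := eqVneq v 0.
by rewrite tinner0r.
Qed.

Lemma tnorm_ge0 x v : 0 <= tnorm x v. Proof. exact: sqrtr_ge0. Qed.

Lemma tnorm_sqr x v : tnorm x v ^+ 2 = tinner x v v.
Proof. by rewrite sqr_sqrtr// tinner_ge0. Qed.

Lemma tnorm0 x : tnorm x 0 = 0.
Proof. by rewrite /tnorm tinner0r sqrtr0. Qed.

Lemma tnorm_eq0 x v : tnorm x v = 0 -> v = 0.
Proof.
move=> v0; apply/eqP/negPn/negP => /(tinner_gt0 x).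
by rewrite -tnorm_sqr v0 expr0n ltxx.
Qed.

Lemma tnormZ x a v : tnorm x (a *: v) = `|a| * tnorm x v.
Proof.
rewrite /tnorm tinnerZl tinnerZr mulrA -expr2 sqrtrM ?sqr_ge0//.
by rewrite sqrtr_sqr.
Qed.

Lemma tinner_CS x v w : `|tinner x v w| <= tnorm x v * tnorm x w.
Proof.
have [->|w0] := eqVneq w 0; first by rewrite tinner0r tnorm0 mulr0 normr0.
rewrite -ler_sqr ?nnegrE ?mulr_ge0 ?tnorm_ge0//.
rewrite exprMn !tnorm_sqr -normrX ger0_norm ?sqr_ge0//.
(* The component of [v] orthogonal to [w], scaled by the squared norm of [w] to avoid a division;
   positivity of its square is the Cauchy-Schwarz inequality up to that factor. *)
have := tinner_ge0 x (tinner x w w *: v - tinner x v w *: w).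
have := tinner_gt0 x w0.
rewrite !(tinnerDl, tinnerDr, tinnerZl, tinnerZr, tinnerNr, tinnerNl) (tinnerC _ w v).
set a := tinner x v v; set b := tinner x w w; set c := tinner x v w => b0 H.
rewrite -subr_ge0 -(pmulr_rge0 _ b0).
suff -> : b * (a * b - c ^+ 2) = b * (b * a) + c * - (b * c) + b * - (c * c) + c * c * b.
  by apply: le_trans H _; rewrite le_eqVlt; apply/orP; left; apply/eqP; ring.
ring.
Qed.

Lemma tnormD x v w : tnorm x (v + w) <= tnorm x v + tnorm x w.
Proof.
rewrite -ler_sqr ?nnegrE ?addr_ge0 ?tnorm_ge0// sqrrD !tnorm_sqr.
rewrite !(tinnerDl, tinnerDr) (tinnerC _ w v).
have := ler_norm (tinner x v w); have := tinner_CS x v w.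
lra.
Qed.

End tangent_inner_product.

Section gradient_rules.
Context {R : realType} {n : nat} (M : riemannianManifold R n).
Implicit Types (x : M) (D : set M) (f g : M -> R).

Lemma grad_near_eq f g x : (\forall y \near x, f y = g y) -> grad f x = grad g x.
Proof.
move=> fg; rewrite /grad; congr (_ *m _); apply/rowP => i; rewrite !mxE.
apply: near_eq_derive; exact: (near_param (dom_chart_at x) fg).
Qed.

Lemma grad_cst a x : grad (cst a : M -> R) x = 0.
Proof.
rewrite /grad (_ : differential _ x = 0) ?mul0mx//.
by apply/rowP => i; rewrite !mxE -[_ \o _]/(cst a) derive_cst.
Qed.

Lemma Ck1_derivable f D x i : Ck_on 1 D f -> D x ->
  derivable (f \o param (chart_at x)) (coord (chart_at x) x) (delta_mx 0 i).
Proof.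
move=> Cf Dx; have cx := dom_chart_at x.
by have [_ + _] := (is_Ck1P _ _).1 (Cf (chart_at x)) _ (coord_image cx Dx).
Qed.

Lemma gradD f g D x : Ck_on 1 D f -> Ck_on 1 D g -> D x ->
  grad (fun y => f y + g y) x = grad f x + grad g x.
Proof.
move=> Cf Cg Dx; rewrite /grad -mulmxDl; congr (_ *m _); apply/rowP => i.
rewrite !mxE; apply: deriveD; exact: Ck1_derivable Dx.
Qed.

Lemma gradZ f a D x : Ck_on 1 D f -> D x ->
  grad (fun y => a * f y) x = a *: grad f x.
Proof.
move=> Cf Dx; rewrite /grad scalemxAl; congr (_ *m _); apply/rowP => i.
rewrite !mxE; apply: deriveZ; exact: Ck1_derivable Dx.
Qed.

Lemma gradM f g D x : Ck_on 1 D f -> Ck_on 1 D g -> D x ->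
  grad (fun y => f y * g y) x = f x *: grad g x + g x *: grad f x.
Proof.
move=> Cf Cg Dx; rewrite /grad !scalemxAl -mulmxDl; congr (_ *m _).
apply/rowP => i; rewrite !mxE.
have cx := dom_chart_at x.
have := deriveM (Ck1_derivable (i := i) Cf Dx) (Ck1_derivable (i := i) Cg Dx).
by rewrite /= coordK.
Qed.

Lemma Ck_onB k D f g : open D -> Ck_on k D f -> Ck_on k D g ->
  Ck_on k D (fun x => f x - g x).
Proof.
move=> oD Cf Cg; rewrite (_ : (fun x => _) = (fun x => f x + (-1) * g x)).
  exact: (Ck_onD oD Cf (Ck_onM oD (@Ck_on_cst _ _ M k D (-1)) Cg)).
by apply/funext => x; rewrite mulN1r.
Qed.

Lemma gradB D f g x : open D -> Ck_on 1 D f -> Ck_on 1 D g -> D x ->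
  grad (fun x => f x - g x) x = grad f x - grad g x.
Proof.
move=> oD Cf Cg Dx; rewrite (_ : (fun x => _) = (fun x => f x + (-1) * g x)).
  have Cg1 := Ck_onM oD (@Ck_on_cst _ _ M 1 D (-1)) Cg.
  by rewrite (gradD Cf Cg1 Dx) (gradZ _ Cg Dx) scaleN1r.
by apply/funext => y; rewrite mulN1r.
Qed.

Lemma grad_comp f (F : R -> R) (G : R) D x : Ck_on 1 D f -> D x ->
  is_derive (f x) 1 F G -> grad (F \o f) x = G *: grad f x.
Proof.
move=> Cf Dx dF; rewrite /grad scalemxAl; congr (_ *m _).
apply/rowP => i; rewrite !mxE.
have cx := dom_chart_at x.
have df := Ck1_derivable (i := i) Cf Dx.
have [|_ <-//] := @is_derive_comp1 _ _ (f \o param (chart_at x)) F G _ _ df.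
by rewrite /= coordK.
Qed.

Lemma gradX f D x m : open D -> Ck_on 1 D f -> D x ->
  grad (fun y => f y ^+ m) x = (m%:R * f x ^+ m.-1) *: grad f x.
Proof.
move=> oD Cf Dx; apply: (grad_comp (F := (fun t : R => t ^+ m)) Cf Dx).
apply: DeriveDef; first exact: exprn_derivable.
by rewrite exp_derive [_ *: 1]mulr1.
Qed.

Lemma tinner_grad f x (v : 'rV[R]_n) :
  tinner x (grad f x) v = \sum_i v 0 i * differential f x 0 i.
Proof.
have gu : gram x \in unitmx by apply: metric_unit; exact: dom_chart_at.
rewrite /tinner /grad mulmxKV// mxE; apply: eq_bigr => i _.
by rewrite mulrC mxE.
Qed.

Lemma tnorm_grad_continuous f D x : open D -> D x -> Ck_on 1 D f ->
  {for x, continuous (fun y => tnorm y (grad f y))}.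
Proof.
move=> oD Dx Cf.
apply: (@continuous_comp _ _ _ (gprod f f) (@Num.sqrt R)).
  exact: (gprod_continuous oD Dx Cf Cf).
exact: sqrt_continuous.
Qed.

Lemma grad_supp f x : ~ supp f x -> grad f x = 0.
Proof.
move=> fx; rewrite -(grad_cst 0 x); apply: grad_near_eq.
have : open (~` supp f) by apply/closed_openC/closed_closure.
move=> oS; apply: filterS (open_nbhs_nbhs (conj oS fx)) => y /= fy.
apply/eqP; apply: contra_notT fy => fy.
exact: subset_closure.
Qed.

End gradient_rules.

(** * The flux and the one-variable profiles *)

Section structure_function.
Context {R : realType} (p : R) (A : R -> R).

Lemma derive_gt0_lt (f : R -> R) (s t : R) : s < t ->
  (forall r, s <= r <= t -> derivable f r 1) ->
  (forall r, s < r < t -> 0 < derive1 f r) -> f s < f t.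
Proof.
move=> st df f0.
have [||r + E] := @MVT R f (derive1 f) s t st.
- move=> r; rewrite in_itv/= => /andP[/ltW sr /ltW rt].
  by rewrite derive1E; apply/derivableP/df; rewrite sr.
- apply/continuous_in_subspaceT => r; rewrite inE/= in_itv/= => srt.
  by apply/differentiable_continuous/derivable1_diffP/df.
- by rewrite in_itv/= => /f0 fr; rewrite -subr_gt0 E mulr_gt0// subr_gt0.
Qed.

Hypothesis hA : structure_conditions p A.

Lemma structure_A0 : A 0 = 0.
Proof. by have [_ _ [? [? [? [? [_ []]]]]]] := hA. Qed.

Lemma structure_A_gt0 s : 0 < s -> 0 < A s.
Proof. by have [_ _ [? [? [? [? [_ [_ + _ _]]]]]]] := hA; exact. Qed.

Lemma structure_A_ge0 s : 0 <= s -> 0 <= A s.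
Proof.
by rewrite le_eqVlt => /predU1P[<-|/structure_A_gt0/ltW//]; rewrite structure_A0.
Qed.

(** For positive arguments [alpha * A r <= r * A' r] with [alpha > 0] and [A r > 0] forces a
    positive derivative. The endpoint 0, where [A] need not be differentiable, is settled by
    [A 0 = 0]. *)
Lemma structure_A_lt s t : 0 <= s -> s < t -> A s < A t.
Proof.
rewrite le_eqVlt => /predU1P[<- /structure_A_gt0|s0 st]; first by rewrite structure_A0.
have [_ dA [a [b [D1 [D2 [[/andP[a0 _] _ _ _] [_ Agt0 sA _]]]]]]] := hA.
apply: derive_gt0_lt => // r /andP[sr rt].
  by have [] := dA r (lt_le_trans s0 sr).
have r0 : 0 < r by exact: lt_trans sr.
have /andP[sAr _] := sA r r0.
rewrite -(pmulr_rgt0 _ r0); apply: lt_le_trans sAr.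
by apply: mulr_gt0 => //; exact: Agt0.
Qed.

Lemma structure_bounds : exists D1 D2 : R, [/\ 0 < D1, 0 < D2 &
  forall s, 0 <= s -> D1 * s `^ (p - 1) <= A s <= D2 * s `^ (p - 1)].
Proof.
by have [_ _ [a [b [D1 [D2 [[_ _ ? ?] [_ _ _ ?]]]]]]] := hA; exists D1, D2.
Qed.

Context {n : nat} (M : riemannianManifold R n).
Implicit Types (x : M) (v w : 'rV[R]_n).

Lemma fluxE x v : flux A x v = (A (tnorm x v) / tnorm x v) *: v.
Proof. by rewrite /flux; case: eqVneq => // ->; rewrite scaler0. Qed.

Lemma tinner_fluxE x v w :
  tinner x w (flux A x v) = A (tnorm x v) / tnorm x v * tinner x w v.
Proof. by rewrite fluxE tinnerZr. Qed.

Lemma tnorm_fluxE x v : A (tnorm x v) / tnorm x v * tnorm x v = A (tnorm x v).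
Proof.
have [v0|v0] := eqVneq (tnorm x v) 0; last by rewrite divfK.
by rewrite v0 mulr0 structure_A0.
Qed.

Lemma flux_coef_ge0 x v : 0 <= A (tnorm x v) / tnorm x v.
Proof. by rewrite divr_ge0 ?structure_A_ge0 ?tnorm_ge0. Qed.

Lemma tinner_flux_le x v w :
  `|tinner x w (flux A x v)| <= A (tnorm x v) * tnorm x w.
Proof.
rewrite tinner_fluxE normrM (ger0_norm (flux_coef_ge0 x v)).
rewrite -[in leRHS]tnorm_fluxE -mulrA ler_wpM2l ?flux_coef_ge0// mulrC.
exact: tinner_CS.
Qed.

Lemma tinner_flux_diag x v : tinner x v (flux A x v) = A (tnorm x v) * tnorm x v.
Proof. by rewrite tinner_fluxE -tnorm_sqr expr2 mulrA tnorm_fluxE. Qed.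

(** Cauchy-Schwarz bounds both mixed terms by their values for parallel vectors, which reduces
    monotonicity of the flux to that of the scalar function [A]. *)
Lemma flux_mono x v w :
  (A (tnorm x v) - A (tnorm x w)) * (tnorm x v - tnorm x w) <=
  tinner x (v - w) (flux A x v - flux A x w).
Proof.
set a := tnorm x v; set b := tnorm x w.
rewrite tinnerDl !(tinnerDr, tinnerNr, tinnerNl) !tinner_flux_diag !tinner_fluxE.
rewrite (tinnerC x w v) -/a -/b.
have c1 := le_trans (ler_norm _) (tinner_CS x v w).
have := ler_wpM2l (flux_coef_ge0 x v) c1.
have := ler_wpM2l (flux_coef_ge0 x w) c1.
rewrite -/a -/b.
have -> : A b / b * (a * b) = A b * a by rewrite mulrCA [X in a * X]tnorm_fluxE mulrC.
have -> : A a / a * (a * b) = A a * b by rewrite mulrA [X in X * b]tnorm_fluxE.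
lra.
Qed.

Lemma flux_mono_ge0 x v w : 0 <= tinner x (v - w) (flux A x v - flux A x w).
Proof.
apply: le_trans (flux_mono x v w).
have [ab|ab|->] := ltgtP (tnorm x v) (tnorm x w).
- rewrite mulr_le0// subr_le0; last exact: ltW.
  by apply/ltW/structure_A_lt => //; exact: tnorm_ge0.
- rewrite mulr_ge0// subr_ge0; last exact: ltW.
  by apply/ltW/structure_A_lt => //; exact: tnorm_ge0.
- by rewrite subrr mul0r.
Qed.

(** Strict monotonicity of [A] first forces equal norms. Both fluxes then have the same positive
    coefficient, and the left side is this coefficient times the squared norm of [v - w]. *)
Lemma flux_mono_eq0 x v w :
  tinner x (v - w) (flux A x v - flux A x w) = 0 -> v = w.
Proof.
move=> E; have := flux_mono x v w; rewrite E => le0.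
have ab : tnorm x v = tnorm x w.
  have [ab|ab|//] := ltgtP (tnorm x v) (tnorm x w); exfalso.
    have := structure_A_lt (tnorm_ge0 x v) ab; move: le0; rewrite leNgt.
    by rewrite nmulr_lgt0 ?subr_lt0// => /negP.
  have := structure_A_lt (tnorm_ge0 x w) ab; move: le0; rewrite leNgt.
  by rewrite pmulr_lgt0 ?subr_gt0// => /negP.
have [v0|v0] := eqVneq (tnorm x v) 0.
  by rewrite (tnorm_eq0 v0); move: v0; rewrite ab => /tnorm_eq0 ->.
apply/eqP; rewrite -subr_eq0; apply/eqP/(@tnorm_eq0 _ _ _ x).
move: E; rewrite !fluxE -ab -scalerBr tinnerZr -tnorm_sqr => /eqP.
rewrite mulf_eq0 mulf_eq0 invr_eq0 (negbTE v0) orbF expf_eq0/=.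
rewrite gt_eqF/= ?structure_A_gt0 ?lt_def ?v0 ?tnorm_ge0// => /eqP//.
Qed.

End structure_function.

(** * C^1 step and truncation on the line *)

Section one_variable_functions.
Context {R : realType}.
Implicit Types (t e : R).

(** A quadratic error bound identifies the derivative at one stroke, including at the points where a
    profile defined by cases changes its formula. *)
Lemma quadratic_is_derive (f : R -> R) (C t d : R) :
  (forall h, `|f (h + t) - f t - h * d| <= C * h ^+ 2) -> is_derive t 1 f d.
Proof.
move=> H.
have C1 : 0 < `|C| + 1 by rewrite ltr_wpDl.
have cvgd : (fun h => h^-1 *: (f (h *: 1 + t) - f t)) @ 0^' --> d.
  apply/cvgrPdist_le => e e0; near=> h.
  have h0 : h != 0 by near: h; exact: nbhs_dnbhs_neq.
  have he : `|h| <= e / (`|C| + 1).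
    by near: h; apply: dnbhs0_le; rewrite divr_gt0.
  rewrite scaler1.
  have -> : d - h^-1 *: (f (h + t) - f t) = - (h^-1 * (f (h + t) - f t - h * d)).
    by rewrite [_ *: _]/(_ * _) mulrBr mulKf// opprB.
  rewrite normrN normrM normfV ler_pdivrMl ?normr_gt0//.
  apply: le_trans (H h) _; move: he; rewrite ler_pdivlMr// => he.
  apply: (@le_trans _ _ ((`|C| + 1) * h ^+ 2)).
    by rewrite ler_wpM2r ?sqr_ge0// (le_trans (ler_norm C))// lerDl.
  rewrite -(ger0_norm (sqr_ge0 h)) normrX expr2 mulrCA.
  by rewrite ler_wpM2l// mulrC.
apply: DeriveDef; first by apply/cvg_ex; exists d.
exact/cvg_lim.
Unshelve. all: by end_near. Qed.

Lemma is_deriveB_fun (f g : R -> R) (t a b : R) : is_derive t 1 f a ->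
  is_derive t 1 g b -> is_derive t 1 (fun s => f s - g s) (a - b).
Proof. by move=> df dg; exact: is_deriveB. Qed.

Lemma is_deriveD_fun (f g : R -> R) (t a b : R) : is_derive t 1 f a ->
  is_derive t 1 g b -> is_derive t 1 (fun s => f s + g s) (a + b).
Proof. by move=> df dg; exact: is_deriveD. Qed.

Definition pos2 t := Num.max t 0 ^+ 2.

Lemma is_derive_pos2 t : is_derive t 1 pos2 (2 * Num.max t 0).
Proof.
apply: (@quadratic_is_derive _ 1) => h; rewrite /pos2 mul1r.
rewrite ler_norml; case: (leP t 0) => t0; case: (leP (h + t) 0) => ht0;
  apply/andP; split; nra.
Qed.

Lemma continuous_max0 : continuous (fun t => Num.max t 0).
Proof. by move=> t; apply: continuous_max; [exact: cvg_id|exact: cvg_cst]. Qed.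

(** A C^1 substitute for clamping to [0,1]: [pos2 (1 - t)] is 0 from 1 on, which flattens the right
    end, and at least 1 for [t <= 0], where the outer positive part flattens the left end. *)
Definition step t := pos2 (1 - pos2 (1 - t)).
Definition step' t := 4 * (Num.max (1 - pos2 (1 - t)) 0 * Num.max (1 - t) 0).

Lemma is_derive_step t : is_derive t 1 step (step' t).
Proof.
have d1 : is_derive t 1 (fun s => 1 - s) (- 1).
  have H := is_deriveB_fun (is_derive_cst (1 : R) t 1) (is_derive_id t 1).
  by apply: is_derive_eq H _; rewrite sub0r.
have d2 := is_derive_comp1 (@ex_derive _ _ _ _ _ _ _ d1) (is_derive_pos2 (1 - t)).
rewrite derive_val in d2.
have d3 : is_derive t 1 (fun s => 1 - pos2 (1 - s)) (2 * Num.max (1 - t) 0).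
  have H := is_deriveB_fun (is_derive_cst (1 : R) t 1) d2.
  by apply: is_derive_eq H _; ring.
have d4 := is_derive_comp1 (@ex_derive _ _ _ _ _ _ _ d3) (is_derive_pos2 _).
rewrite derive_val in d4.
by apply: is_derive_eq d4 _; rewrite /step'; ring.
Qed.

Lemma continuous_pos2 : continuous pos2.
Proof.
by move=> t; have d := is_derive_pos2 t; apply/differentiable_continuous/derivable1_diffP.
Qed.

Lemma continuous_step' : continuous step'.
Proof.
have c1 : continuous (fun t : R => 1 - t).
  by move=> t; apply: continuousB_for; [exact: continuous_cst_for|exact: cvg_id].
move=> t; apply: (@continuousM_for _ _ (fun=> 4)
  (fun t => Num.max (1 - pos2 (1 - t)) 0 * Num.max (1 - t) 0)); first exact: continuous_cst_for.
apply: continuousM_for.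
  apply: (@continuous_comp _ _ _ (fun t => 1 - pos2 (1 - t)) (fun t => Num.max t 0)).
    apply: continuousB_for; first exact: continuous_cst_for.
    apply: (@continuous_comp _ _ _ (fun t => 1 - t) pos2); first exact: c1.
    exact: continuous_pos2.
  exact: continuous_max0.
apply: (@continuous_comp _ _ _ (fun t => 1 - t) (fun t => Num.max t 0)); first exact: c1.
exact: continuous_max0.
Qed.

Lemma pos2_ge0 t : 0 <= pos2 t. Proof. exact: sqr_ge0. Qed.

Lemma pos2_le1 t : t <= 1 -> pos2 t <= 1.
Proof.
move=> t1; apply: exprn_ile1; last by rewrite ge_max t1 ler01.
by rewrite le_max lexx orbT.
Qed.

Lemma pos2_ge1 t : 1 <= t -> 1 <= pos2 t.
Proof. by move=> t1; rewrite /pos2 max_l ?exprn_ege1// (le_trans ler01). Qed.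

Lemma step_itv t : 0 <= step t <= 1.
Proof. by rewrite pos2_ge0/= pos2_le1// lerBlDr lerDl pos2_ge0. Qed.

Lemma step_le0 t : t <= 0 -> step t = 0.
Proof.
move=> t0; rewrite /step {1}/pos2 max_r ?expr0n// subr_le0 pos2_ge1//.
by rewrite lerDl oppr_ge0.
Qed.

Lemma step_ge1 t : 1 <= t -> step t = 1.
Proof.
move=> t1; rewrite /step [pos2 (1 - t)]/pos2 max_r ?subr_le0//.
by rewrite expr0n/= subr0 /pos2 max_l// expr1n.
Qed.

Lemma step'_le t : `|step' t| <= 4.
Proof.
have max0 (s : R) : 0 <= Num.max s 0 by rewrite le_max lexx orbT.
rewrite /step' normrM ger0_norm// ger_pMr// ger0_norm ?mulr_ge0//.
(* The factor [max (1 - t) 0] exceeds 1 only for negative [t], and there the other factor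
   vanishes. *)
have [t0|t0] := leP t 0.
  rewrite [Num.max (1 - pos2 _) 0]max_r ?mul0r//.
  by rewrite subr_le0 pos2_ge1// lerDl oppr_ge0.
rewrite mulr_ile1 ?ge_max ?ler01 ?andbT// lerBlDr lerDl ?pos2_ge0//.
exact: ltW.
Qed.

(* Bounded, so that [eta * truncation e (u - v)] is an admissible multiple of a
   cut-off, and strictly increasing exactly on [t > e]. *)
Definition truncation e t := 1 - (1 + pos2 (t - e))^-1.
Definition truncation' e t := 2 * Num.max (t - e) 0 / (1 + pos2 (t - e)) ^+ 2.

Lemma pos2D1_gt0 t : 0 < 1 + pos2 t.
Proof. by have := pos2_ge0 t; lra. Qed.

Lemma is_derive_truncation e t : is_derive t 1 (truncation e) (truncation' e t).
Proof.
have d1 : is_derive t 1 (fun s => s - e) 1.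
  have H := is_deriveB_fun (is_derive_id t 1) (is_derive_cst e t 1).
  by apply: is_derive_eq H _; rewrite subr0.
have d2 := is_derive_comp1 (@ex_derive _ _ _ _ _ _ _ d1) (is_derive_pos2 (t - e)).
rewrite derive_val mulr1 in d2.
have d3 := is_deriveD_fun (is_derive_cst (1 : R) t 1) d2.
have n0 : 1 + pos2 (t - e) != 0 by rewrite gt_eqF// pos2D1_gt0.
have dV := is_derive_comp1 (@ex_derive _ _ _ _ _ _ _ d3) (is_derive_inv n0).
rewrite derive_val in dV.
have d4 := is_deriveB_fun (is_derive_cst (1 : R) t 1) dV.
apply: is_derive_eq d4 _; rewrite /truncation' expr2 invfM; ring.
Qed.

Lemma continuous_truncation' e : continuous (truncation' e).
Proof.
have c1 : continuous (fun t => t - e).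
  by move=> t; apply: continuousB_for; [exact: cvg_id|exact: continuous_cst_for].
move=> t; apply: (@continuousM_for _ _ (fun t => 2 * Num.max (t - e) 0)
  (fun t => ((1 + pos2 (t - e)) ^+ 2)^-1)).
  apply: continuousM_for; first exact: continuous_cst_for.
  apply: (@continuous_comp _ _ _ (fun t => t - e) (fun t => Num.max t 0)); first exact: c1.
  exact: continuous_max0.
have cp : {for t, continuous (fun s => 1 + pos2 (s - e))}.
  apply: continuousD_for; first exact: continuous_cst_for.
  apply: (@continuous_comp _ _ _ (fun t => t - e) pos2); first exact: c1.
  exact: continuous_pos2.
apply: continuousV; first by rewrite expf_neq0// gt_eqF// pos2D1_gt0.
exact: (continuousM_for cp cp).
Qed.

Lemma truncation_ge0 e t : 0 <= truncation e t.
Proof.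
rewrite /truncation subr_ge0 invf_le1 ?pos2D1_gt0//.
by rewrite lerDl pos2_ge0.
Qed.

(** With [s = max (t - e) 0] the truncation is [s^2 / (1 + s^2)], and
    [s (1 + s^2) - s^2 = s (1 - s + s^2)] is nonnegative. The bound by [|t|] makes the test function
    at most [|u| + |v|]. *)
Lemma truncation_le e t : 0 <= e -> truncation e t <= `|t|.
Proof.
move=> e0; rewrite /truncation.
have := pos2D1_gt0 (t - e); rewrite /pos2; set s := Num.max _ _ => s1.
have s0 : 0 <= s by rewrite le_max lexx orbT.
have st : s <= `|t|.
  by rewrite ge_max normr_ge0 andbT; have := ler_norm t; lra.
apply: le_trans st; set i := _^-1.
have i1 : i * (1 + s ^+ 2) = 1 by rewrite mulVf// gt_eqF.
have i0 : 0 <= i by rewrite invr_ge0 ltW.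
have : 0 <= i * (s * (1 - s + s ^+ 2)).
  apply: mulr_ge0 => //; apply: mulr_ge0 => //.
  have [s1'|/ltW s1'] := leP s 1; first by have := sqr_ge0 s; lra.
  by have := ler_wpM2l s0 s1'; rewrite mulr1 expr2; lra.
suff -> : i * (s * (1 - s + s ^+ 2)) = s * (i * (1 + s ^+ 2)) - i * (1 + s ^+ 2) + i.
  by rewrite i1; lra.
ring.
Qed.

Lemma truncation_eq0 e t : t <= e -> truncation e t = 0.
Proof.
move=> te; rewrite /truncation /pos2 max_r ?subr_le0//.
by rewrite expr0n addr0 invr1 subrr.
Qed.

Lemma truncation'_ge0 e t : 0 <= truncation' e t.
Proof.
by rewrite /truncation' divr_ge0// ?sqr_ge0// mulr_ge0// le_max lexx orbT.
Qed.

Lemma truncation'_gt0 e t : e < t -> 0 < truncation' e t.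
Proof.
move=> et; rewrite divr_gt0 ?exprn_gt0 ?pos2D1_gt0// mulr_gt0//.
by rewrite lt_max subr_gt0 et.
Qed.

Lemma truncation_neq0 e t : truncation e t != 0 -> e < t.
Proof. by apply: contraNT; rewrite -leNgt => /truncation_eq0/eqP. Qed.

End one_variable_functions.

(** * The Riemannian volume *)

Section posdef_determinant.
Context {R : realType} {n : nat}.
Implicit Types (G : 'M[R]_n).

Let posdef G := forall v : 'rV[R]_n, v != 0 -> 0 < (v *m G *m v^T) 0 0.

Let posdef_unit G : posdef G -> G \in unitmx.
Proof.
move=> Gp; rewrite -row_free_unit -kermx_eq0; apply/eqP/row_matrixP => i.
rewrite row0; apply/eqP; apply/negP => /negP ki.
by have := Gp _ ki; rewrite -row_mul mulmx_ker row0 mul0mx mxE ltxx.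
Qed.

(* The determinant does not vanish along the segment from the identity to [G]. *)
Lemma posdef_det_gt0 G :
  (forall v : 'rV[R]_n, v != 0 -> 0 < (v *m G *m v^T) 0 0) -> 0 < \det G.
Proof.
move=> Gp.
pose H (t : R) := t *: G + (1 - t) *: 1%:M.
have H0 t : 0 <= t <= 1 -> \det (H t) != 0.
  move=> /andP[t0 t1]; rewrite -unitfE -unitmxE; apply: posdef_unit => v v0.
  have v1 : 0 < (v *m v^T) 0 0.
    rewrite mxE lt_def sumr_ge0 ?andbT; last by move=> i _; rewrite mxE -expr2 sqr_ge0.
    rewrite psumr_eq0; last by move=> i _; rewrite mxE -expr2 sqr_ge0.
    apply: contra v0 => /allP v0; apply/eqP/rowP => i; rewrite [RHS]mxE.
    have /= := v0 i (mem_index_enum i).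
    by rewrite mxE -expr2 sqrf_eq0 => /eqP.
  rewrite mulmxDr mulmxDl mxE -!scalemxAr -!scalemxAl mulmx1.
  rewrite [X in X + _]mxE [X in _ + X]mxE.
  have := Gp v v0; move: t0 t1; rewrite le_eqVlt => /predU1P[<-|t0] t1 vG.
    by rewrite mul0r add0r subr0 mul1r.
  apply: ltr_pwDl; first exact: mulr_gt0.
  by apply: mulr_ge0; [rewrite subr_ge0|exact: ltW].
rewrite ltNge; apply/negP => G0.
have H1 : \det (H 1) = \det G by rewrite /H scale1r subrr scale0r addr0.
have H00 : \det (H 0) = 1 by rewrite /H scale0r subr0 scale1r add0r det1.
have [||t] := @IVT R (fun t => \det (H t)) 0 1 0 ler01.
- apply: continuous_subspaceT => t; apply: continuous_det_for => i j.
  have -> : (fun t : R => H t i j) =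
      (fun t => t * G i j + (1 - t) * (1%:M : 'M[R]_n) i j).
    by apply/funext => s; rewrite !mxE.
  apply: continuousD_for; apply: continuousM_for; try exact: continuous_cst_for.
    exact: cvg_id.
  by apply: continuousB_for; [exact: continuous_cst_for|exact: cvg_id].
- by rewrite H1 H00 ge_min G0 orbT le_max ler01.
- by rewrite in_itv/= => /H0 + E; rewrite E eqxx.
Qed.

End posdef_determinant.

Section ge0_integral_monotone.
Context d (T : measurableType d) (R : realType).
Variable mu : {measure set T -> \bar R}.
Local Open Scope ereal_scope.

(** The integral of a nonnegative function is a supremum over the simple functions below it, so a
    larger function has more competitors. *)
Lemma ge0_le_integral_nomeas (D : set T) (f g : T -> \bar R) :
  (forall x, D x -> 0 <= f x) -> (forall x, D x -> f x <= g x) ->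
  \int[mu]_(x in D) f x <= \int[mu]_(x in D) g x.
Proof.
move=> f0 fg; rewrite !ge0_integralE//; last first.
  by move=> x Dx; exact: le_trans (f0 x Dx) (fg x Dx).
apply: ereal_sup_le => _ [h hf <-]; exists h => // x.
apply: le_trans (hf x) _; rewrite /patch; case: ifPn => // /set_mem.
exact: fg.
Qed.

End ge0_integral_monotone.

(** * Boxes, and local bounds for the volume *)

Section lebesgue_box.
Context {R : realType}.
Local Open Scope ereal_scope.

Definition tuple_box n (s : n.-tuple R) (r : R) : set (n.-tuple R) :=
  \bigcap_(i in [set: 'I_n]) ((fun t => tnth t i) @^-1` ball (tnth s i) r).

Lemma measurable_tuple_box n (s : n.-tuple R) r : measurable (tuple_box s r).
Proof.
apply: fin_bigcap_measurable => // i _.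
by rewrite -[X in measurable X]setTI; apply: measurable_tnth => //; exact: measurable_ball.
Qed.

Lemma lebesgue_tuple_box n (s : n.-tuple R) (r : R) : (0 < r)%R ->
  0 < lebesgue_tuple n (tuple_box s r) < +oo.
Proof.
move=> r0; elim: n s => [|n ih] s.
  rewrite /= /dirac indicE mem_set; first by rewrite lte01 ltry.
  by move=> [].
case/tupleP: s => s0 s; rewrite /= /lebesgue_tupleS /pushforward.
have -> : @tuple_cons R n @^-1` tuple_box [tuple of s0 :: s] r =
    ball s0 r `*` tuple_box s r.
  apply/seteqP; split => [[x t] H|[x t] [Hx Ht]].
    split=> [|i _]; first by have := H ord0 Logic.I; rewrite /= !tnth0.
    by have := H (lift ord0 i) Logic.I; rewrite /= !tnthS.
  move=> i _; have [j ->|->] := unliftP ord0 i.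
    by have := Ht j Logic.I; rewrite /= !tnthS.
  by move: Hx; rewrite /= !tnth0.
rewrite product_measure1E; [|exact: measurable_ball|exact: measurable_tuple_box].
have /andP[b0 boo] := ih s.
have /andP[m0 moo] : 0 < lebesgue_measure (ball s0 r) < +oo.
  by rewrite lebesgue_measure_ball ?(ltW r0)// lte_fin mulrn_wgt0//= ltry.
apply/andP; split; first exact: mule_gt0.
by apply: lte_mul_pinfty => //; rewrite ge0_fin_numE.
Qed.

End lebesgue_box.

Section riemannian_volume.
Context {R : realType} {n : nat} (M : riemannianManifold R n).
Variable vol : {measure set (borel M) -> \bar R}.
Hypothesis hvol : is_riemannian_volume vol.
Implicit Types (c : chart M) (x : M) (D O : set M).

Lemma open_borel O : open O -> measurable (O : set (borel M)).
Proof. by move=> oO; exact: sub_sigma_algebra. Qed.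

Lemma density_continuous c x : dom c x ->
  {for coord c x, continuous (fun z => Num.sqrt (\det (metric c z)))}.
Proof.
move=> cx; apply: (@continuous_comp _ _ _ (fun z => \det (metric c z)) (@Num.sqrt R)).
  apply: continuous_det_for => k l; apply: continuous_entry_for.
  have := @metric_smooth _ _ M c 0 => -[+ _]; apply; exact: coord_image_dom.
exact: sqrt_continuous.
Qed.

Lemma density_gt0 c x : dom c x -> 0 < Num.sqrt (\det (metric c (coord c x))).
Proof.
move=> cx; rewrite sqrtr_gt0; apply: posdef_det_gt0.
exact/metric_posdef/coord_image_dom.
Qed.

(** In a chart a small ball of the sup norm is a box, of positive finite Lebesgue measure, and by
    continuity the density stays between half and twice its positive value at [x]. Positivity later
    turns almost everywhere into everywhere; finiteness bounds the volume of compact sets. *)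
Lemma small_open_volume O x : open O -> O x ->
  exists D, [/\ open D, D x, D `<=` O & (0 < vol D < +oo)%E].
Proof.
move=> oO Ox; have cx := dom_chart_at x; set c := chart_at x in cx *.
pose z0 := coord c x; pose g z := Num.sqrt (\det (metric c z)).
have g0 : 0 < g z0 by exact: density_gt0.
have Oz : nbhs z0 (coord c @` (dom c `&` O)).
  by apply: open_nbhs_nbhs; split; [exact: open_coord_image|exact: coord_image].
have gz : nbhs z0 [set z | `|g z0 - g z| <= g z0 / 2].
  by have /cvgrPdist_le /(_ (g z0 / 2)) := density_continuous cx; apply; rewrite divr_gt0.
have : nbhs z0 (coord c @` (dom c `&` O) `&` [set z | `|g z0 - g z| <= g z0 / 2]).
  exact: filterI.
move=> /nbhs_ballP[r /= r0 zr].
pose D := dom c `&` (coord c @^-1` ball z0 r).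
have coordD : coord c @` D = ball z0 r.
  apply/seteqP; split => [_ [y [cy Dy] <-]//|z zz].
  by have [[y [cy Oy] yz] _] := zr z zz; exists y => //; split => //; rewrite /= yz.
have DO : D `<=` O.
  move=> y [cy Dy]; have [yO _] := zr _ Dy.
  exact: coord_imageI yO cy.
have oD : open D.
  rewrite openE => y [cy Dy]; apply: filterI; first exact: nbhs_dom.
  by apply: near_coord => //; apply: open_nbhs_nbhs; split => //; exact: ball_open.
exists D; split => //; first by split => //; exact: ballxx.
rewrite (@hvol c D (open_borel oD)); last by move=> y [].
pose s := [tuple z0 0 i | i < n].
have -> : [set t | (coord c @` D) (row_of_tuple t)] = tuple_box s r.
  rewrite coordD; apply/seteqP; split => [t [_ H] i _|t H].
    by have := H 0 i; rewrite /= mxE tnth_mktuple.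
  split => // i j; rewrite ord1 mxE; have := H j Logic.I.
  by rewrite /= tnth_mktuple.
have /andP[b0 boo] := lebesgue_tuple_box s r0.
have gb t : tuple_box s r t -> g z0 / 2 <= g (row_of_tuple t) <= g z0 * 2.
  move=> H; have [_ /=] : (coord c @` (dom c `&` O) `&`
      [set z | `|g z0 - g z| <= g z0 / 2]) (row_of_tuple t).
    apply: zr; split => // i j; rewrite ord1 mxE; have := H j Logic.I.
    by rewrite /= tnth_mktuple.
  by rewrite ler_norml => /andP[h1 h2]; apply/andP; split; lra.
have mb := measurable_tuple_box s r.
apply/andP; split.
  apply: (@lt_le_trans _ _ (\int[lebesgue_tuple n]_(t in tuple_box s r) (cst (g z0 / 2)%:E) t)%E).
    by rewrite integral_cst// mule_gt0// lte_fin divr_gt0.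
  apply: ge0_le_integral_nomeas => t H; first by rewrite lee_fin divr_ge0// ltW.
  by rewrite lee_fin; have /andP[] := gb t H.
apply: (@le_lt_trans _ _ (\int[lebesgue_tuple n]_(t in tuple_box s r) (cst (g z0 * 2)%:E) t)%E).
  apply: ge0_le_integral_nomeas => t H; first by rewrite lee_fin sqrtr_ge0.
  by rewrite lee_fin; have /andP[] := gb t H.
by rewrite integral_cst// lte_mul_pinfty// lee_fin mulr_ge0// ltW.
Qed.

Lemma volume_open_gt0 O x : open O -> O x -> (0 < vol O)%E.
Proof.
move=> oO Ox; have [D [oD Dx DO /andP[D0 _]]] := small_open_volume oO Ox.
by apply: lt_le_trans D0 _; apply: le_measure => //; rewrite inE; exact: open_borel.
Qed.

Lemma compact_finite_volume C : compact C ->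
  exists O, [/\ open O, C `<=` O & (vol O < +oo)%E].
Proof.
move=> cC.
pose P D := open D /\ (vol D < +oo)%E.
pose F x := xget set0 [set D | P D /\ D x].
have FP x : P (F x) /\ F x x.
  apply: (@xgetPex _ set0 [set D | P D /\ D x]).
  have [D [oD Dx _ /andP[_ Doo]]] := small_open_volume openT (Logic.I : [set: M] x).
  by exists D.
move: cC; rewrite compact_cover => /(_ M setT F).
case=> [x _|x Cx|J _ CJ]; first exact: (FP x).1.1.
  by exists x => //; exact: (FP x).2.
exists (cover [set` J] F); split => //; rewrite /cover.
  by apply: bigcup_open => x _; exact: (FP x).1.1.
rewrite bigcup_fset.
suff H (s : seq M) : measurable (\big[setU/set0]_(i <- s) F i : set (borel M)) /\
    (vol (\big[setU/set0]_(i <- s) F i) < +oo)%E by exact: (H _).2.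
elim: s => [|x s [ms soo]].
  by rewrite big_nil; split; [exact: measurable0|rewrite measure0 ltry].
have mF : measurable (F x : set (borel M)) by apply: open_borel; exact: (FP x).1.1.
rewrite big_cons; split; first exact: measurableU.
apply: (le_lt_trans (measureU2 vol mF ms)).
by apply: lte_add_pinfty => //; exact: (FP x).1.2.
Qed.

End riemannian_volume.

(** * Energy estimates and comparison *)

Section young.
Context {R : realType}.
Implicit Types (a b d xi p : R).

(* By cases on whether [a <= d * xi * b]. *)
Lemma weighted_young p q a b d xi : 1 < p -> (0 < q)%N -> p <= q%:R ->
  0 <= a -> 0 <= b -> 0 < d -> 0 <= xi <= 1 ->
  a * xi ^+ q.-1 * b `^ (p - 1) <=
  d * (xi ^+ q * b `^ p) + d `^ (1 - p) * a `^ p.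
Proof.
move=> p1 q0 pq a0 b0 d0 /andP[xi0 xi1].
have p0 : 0 < p by exact: lt_trans p1.
have [le_a|lt_a] := leP a (d * xi * b).
  apply: (@le_trans _ _ (d * xi * b * xi ^+ q.-1 * b `^ (p - 1))).
    by rewrite ler_wpM2r ?powR_ge0// ler_wpM2r// exprn_ge0.
  have -> : d * xi * b * xi ^+ q.-1 * b `^ (p - 1) =
      d * ((xi * xi ^+ q.-1) * (b * b `^ (p - 1))) by ring.
  rewrite -exprS prednK// mulr_powRB1//.
  by rewrite lerDl mulr_ge0 ?powR_ge0.
have ad0 : 0 <= a / d by rewrite divr_ge0// ltW.
apply: (@le_trans _ _ (d `^ (1 - p) * a `^ p)); last first.
  by rewrite lerDr mulr_ge0 ?mulr_ge0 ?powR_ge0 ?exprn_ge0// ltW.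
(* Here [p <= q] enters: on [0,1] the larger exponent gives the smaller power. *)
have xq : xi ^+ q.-1 <= xi `^ (p - 1).
  rewrite -powR_mulrn//.
  have [->|x0] := eqVneq xi 0.
    rewrite powR0; first exact: powR_ge0.
    have : 1 < q%:R :> R by exact: lt_le_trans pq.
    by rewrite ltr1n; case: (q) => [|[|?]]//= _; rewrite pnatr_eq0.
  apply: ger_powR; first by rewrite lt_def x0 xi0 xi1.
  by rewrite -subn1 natrB// lerB.
apply: (@le_trans _ _ (a * (a / d) `^ (p - 1))).
  rewrite -mulrA ler_wpM2l//.
  apply: (@le_trans _ _ (xi `^ (p - 1) * b `^ (p - 1))).
    by rewrite ler_wpM2r ?powR_ge0.
  rewrite -powRM//; apply: ge0_ler_powR; rewrite ?nnegrE ?ad0 ?mulr_ge0//.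
    by rewrite subr_ge0 ltW.
  by rewrite ler_pdivlMr// mulrC mulrA ltW.
rewrite powRM ?invr_ge0 ?(ltW d0)// mulrA mulr_powRB1// mulrC.
by rewrite -[d^-1]powR_inv1 ?(ltW d0)// -powRrM mulN1r opprB.
Qed.

Lemma powRD_le p a b : 0 <= p -> 0 <= a -> 0 <= b ->
  (a + b) `^ p <= 2 `^ p * (a `^ p + b `^ p).
Proof.
move=> p0; wlog ab : a b / a <= b.
  move=> H a0 b0; have [/H|/ltW/H] := leP a b; first exact.
  by rewrite addrC [X in _ * X]addrC; exact.
move=> a0 b0; apply: (@le_trans _ _ ((2 * b) `^ p)).
  apply: ge0_ler_powR; rewrite ?nnegrE ?addr_ge0 ?mulr_ge0//.
  by rewrite mulr2n mulrDl mul1r lerD2r.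
by rewrite powRM// ler_wpM2l ?powR_ge0// lerDr powR_ge0.
Qed.

End young.

Section structure_function_continuity.
Context {R : realType} (p : R) (A : R -> R).
Hypothesis hA : structure_conditions p A.

(** [A] is continuous only on the nonnegative half-line; precomposing with [max s 0] extends it to a
    continuous function on the line without changing it on norms. *)
Lemma structure_continuous : continuous (fun s : R => A (Num.max s 0)).
Proof.
have [/continuous_within_itvcyP[cA cA0] _ _] := hA.
move=> s; have [s0|s0|->] := ltgtP s 0.
- apply: (@continuous_near_eq _ _ (fun=> A 0)); last exact: cst_continuous.
  near=> t; rewrite max_r//; near: t; apply: filterS (lt_nbhsl s0) => t; exact: ltW.
- apply: (@continuous_near_eq _ _ A).
    near=> t; rewrite max_l//; near: t; apply: filterS (lt_nbhsr s0) => t; exact: ltW.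
  by apply: cA; rewrite in_itv/= andbT.
- apply/cvgrPdist_lt => e e0; rewrite maxxx.
  move/cvgrPdist_lt : cA0 => /(_ e e0).
  rewrite /at_right !near_withinE => H; near=> t.
  have [t0|t0] := leP t 0; first by rewrite subrr normr0.
  by move: t0; near: t.
Unshelve. all: by end_near. Qed.

End structure_function_continuity.

Section borel_integration.
Context {R : realType} {n : nat} (M : riemannianManifold R n).
Variable vol : {measure set (borel M) -> \bar R}.
Hypothesis hvol : is_riemannian_volume vol.
Implicit Types (D S : set M) (f g : M -> R).

Lemma compact_closed_manifold S : compact S -> closed S.
Proof. by apply: compact_closed; exact: manifold_hausdorff. Qed.

Lemma continuous_borel D f : open D -> (forall x, D x -> {for x, continuous f}) ->
  measurable_fun (D : set (borel M)) f.
Proof.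
move=> oD cf; apply: (measurability _ (RGenOInfty.measurableE R)).
have oP (a : R) : open (D `&` f @^-1` `]a, +oo[ : set M).
  rewrite openE => x [Dx fx]; apply: filterI; first exact: open_nbhs_nbhs.
  by apply: (cf x Dx); apply: open_nbhs_nbhs; split => //; exact: rray_open.
by move=> _ [_ [a ->] <-]; apply: open_borel; exact: oP.
Qed.

Lemma compact_continuous_bounded S g : compact S ->
  (forall x, S x -> {for x, continuous g}) ->
  exists2 C, 0 <= C & forall x, S x -> g x <= C.
Proof.
move=> cS cg; have [[x0 Sx0]|/nonemptyPn S0] := pselect (S !=set0); last first.
  by exists 0 => // x; rewrite S0.
have cw : {within S, continuous g}.
  by apply: continuous_in_subspaceT => x /set_mem; exact: cg.
have [|c Sc H] := @compact_EVT_max M R g S _ cS cw; first by exists x0.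
exists `|g c| => // x Sx; apply: le_trans (ler_norm _).
by apply: H; exact/mem_set.
Qed.

(** The majorant [g] is bounded on the compact set [S], which lies in an open set of finite volume.
    Continuity is asked of [g] and only measurability of [f], which suits the flux. *)
Lemma integrable_compact_support D S f g : open D -> compact S -> S `<=` D ->
  measurable_fun (D : set (borel M)) f -> (forall x, D x -> ~ S x -> f x = 0) ->
  (forall x, S x -> {for x, continuous g}) -> (forall x, S x -> `|f x| <= g x) ->
  vol.-integrable D (EFin \o f).
Proof.
move=> oD cS SD mf f0 cg fg.
have [C C0 gC] := compact_continuous_bounded cS cg.
have [U [oU SU volU]] := compact_finite_volume hvol cS.
have mD := open_borel oD; have mU := open_borel oU.
apply/integrableP; split; first exact/measurable_EFinP.
apply: (@le_lt_trans _ _ (\int[vol]_(x in D) (C%:E * (\1_U x)%:E))%E).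
  apply: ge0_le_integral_nomeas => x Dx; first exact: abse_ge0.
  rewrite -EFinM lee_fin.
  have [Sx|Sx] := pselect (S x).
    by rewrite indicE mem_set ?mulr1; [exact: le_trans (fg x Sx) (gC x Sx)|exact: SU].
  by rewrite /= f0// normr0 mulr_ge0.
rewrite ge0_integralZl//; last first.
  by apply/measurable_EFinP; exact: measurable_indic.
rewrite integral_indic//; apply: lte_mul_pinfty => //.
apply: le_lt_trans volU; apply: le_measure; rewrite ?inE//.
exact: measurableI.
Qed.

End borel_integration.

(** * Weak solutions and the Caccioppoli inequality *)

Section weak_solutions.
Context {R : realType} {n : nat} (M : riemannianManifold R n).
Variable vol : {measure set (borel M) -> \bar R}.
Hypothesis hvol : is_riemannian_volume vol.
Variables (p : R) (A : R -> R).
Hypothesis hp : 1 < p.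
Hypothesis hA : structure_conditions p A.
Variable D : set M.
Hypothesis oD : open D.
Implicit Types (u v f phi xi : M -> R).

Local Notation gnorm f := (fun x => tnorm x (grad f x)).

Lemma measurable_gnorm f : Ck_on 1 D f ->
  measurable_fun (D : set (borel M)) (gnorm f).
Proof.
by move=> Cf; apply: continuous_borel => // x Dx; exact: (tnorm_grad_continuous oD Dx Cf).
Qed.

Lemma measurable_flux phi u : Ck_on 1 D phi -> Ck_on 1 D u ->
  measurable_fun (D : set (borel M))
    (fun x => tinner x (grad phi x) (flux A x (grad u x))).
Proof.
move=> Cphi Cu.
have mu := measurable_gnorm Cu.
(* The power [-1] agrees with the inverse on norms, 0 included, and is measurable as a real power
   although the inverse is discontinuous at 0. *)
pose k x := A (Num.max (tnorm x (grad u x)) 0) * tnorm x (grad u x) `^ (-1) *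
  gprod phi u x.
rewrite (_ : (fun x => _) = k); last first.
  apply/funext => x; rewrite tinner_fluxE /k max_l ?tnorm_ge0//.
  by rewrite powR_inv1 ?tnorm_ge0.
apply: measurable_funM; first apply: measurable_funM.
- apply: (@measurableT_comp _ _ _ _ _ _ (fun s : R => A (Num.max s 0))) mu.
  by apply: continuous_measurable_fun; exact: structure_continuous hA.
- exact: (measurableT_comp (measurable_powR (-1)) mu).
- by apply: continuous_borel => // x Dx; exact: (gprod_continuous oD Dx Cphi Cu).
Qed.

Lemma integrable_flux phi u : Ck_compact 1 D phi -> Ck_on 1 D u ->
  vol.-integrable D
    (EFin \o (fun x => tinner x (grad phi x) (flux A x (grad u x)))).
Proof.
move=> [Cphi cphi sphi] Cu.
have Cphi' := Ck_on_sub (@subsetT _ D) Cphi.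
apply: (@integrable_compact_support _ _ _ _ hvol D (supp phi) _
  (fun x => A (Num.max (tnorm x (grad u x)) 0) * tnorm x (grad phi x))) => //.
- exact: measurable_flux.
- by move=> x _ /grad_supp ->; rewrite tinnerC tinner0r.
- move=> x /sphi Dx; apply: continuousM_for; last exact: (tnorm_grad_continuous oD Dx Cphi').
  apply: (@continuous_comp _ _ _ (gnorm u) (fun s => A (Num.max s 0))).
    exact: (tnorm_grad_continuous oD Dx Cu).
  exact: (structure_continuous hA).
- by move=> x _; rewrite max_l ?tnorm_ge0//; exact: (tinner_flux_le hA).
Qed.

Lemma integrable_powR S f : compact S -> S `<=` D ->
  (forall x, D x -> {for x, continuous f}) -> (forall x, D x -> 0 <= f x) ->
  (forall x, D x -> ~ S x -> f x = 0) ->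
  vol.-integrable D (EFin \o (fun x => f x `^ p)).
Proof.
move=> cS SD cf f0 fS.
have p0 : 0 < p by exact: lt_trans hp.
have [C C0 fC] := compact_continuous_bounded cS (fun x Sx => cf x (SD x Sx)).
apply: (@integrable_compact_support _ _ _ _ hvol D S _ (fun=> C `^ p)) => //.
- apply: (measurableT_comp (measurable_powR p)).
  exact: continuous_borel.
- by move=> x Dx Sx; rewrite fS// powR0// gt_eqF.
- by move=> x _; exact: continuous_cst_for.
- move=> x Sx; rewrite ger0_norm ?powR_ge0//.
  by apply: ge0_ler_powR; rewrite ?nnegrE ?fC ?f0 ?(ltW p0)//; exact: SD.
Qed.

(** The test function is [xi ^+ q * u]. The term with the gradient of [xi] is split by Young's
    inequality and half of the coercive term absorbs its energy part. The constant comes before [u]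
    and [xi], so it is uniform over all cut-offs. *)
Lemma caccioppoli q : (0 < q)%N -> p <= q%:R -> exists2 C, 0 <= C &
  forall u xi, weak_solution vol A D u -> Ck_on 1 setT xi ->
    compact (supp xi) -> supp xi `<=` D -> (forall x, 0 <= xi x <= 1) ->
  (\int[vol]_(x in D) (xi x ^+ q * tnorm x (grad u x) `^ p)%:E <=
   C%:E * \int[vol]_(x in D) ((`|u x| * tnorm x (grad xi x)) `^ p)%:E)%E.
Proof.
move=> q0 pq.
have p0 : 0 < p by exact: lt_trans hp.
have [D1 [D2 [D10 D20 DA]]] := structure_bounds hA.
have qR : 0 < q%:R :> R by rewrite ltr0n.
(* Chosen so that [q * D2 * d = D1 / 2]: the absorbed part is exactly half of the coercive
   constant. *)
pose d := D1 / (2 * (q%:R * D2)).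
have d0 : 0 < d by rewrite divr_gt0// !mulr_gt0.
pose C := 2 / D1 * (q%:R * D2 * d `^ (1 - p)).
have C0 : 0 <= C.
  by rewrite !mulr_ge0 ?powR_ge0// ?invr_ge0 ltW.
exists C => // u xi [Cu wu] Cxi cxi sxi xi01.
pose phi x := xi x ^+ q * u x.
have CxiD := Ck_on_sub (@subsetT _ D) Cxi.
have CxiX := Ck_onX q oD CxiD.
have phiD : Ck_on 1 D phi by exact: Ck_onM.
have sphi : supp phi `<=` supp xi.
  apply: closure_subset => x /=; rewrite /phi; apply: contra_neq => ->.
  by rewrite expr0n gtn_eqF// mul0r.
have phic : Ck_compact 1 D phi.
  split; first by apply: Ck_on_supp phiD _; exact: subset_trans sxi.
    by apply: subclosed_compact sphi => //; exact: closed_closure.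
  exact: subset_trans sxi.
pose t x := tinner x (grad phi x) (flux A x (grad u x)).
have it : vol.-integrable D (EFin \o t) by exact: integrable_flux.
pose a x := `|u x| * tnorm x (grad xi x).
have ia : vol.-integrable D (EFin \o (fun x => a x `^ p)).
  apply: (integrable_powR cxi) => //.
  - move=> x Dx; apply: continuousM_for; last exact: (tnorm_grad_continuous oD Dx CxiD).
    apply: (@continuous_comp _ _ _ u (fun r : R => `|r|)); first exact: Ck_on_continuous Cu Dx.
    exact: norm_continuous.
  - by move=> x _; rewrite mulr_ge0 ?tnorm_ge0.
  - by move=> x _ /grad_supp xi0; rewrite /a xi0 tnorm0 mulr0.
have key x : D x -> xi x ^+ q * tnorm x (grad u x) `^ p <=
    2 / D1 * t x + C * a x `^ p.
  move=> Dx; set s := tnorm x (grad u x).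
  have s0 : 0 <= s by exact: tnorm_ge0.
  have xi0 : 0 <= xi x by case/andP: (xi01 x).
  have -> : t x = xi x ^+ q * (A s * s) +
      u x * (q%:R * xi x ^+ q.-1) * tinner x (grad xi x) (flux A x (grad u x)).
    rewrite /t (gradM CxiX Cu Dx) (gradX q oD CxiD Dx).
    rewrite tinnerDl !tinnerZl (tinner_flux_diag hA) -/s; ring.
  have /andP[As1 As2] := DA s s0.
  have h1 : D1 * s `^ p <= A s * s.
    by rewrite -(mulr_powRB1 s0 p0) mulrCA mulrC; exact: ler_wpM2r.
  have := ler_norm (- (u x * (q%:R * xi x ^+ q.-1) * tinner x (grad xi x) (flux A x (grad u x)))).
  rewrite normrN !normrM (ger0_norm (ltW qR)) (ger0_norm (exprn_ge0 _ xi0)).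
  have := tinner_flux_le hA x (grad u x) (grad xi x); rewrite -/s.
  have y := weighted_young hp q0 pq
    (mulr_ge0 (normr_ge0 (u x)) (tnorm_ge0 x (grad xi x))) s0 d0 (xi01 x).
  move: y; rewrite -/(a x) => y.
  set T := `|tinner _ _ _|; set T' := tinner _ _ _ => h2 h3.
  have h4 : `|u x| * (q%:R * xi x ^+ q.-1) * T <=
      q%:R * D2 * (a x * xi x ^+ q.-1 * s `^ (p - 1)).
    apply: (@le_trans _ _ (`|u x| * (q%:R * xi x ^+ q.-1) *
        (D2 * s `^ (p - 1) * tnorm x (grad xi x)))).
      apply: ler_wpM2l; first by rewrite !mulr_ge0// ?exprn_ge0// ltW.
      by apply: le_trans h2 _; apply: ler_wpM2r => //; exact: tnorm_ge0.
    by rewrite le_eqVlt; apply/orP; left; apply/eqP; rewrite /a; ring.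
  have h5 := ler_wpM2l (ltW (mulr_gt0 qR D20)) y.
  have h6 : q%:R * D2 * (d * (xi x ^+ q * s `^ p) + d `^ (1 - p) * a x `^ p) =
      D1 / 2 * (xi x ^+ q * s `^ p) + q%:R * D2 * d `^ (1 - p) * a x `^ p.
    rewrite /d; field; by rewrite !gt_eqF.
  have h7 := ler_wpM2l (exprn_ge0 q xi0) h1.
  have h8 : D1 / 2 * (xi x ^+ q * s `^ p) <=
      xi x ^+ q * (A s * s) + u x * (q%:R * xi x ^+ q.-1) * T' +
      q%:R * D2 * d `^ (1 - p) * a x `^ p.
    move: h3 h4 h5; rewrite h6; lra.
  have h9 : 0 <= 2 / D1 by rewrite divr_ge0// ltW.
  have := ler_wpM2l h9 h8.
  rewrite (_ : 2 / D1 * (D1 / 2 * _) = xi x ^+ q * s `^ p); last first.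
    by field; rewrite gt_eqF.
  move=> h10; apply: le_trans h10 _.
  by rewrite le_eqVlt; apply/orP; left; apply/eqP; rewrite /C; ring.
have mD : measurable (D : set (borel M)) by exact: open_borel.
have it2 : vol.-integrable D (fun x => (2 / D1)%:E * (t x)%:E)%E by exact: (integrableZl mD).
have ia2 : vol.-integrable D (fun x => C%:E * (a x `^ p)%:E)%E by exact: (integrableZl mD).
apply: (@le_trans _ _ (\int[vol]_(x in D) ((2 / D1)%:E * (t x)%:E + C%:E * (a x `^ p)%:E))%E).
  apply: ge0_le_integral_nomeas => x Dx.
    by rewrite lee_fin mulr_ge0 ?powR_ge0// exprn_ge0//; case/andP: (xi01 x).
  by rewrite -!EFinM -EFinD lee_fin; exact: key.
rewrite (integralD mD it2 ia2) (integralZl mD it) (integralZl mD ia).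
by rewrite (wu phi phic) mule0 add0e.
Qed.

End weak_solutions.

Lemma powR_product_le (R : realType) (p U h E Z X : R) : 0 <= p ->
  0 <= U -> U <= h -> 0 <= E -> 0 <= Z -> 0 <= X -> X <= E + Z ->
  (U * X) `^ p <= 2 `^ p * ((h * E) `^ p + (U * Z) `^ p).
Proof.
move=> p0 U0 Uh E0 Z0 X0 XEZ.
have hE : 0 <= h * E by rewrite mulr_ge0// (le_trans U0).
have UZ : 0 <= U * Z by rewrite mulr_ge0.
apply: le_trans (powRD_le p0 hE UZ).
apply: ge0_ler_powR; [exact: p0|by rewrite nnegrE mulr_ge0|
  by rewrite nnegrE addr_ge0|].
apply: le_trans (ler_wpM2l U0 XEZ) _; rewrite mulrDr lerD2r.
exact: ler_wpM2r.
Qed.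

Lemma tnorm_grad_prod (R : realType) n (M : riemannianManifold R n)
    (f g : M -> R) x : Ck_on 1 setT f -> Ck_on 1 setT g ->
  0 <= f x <= 1 -> 0 <= g x <= 1 ->
  tnorm x (grad (fun y => f y * g y) x) <= tnorm x (grad f x) + tnorm x (grad g x).
Proof.
move=> Cf Cg /andP[f0 f1] /andP[g0 g1].
rewrite (gradM Cf Cg)//; apply: le_trans (tnormD _ _ _) _; rewrite !tnormZ.
by rewrite addrC !ger0_norm// lerD// ler_piMl ?tnorm_ge0.
Qed.

Lemma flux_young (R : realType) (p W h T As E s D2 d : R) : 1 < p -> 0 <= W ->
  W <= h -> 0 <= E -> 0 <= s -> 0 < D2 -> 0 < d -> `|T| <= As * E ->
  As <= D2 * s `^ (p - 1) ->
  W * `|T| <= D2 * (d * s `^ p + d `^ (1 - p) * (h * E) `^ p).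
Proof.
move=> p1 W0 Wh E0 s0 D20 d0 TE AsD.
have hE0 : 0 <= h * E by rewrite mulr_ge0// (le_trans W0).
(* With [xi = 1] the weight is trivial, and any integer above [p] can serve as [q]. *)
have := @weighted_young _ p (Num.truncn p).+1 (h * E) s d 1 p1 isT
  (ltW (truncnS_gt p)) hE0 s0 d0.
rewrite ler01 lexx !expr1n mulr1 mul1r => /(_ isT) /(ler_wpM2l (ltW D20)).
apply: le_trans; apply: (@le_trans _ _ (h * (D2 * s `^ (p - 1) * E))).
  apply: (@le_trans _ _ (W * (D2 * s `^ (p - 1) * E))).
    by apply: ler_wpM2l => //; apply: le_trans TE _; exact: ler_wpM2r.
  by apply: ler_wpM2r => //; rewrite !mulr_ge0 ?powR_ge0// ltW.
by rewrite le_eqVlt; apply/orP; left; apply/eqP; ring.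
Qed.

Lemma flux_young_sub (R : realType) (W T1 T2 D2 d C su sv ax : R) : 0 <= W ->
  W * `|T1| <= D2 * (d * su + C * ax) -> W * `|T2| <= D2 * (d * sv + C * ax) ->
  - (W * (T1 - T2)) <= 2 * D2 * C * ax + D2 * d * (su + sv).
Proof.
move=> W0 y1 y2.
have := ler_wpM2l W0 (ler_norm (- T1)); have := ler_wpM2l W0 (ler_norm T2).
rewrite normrN; lra.
Qed.

Lemma tinner_comb_sub (R : realType) n (M : riemannianManifold R n) (x : M)
    (X Y F F' : 'rV[R]_n) (a b c : R) :
  tinner x (b *: (c *: X) + a *: Y) F - tinner x (b *: (c *: X) + a *: Y) F' =
  b * (c * tinner x X (F - F')) + a * (tinner x Y F - tinner x Y F').
Proof.
rewrite !(tinnerDl, tinnerZl) tinnerDr tinnerNr.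
move: (tinner x X F) (tinner x X F') (tinner x Y F) (tinner x Y F') => *.
ring.
Qed.

#[local] Opaque powR Ck_on grad tinner tnorm flux truncation truncation' patch.

(** * Comparison along an exhaustion, given cut-offs of bounded cost *)

Section exhaustion.
Context {R : realType} {n : nat} (M : riemannianManifold R n).
Variable vol : {measure set (borel M) -> \bar R}.
Hypothesis hvol : is_riemannian_volume vol.
Variable D : set M.
Hypothesis oD : open D.
Variable G : nat -> set M.
Hypothesis oG : forall N, open (G N).
Hypothesis ndG : forall i j, (i <= j)%N -> G i `<=` G j.
Hypothesis G_cover : forall x, exists N, G N x.
Implicit Types (f : M -> R).

Let mD : measurable (D : set (borel M)). Proof. exact: open_borel. Qed.
Let mG N : measurable (G N : set (borel M)). Proof. exact: open_borel. Qed.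

Lemma compact_sub_exhaustion S : compact S -> exists N, S `<=` G N.
Proof.
move=> cS; move: (cS); rewrite compact_cover => /(_ nat setT G).
case=> [i _|x _|J _ SJ]; first exact: oG.
  by have [N GN] := G_cover x; exists N.
have [N JN] : exists N, forall i, i \in J -> (i <= N)%N.
  exists (\max_(i <- J) i)%N => i iJ.
  exact: (@leq_bigmax_seq _ _ xpredT id).
by exists N => x /SJ[i /JN iN]; exact: ndG.
Qed.

Lemma integral_exhaustion f : measurable_fun (D : set (borel M)) f ->
  (forall x, D x -> 0 <= f x) ->
  (\int[vol]_(x in D `&` G N) (f x)%:E @[N --> \oo] --> \int[vol]_(x in D) (f x)%:E)%E.
Proof.
move=> mf f0.
have DU : D = \bigcup_N (D `&` G N).
  rewrite -setI_bigcupr; apply/seteqP; split => [x Dx|x []//].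
  by split => //; have [N GN] := G_cover x; exists N.
rewrite [X in _ --> X](_ : _ = \int[vol]_(x in \bigcup_N (D `&` G N)) (f x)%:E)%E; last first.
  by rewrite -DU.
apply: ge0_nondecreasing_set_cvg_integral.
- by move=> i j ij; rewrite subsetEset => x [Dx Gx]; split => //; exact: ndG Gx.
- by move=> i; exact: measurableI.
- move=> i; apply/measurable_EFinP; apply: measurable_funS mf => //.
- by move=> i x [Dx _]; rewrite lee_fin f0.
Qed.

Lemma integral_tail f (C e : R) N0 : measurable_fun (D : set (borel M)) f ->
  (forall x, D x -> 0 <= f x) -> (\int[vol]_(x in D) (f x)%:E <= C%:E)%E ->
  0 < e -> exists2 N, (N0 <= N)%N & (\int[vol]_(x in D `&` ~` G N) (f x)%:E <= e%:E)%E.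
Proof.
move=> mf f0 fC e0.
set L := (\int[vol]_(x in D) (f x)%:E)%E.
have L0 : (0 <= L)%E by apply: integral_ge0 => x Dx; rewrite lee_fin f0.
have Lfin : L \is a fin_num by rewrite ge0_fin_numE// (le_lt_trans fC)// ltry.
have cv := integral_exhaustion mf f0.
have Le : (L - e%:E < L)%E by rewrite lteBlDr// lteDl// lte_fin.
have [N1 _ HN1] :=
  cv _ (open_nbhs_nbhs (conj (@open_ereal_gt_ereal R (L - e%:E)%E) Le)).
exists (maxn N0 N1); first exact: leq_maxl.
set N := maxn N0 N1; have := HN1 N (leq_maxr _ _) => /= HN.
have mDc : measurable (D `&` ~` G N : set (borel M)).
  by apply: measurableI => //; exact: measurableC.
have E : (L = \int[vol]_(x in D `&` G N) (f x)%:E +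
    \int[vol]_(x in D `&` ~` G N) (f x)%:E)%E.
  rewrite -ge0_integral_setU//.
  - by rewrite -setIUr setUv setIT.
  - exact: measurableI.
  - by rewrite -setIUr setUv setIT; exact/measurable_EFinP.
  - by rewrite -setIUr setUv setIT => x Dx; rewrite lee_fin f0.
  - by apply/disj_setPS => x [[_ +] [_]].
have a0 : (0 <= \int[vol]_(x in D `&` G N) (f x)%:E)%E.
  by apply: integral_ge0 => x [Dx _]; rewrite lee_fin f0.
have b0 : (0 <= \int[vol]_(x in D `&` ~` G N) (f x)%:E)%E.
  by apply: integral_ge0 => x [Dx _]; rewrite lee_fin f0.
move: E HN Lfin a0 b0; set a := (\int[vol]_(x in D `&` G N) _)%E.
set b := (\int[vol]_(x in D `&` ~` G N) _)%E.
move=> ->; case: a => [a| |]//; case: b => [b| |]//.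
rewrite -?EFinN -!EFinD !lte_fin !lee_fin => ? _ _ _; lra.
Qed.

Variables (p : R) (A : R -> R).
Hypothesis hp : 1 < p.
Hypothesis hA : structure_conditions p A.
(** [zeta] vanishes on a neighbourhood [V] of the complement of [D], where no energy bound is
    available, and is 1 outside the compact set [H]; its gradient therefore lives on a compact
    subset of [D]. *)
Variables (V H : set M) (zeta : M -> R).
Hypothesis oV : open V.
Hypothesis DV : forall x, ~ D x -> V x.
Hypothesis cH : compact H.
Hypothesis Czeta : Ck_on 1 setT zeta.
Hypothesis zeta01 : forall x, 0 <= zeta x <= 1.
Hypothesis zetaV : forall x, V x -> zeta x = 0.
Hypothesis zetaH : forall x, ~ H x -> zeta x = 1.
Variables (h : M -> R) (B : R).
(** All that the comparison retains of the capacity bounds: cut-offs equal to 1 on any prescribed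
    [G N], at a cost [B] that does not depend on [N]. *)
Hypothesis exh : forall N, exists eta, [/\ Ck_on 1 setT eta, compact (supp eta),
  forall x, 0 <= eta x <= 1, forall x, G N x -> eta x = 1 &
  (\int[vol]_(x in D) ((h x * tnorm x (grad eta x)) `^ p)%:E <= B%:E)%E].
Hypothesis ch : forall x, D x -> {for x, continuous h}.

Let q := (Num.truncn p).+1.

Let pq : p <= q%:R. Proof. exact/ltW/truncnS_gt. Qed.

(** The weight removes the possibly infinite energy near the complement of [D]; outside [H] the
    density is the full p-th power of the gradient norm. *)
Definition energy_density u x : R := zeta x ^+ q * tnorm x (grad u x) `^ p.

Lemma measurable_energy u (xi : M -> R) : Ck_on 1 D u -> Ck_on 1 D xi ->
  measurable_fun (D : set (borel M)) (fun x => xi x ^+ q * tnorm x (grad u x) `^ p).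
Proof.
move=> Cu Cxi; apply: measurable_funM.
  apply: continuous_borel => // x Dx.
  exact: Ck_on_continuous (Ck_onX q oD Cxi) Dx.
exact: (measurableT_comp (measurable_powR p) (measurable_gnorm oD Cu)).
Qed.

(** Caccioppoli with the cut-off [eta * zeta]: the gradient of [eta] costs at most [B], that of
    [zeta] a fixed integral over a compact set. The bound is independent of [N], so it survives the
    monotone limit. *)
Lemma finite_energy u : weak_solution vol A D u ->
  (forall x, D x -> `|u x| <= h x) ->
  exists C, (\int[vol]_(x in D) (energy_density u x)%:E <= C%:E)%E.
Proof.
move=> wu uh; have [Cu _] := wu.
have CzD := Ck_on_sub (@subsetT _ D) Czeta.
have p0 : 0 < p by exact: lt_trans hp.
(* The gradient of [zeta] vanishes off [S]: on [V] because [zeta] is 0 there, outside [H] because it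
   is 1 there. *)
pose S := H `&` ~` V.
have cS : compact S.
  by apply: compact_closedI => //; exact: open_closedC.
have SD : S `<=` D by move=> x [_ Vx]; apply: contrapT => /DV.
pose a x := `|u x| * tnorm x (grad zeta x).
have ia : vol.-integrable D (EFin \o (fun x => a x `^ p)).
  apply: (integrable_powR hvol hp oD cS SD).
  - move=> x Dx; apply: continuousM_for; last exact: (tnorm_grad_continuous oD Dx CzD).
    apply: (@continuous_comp _ _ _ u (fun r : R => `|r|)); first exact: Ck_on_continuous Cu Dx.
    exact: norm_continuous.
  - by move=> x _; rewrite mulr_ge0 ?tnorm_ge0.
  - move=> x Dx Sx; rewrite /a.
    suff -> : grad zeta x = 0 by rewrite tnorm0 mulr0.
    have [Vx|Vx] := pselect (V x).
      rewrite -(grad_cst 0 x); apply: grad_near_eq.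
      by apply: filterS (open_nbhs_nbhs (conj oV Vx)) => y /zetaV.
    have Hx : ~ H x by move=> Hx; apply: Sx.
    have oH : open (~` H) by apply: closed_openC; exact: compact_closed_manifold.
    rewrite -(grad_cst 1 x); apply: grad_near_eq.
    by apply: filterS (open_nbhs_nbhs (conj oH Hx)) => y /zetaH.
have ifin := integrable_fin_num mD ia.
pose E0 := fine (\int[vol]_(x in D) (a x `^ p)%:E)%E.
have E0E : (\int[vol]_(x in D) (a x `^ p)%:E)%E = E0%:E by rewrite fineK.
have [C C0 cacc] := caccioppoli hvol hp hA oD (ltn0Sn _ : (0 < q)%N) pq.
exists (C * (2 `^ p * (B + E0))).
apply: cvge_to_le (integral_exhaustion _ _) _.
- exact: measurable_energy.
- move=> x _; rewrite mulr_ge0 ?powR_ge0// exprn_ge0//.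
  by case/andP: (zeta01 x).
apply: nearW => N.
have [eta [Ceta ceta eta01 etaG etaB]] := exh N.
pose xi x := eta x * zeta x.
have Cxi : Ck_on 1 setT xi by exact: Ck_onM openT Ceta Czeta.
have CxiD := Ck_on_sub (@subsetT _ D) Cxi.
have sxieta : supp xi `<=` supp eta.
  by apply: closure_subset => x /=; rewrite /xi; apply: contra_neq => ->; rewrite mul0r.
have sxi : supp xi `<=` ~` V.
  rewrite [X in _ `<=` X](closure_id _).1; last exact: open_closedC.
  by apply: closure_subset => x /= + Vx; rewrite /xi zetaV// mulr0 eqxx.
have sxiD : supp xi `<=` D by move=> x /sxi Vx; apply: contrapT => /DV.
have cxi : compact (supp xi).
  by apply: subclosed_compact sxieta => //; exact: closed_closure.
have xi01 x : 0 <= xi x <= 1.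
  have /andP[e0 e1] := eta01 x; have /andP[z0 z1] := zeta01 x.
  by rewrite mulr_ge0//= mulr_ile1.
apply: (@le_trans _ _ (\int[vol]_(x in D) (xi x ^+ q * tnorm x (grad u x) `^ p)%:E)%E).
  apply: (@le_trans _ _ (\int[vol]_(x in D `&` G N) (xi x ^+ q * tnorm x (grad u x) `^ p)%:E)%E).
    rewrite le_eqVlt; apply/orP; left; apply/eqP; apply: eq_integral => x /set_mem[_ Gx].
    by rewrite /energy_density /xi etaG// mul1r.
  apply: ge0_subset_integral => //.
  - exact: measurableI.
  - by apply/measurable_EFinP; exact: measurable_energy.
  - by move=> x _; rewrite lee_fin mulr_ge0 ?powR_ge0// exprn_ge0//; case/andP: (xi01 x).
apply: le_trans (cacc u xi wu Cxi cxi sxiD xi01) _.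
rewrite EFinM; apply: lee_wpmul2l; first by rewrite lee_fin.
pose b x := h x * tnorm x (grad eta x).
have mb : measurable_fun (D : set (borel M)) (fun x => b x `^ p).
  apply: (measurableT_comp (measurable_powR p)).
  apply: measurable_funM; first exact: continuous_borel.
  exact: (measurable_gnorm oD (Ck_on_sub (@subsetT _ D) Ceta)).
have ma : measurable_fun (D : set (borel M)) (fun x => a x `^ p).
  by have /measurable_int /measurable_EFinP := ia.
apply: (@le_trans _ _ (\int[vol]_(x in D) ((2 `^ p)%:E * ((b x `^ p)%:E + (a x `^ p)%:E)))%E).
  apply: ge0_le_integral_nomeas => x Dx; first by rewrite lee_fin powR_ge0.
  rewrite -EFinD -EFinM lee_fin.
  apply: powR_product_le; rewrite ?tnorm_ge0 ?(ltW p0) ?uh//.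
  exact: tnorm_grad_prod.
have mbE : measurable_fun (D : set (borel M)) (fun x => (b x `^ p)%:E).
  apply/measurable_EFinP; exact: mb.
have maE : measurable_fun (D : set (borel M)) (fun x => (a x `^ p)%:E).
  apply/measurable_EFinP; exact: ma.
have b0 x : D x -> (0 <= (b x `^ p)%:E)%E by move=> _; rewrite lee_fin powR_ge0.
have a0 x : D x -> (0 <= (a x `^ p)%:E)%E by move=> _; rewrite lee_fin powR_ge0.
rewrite (ge0_integralZl vol mD (emeasurable_funD mbE maE)); last 2 first.
  by move=> x Dx; exact: adde_ge0 (b0 x Dx) (a0 x Dx).
  by rewrite lee_fin powR_ge0.
rewrite EFinM; apply: lee_wpmul2l; first by rewrite lee_fin powR_ge0.
rewrite (ge0_integralD vol mD b0 mbE a0 maE) EFinD -E0E.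
exact: (leeD etaB (lexx _)).
Qed.

Section comparison.
Variables (u v : M -> R) (e : R).
Hypothesis e0 : 0 <= e.
Hypothesis wu : weak_solution vol A D u.
Hypothesis wv : weak_solution vol A D v.
Hypothesis uvh : forall x, D x -> `|u x| + `|v x| <= h x.
Hypothesis excess : closure [set x | D x /\ e < u x - v x] `<=` D.

Let Cu : Ck_on 1 D u. Proof. by case: wu. Qed.
Let Cv : Ck_on 1 D v. Proof. by case: wv. Qed.

Let Cuv : Ck_on 1 D (fun x => u x - v x). Proof. exact: Ck_onB. Qed.

(** Extended by 0 outside [D], since the values of [u] and [v] there mean nothing; [excess] keeps
    the support inside [D]. *)
Let w : M -> R := patch (fun=> 0) D (fun x => truncation e (u x - v x)).

Let wE x : D x -> w x = truncation e (u x - v x).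
Proof. by move=> Dx; rewrite /w patchE mem_set. Qed.

Let CwD : Ck_on 1 D w.
Proof.
have Ct : Ck_on 1 D (truncation e \o (fun x => u x - v x)).
  exact: (C1_on_comp oD (@is_derive_truncation R e) (@continuous_truncation' R e) Cuv).
by apply: (Ck_on_eq oD _ Ct) => x Dx; rewrite wE.
Qed.

Let grad_w x : D x ->
  grad w x = truncation' e (u x - v x) *: (grad u x - grad v x).
Proof.
move=> Dx; rewrite -(gradB oD Cu Cv Dx).
rewrite -(@grad_comp _ _ M (fun x => u x - v x) _ _ D x Cuv Dx
  (is_derive_truncation e (u x - v x))).
by apply: grad_near_eq; apply: filterS (open_nbhs_nbhs (conj oD Dx)) => y /wE.
Qed.

Let supp_w : supp w `<=` D.
Proof.
apply: subset_trans excess; apply: closure_subset => x /=.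
have [Dx|Dx] := pselect (D x); last by rewrite /w patchE memNset// eqxx.
by rewrite wE// => /truncation_neq0.
Qed.

(** By the chain rule this is, on [D], the pairing of the gradient of [w] with the difference of the
    two fluxes. *)
Definition mono_density x : R := truncation' e (u x - v x) *
  tinner x (grad u x - grad v x) (flux A x (grad u x) - flux A x (grad v x)).

Lemma mono_density_ge0 x : 0 <= mono_density x.
Proof. by rewrite mulr_ge0 ?truncation'_ge0// (flux_mono_ge0 hA). Qed.

Lemma measurable_mono_density :
  measurable_fun (D : set (borel M)) mono_density.
Proof.
apply: measurable_funM.
  apply: continuous_borel => // x Dx.
  apply: (@continuous_comp _ _ _ (fun x => u x - v x) (truncation' e)).
    exact: Ck_on_continuous Cuv Dx.
  exact: continuous_truncation'.
have mf f g : Ck_on 1 D f -> Ck_on 1 D g -> measurable_fun (D : set (borel M))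
    (fun x => tinner x (grad f x) (flux A x (grad g x))).
  by move=> Cf Cg; exact: (measurable_flux hA oD).
rewrite (_ : (fun x => _) = (fun x =>
   (tinner x (grad u x) (flux A x (grad u x)) -
    tinner x (grad u x) (flux A x (grad v x))) -
   (tinner x (grad v x) (flux A x (grad u x)) -
    tinner x (grad v x) (flux A x (grad v x))))); last first.
  by apply/funext => x; rewrite tinnerDl tinnerNl !(tinnerDr, tinnerNr).
by apply: measurable_funB; apply: measurable_funB; exact: mf.
Qed.

(** Both equations are tested with [eta * w] and subtracted. The derivative of [w] yields
    [eta * mono_density]. The derivative of [eta] yields an error supported outside [G N], hence
    outside [H], where [zeta = 1] and the energy densities dominate the full gradients in Young's
    inequality. *)
Lemma comparison_estimate (D2 d : R) N eta : 0 < D2 -> 0 < d ->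
  (forall s, 0 <= s -> A s <= D2 * s `^ (p - 1)) -> H `<=` G N ->
  Ck_on 1 setT eta -> compact (supp eta) -> (forall x, 0 <= eta x <= 1) ->
  (forall x, G N x -> eta x = 1) ->
  (\int[vol]_(x in D `&` G N) (mono_density x)%:E <=
   (2 * D2 * d `^ (1 - p))%:E *
     \int[vol]_(x in D) ((h x * tnorm x (grad eta x)) `^ p)%:E +
   (D2 * d)%:E * \int[vol]_(x in D `&` ~` G N)
     (energy_density u x + energy_density v x)%:E)%E.
Proof.
move=> D20 d0 AD HG Ceta ceta eta01 etaG.
have CetaD := Ck_on_sub (@subsetT _ D) Ceta.
pose phi x := eta x * w x.
have phiD : Ck_on 1 D phi by exact: (Ck_onM oD CetaD CwD).
have sphieta : supp phi `<=` supp eta.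
  by apply: closure_subset => x /=; rewrite /phi; apply: contra_neq => ->; rewrite mul0r.
have sphi : supp phi `<=` D.
  apply: subset_trans supp_w; apply: closure_subset => x /=.
  by rewrite /phi; apply: contra_neq => ->; rewrite mulr0.
have phic : Ck_compact 1 D phi.
  split; [exact: Ck_on_supp phiD sphi| |exact: sphi].
  exact: (subclosed_compact (@closed_closure _ _) ceta sphieta).
pose t f x := tinner x (grad phi x) (flux A x (grad f x)).
have itu : vol.-integrable D (EFin \o t u) by exact: (integrable_flux hvol hA oD).
have itv : vol.-integrable D (EFin \o t v) by exact: (integrable_flux hvol hA oD).
pose a x := (h x * tnorm x (grad eta x)) `^ p.
pose f x := patch (fun=> 0) (~` G N) (fun x => energy_density u x + energy_density v x) x.
have key x : D x -> eta x * mono_density x <=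
    (t u x - t v x) + (2 * D2 * d `^ (1 - p) * a x + D2 * d * f x).
  move=> Dx.
  have E : eta x * mono_density x = (t u x - t v x) -
      w x * (tinner x (grad eta x) (flux A x (grad u x)) -
             tinner x (grad eta x) (flux A x (grad v x))).
    rewrite /t (gradM CetaD CwD Dx) (grad_w Dx).
    by rewrite tinner_comb_sub addrK.
  rewrite E lerD2l.
  have w0 : 0 <= w x by rewrite (wE Dx); exact: truncation_ge0.
  have wh : w x <= h x.
    apply: le_trans (uvh Dx); rewrite (wE Dx).
    by apply: le_trans (truncation_le _ e0) _; exact: ler_normB.
  have en0 g : 0 <= energy_density g x.
    by rewrite mulr_ge0 ?powR_ge0// exprn_ge0//; case/andP: (zeta01 x).
  have [Gx|Gx] := pselect (G N x).
    have -> : grad eta x = 0.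
      rewrite -(grad_cst 1 x); apply: grad_near_eq.
      by apply: filterS (open_nbhs_nbhs (conj (oG N) Gx)) => y /etaG.
    rewrite !(tinnerC x 0) !tinner0r subrr mulr0 oppr0
      addr_ge0 ?mulr_ge0 ?powR_ge0 ?(ltW D20) ?(ltW d0)//.
    by rewrite /f patchE; case: ifP => // _; rewrite addr_ge0.
  have fE : f x = tnorm x (grad u x) `^ p + tnorm x (grad v x) `^ p.
    have z1 : zeta x = 1 by apply: zetaH => /HG.
    have Gx' : (~` G N) x by exact: Gx.
    rewrite /f patchE (mem_set Gx') /energy_density z1 expr1n.
    by congr (_ + _); exact: mul1r.
  have yu := flux_young hp w0 wh (tnorm_ge0 x (grad eta x)) (tnorm_ge0 x (grad u x))
    D20 d0 (tinner_flux_le hA x (grad u x) (grad eta x)) (AD _ (tnorm_ge0 x (grad u x))).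
  have yv := flux_young hp w0 wh (tnorm_ge0 x (grad eta x)) (tnorm_ge0 x (grad v x))
    D20 d0 (tinner_flux_le hA x (grad v x) (grad eta x)) (AD _ (tnorm_ge0 x (grad v x))).
  rewrite fE; exact: (flux_young_sub w0 yu yv).
have mDG : measurable (D `&` ~` G N : set (borel M)).
  exact: (measurableI _ _ mD (measurableC (mG N))).
have zetaq0 x : 0 <= zeta x ^+ q by apply: exprn_ge0; case/andP: (zeta01 x).
have en0 g x : 0 <= energy_density g x by exact: (mulr_ge0 (zetaq0 x) (powR_ge0 _ _)).
have CzD := Ck_on_sub (@subsetT _ D) Czeta.
have men g : Ck_on 1 D g -> measurable_fun (D : set (borel M)) (energy_density g).
  by move=> Cg; exact: (measurable_energy Cg CzD).
pose fuv x := energy_density u x + energy_density v x.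
have mfuv : measurable_fun (D : set (borel M)) fuv.
  exact: (measurable_funD (men u Cu) (men v Cv)).
have mf : measurable_fun (D : set (borel M)) f.
  apply/(measurable_restrict _ (measurableC (mG N)) mD).
  exact: (measurable_funS mD (@subIsetl _ _ _) mfuv).
have ma : measurable_fun (D : set (borel M)) a.
  apply: (measurableT_comp (measurable_powR p)).
  apply: (measurable_funM _ (measurable_gnorm oD CetaD)).
  exact: (continuous_borel oD ch).
have f0 x : 0 <= f x.
  by rewrite /f patchE; case: ifP => // _; exact: addr_ge0.
have a0 x : 0 <= a x by exact: powR_ge0.
pose C1 := 2 * D2 * d `^ (1 - p).
have C10 : 0 <= C1 by rewrite !mulr_ge0 ?powR_ge0// ltW.
have C20 : 0 <= D2 * d by rewrite mulr_ge0// ltW.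
pose r x := C1 * a x + D2 * d * f x.
have mr : measurable_fun (D : set (borel M)) r.
  by apply: measurable_funD; apply: measurable_funM; [exact: measurable_cst|exact: ma|
    exact: measurable_cst|exact: mf].
have r0 x : 0 <= r x by exact: (addr_ge0 (mulr_ge0 C10 (a0 x)) (mulr_ge0 C20 (f0 x))).
have intr : (\int[vol]_(x in D) (r x)%:E = C1%:E * \int[vol]_(x in D) (a x)%:E +
    (D2 * d)%:E * \int[vol]_(x in D `&` ~` G N) (fuv x)%:E)%E.
  have maE : measurable_fun (D : set (borel M)) (EFin \o a) by apply/measurable_EFinP; exact: ma.
  have mfE : measurable_fun (D : set (borel M)) (EFin \o f) by apply/measurable_EFinP; exact: mf.
  have a0E x : D x -> (0 <= (EFin \o a) x)%E by move=> _; rewrite lee_fin.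
  have f0E x : D x -> (0 <= (EFin \o f) x)%E by move=> _; rewrite lee_fin.
  have fE : (\int[vol]_(x in D) (f x)%:E =
      \int[vol]_(x in D `&` ~` G N) (fuv x)%:E)%E.
    rewrite integral_mkcondr; apply: eq_integral => x _.
    by rewrite /f !patchE; case: ifP.
  rewrite -fE -(ge0_integralZl vol mD maE a0E) ?lee_fin//
    -(ge0_integralZl vol mD mfE f0E) ?lee_fin//.
  rewrite -ge0_integralD.
  - by apply: eq_integral => x _; rewrite /r EFinD !EFinM.
  - exact: mD.
  - by move=> x Dx; apply: mule_ge0; [rewrite lee_fin|exact: a0E].
  - exact: (measurable_funeM _ maE).
  - by move=> x Dx; apply: mule_ge0; [rewrite lee_fin|exact: f0E].
  - exact: (measurable_funeM _ mfE).
rewrite -/C1 -/(fuv _) -/(a _) -intr.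
(* An infinite right side leaves nothing to prove; a finite one makes [r] integrable, so that the
   integral of the sum may be split. *)
have [roo|roo] := leP +oo%E (\int[vol]_(x in D) (r x)%:E)%E.
  by apply: le_trans roo; exact: leey.
have ir : vol.-integrable D (EFin \o r).
  apply/integrableP; split; first by apply/measurable_EFinP; exact: mr.
  apply: le_lt_trans roo; rewrite le_eqVlt; apply/orP; left; apply/eqP.
  by apply: eq_integral => x _ /=; rewrite ger0_norm.
have mm := measurable_mono_density.
have meta : measurable_fun (D : set (borel M)) eta.
  by apply: (continuous_borel oD) => x Dx; exact: Ck_on_continuous CetaD Dx.
have etam0 x : 0 <= eta x * mono_density x.
  by apply: mulr_ge0; [case/andP: (eta01 x)|exact: mono_density_ge0].
apply: (@le_trans _ _ (\int[vol]_(x in D `&` G N) (eta x * mono_density x)%:E)%E).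
  rewrite le_eqVlt; apply/orP; left; apply/eqP; apply: eq_integral => x /set_mem[_ Gx].
  by rewrite etaG// mul1r.
apply: (@le_trans _ _ (\int[vol]_(x in D) (eta x * mono_density x)%:E)%E).
  apply: (ge0_subset_integral vol (measurableI _ _ mD (mG N)) mD).
  - by apply/measurable_EFinP; exact: (measurable_funM meta mm).
  - by move=> x _; rewrite lee_fin.
  - exact: subIsetl.
have it : vol.-integrable D ((EFin \o t u) \- (EFin \o t v))%E.
  exact: (integrableB mD itu itv).
apply: (@le_trans _ _ (\int[vol]_(x in D)
    (((EFin \o t u) \- (EFin \o t v)) x + (EFin \o r) x))%E).
  apply: ge0_le_integral_nomeas => x Dx; first by rewrite lee_fin.
  by rewrite /= -EFinB -EFinD lee_fin; exact: key.
rewrite (integralD mD it ir) (integralB mD itu itv).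
have -> : (\int[vol]_(x in D) (EFin \o t u) x = 0)%E by exact: (wu.2 phi phic).
have -> : (\int[vol]_(x in D) (EFin \o t v) x = 0)%E by exact: (wv.2 phi phic).
by rewrite sube0 add0e.
Qed.

Lemma measurable_energy_density g : Ck_on 1 D g ->
  measurable_fun (D : set (borel M)) (energy_density g).
Proof. by move=> Cg; exact: (measurable_energy Cg (Ck_on_sub (@subsetT _ D) Czeta)). Qed.

Lemma energy_density_ge0 g x : 0 <= energy_density g x.
Proof.
by apply: mulr_ge0 (powR_ge0 _ _); apply: exprn_ge0; case/andP: (zeta01 x).
Qed.

(* In [comparison_estimate], [d] is first taken so large that the cut-off term is
   small, and then [N] so large that the energy outside [G N] is small against [1 / d]. *)
Lemma mono_density_integral0 N0 :
  (\int[vol]_(x in D `&` G N0) (mono_density x)%:E = 0)%E.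
Proof.
have [D1 [D2 [D10 D20 DA]]] := structure_bounds hA.
have AD s : 0 <= s -> A s <= D2 * s `^ (p - 1) by move=> /DA/andP[].
have [NH HN] := compact_sub_exhaustion cH.
have uh x : D x -> `|u x| <= h x.
  by move=> Dx; apply: le_trans (uvh Dx); rewrite lerDl.
have vh x : D x -> `|v x| <= h x.
  by move=> Dx; apply: le_trans (uvh Dx); rewrite lerDr.
have [Eu Euoo] := finite_energy wu uh; have [Ev Evoo] := finite_energy wv vh.
pose fuv x := energy_density u x + energy_density v x.
have mE g : Ck_on 1 D g -> measurable_fun (D : set (borel M)) (EFin \o energy_density g).
  by move=> Cg; apply/measurable_EFinP; exact: measurable_energy_density.
have e0E g x : D x -> (0 <= (EFin \o energy_density g) x)%E.
  by move=> _; rewrite lee_fin; exact: energy_density_ge0.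
have mfuv : measurable_fun (D : set (borel M)) fuv.
  exact: (measurable_funD (measurable_energy_density Cu) (measurable_energy_density Cv)).
have fuv0 x : D x -> 0 <= fuv x.
  by move=> _; exact: (addr_ge0 (energy_density_ge0 u x) (energy_density_ge0 v x)).
have Efuv : (\int[vol]_(x in D) (fuv x)%:E <= (Eu + Ev)%:E)%E.
  rewrite EFinD; apply: le_trans (leeD Euoo Evoo).
  by rewrite -(ge0_integralD vol mD (e0E u) (mE u Cu) (e0E v) (mE v Cv)); exact: lexx.
apply/eqP; rewrite eq_le; apply/andP; split; last first.
  by apply: integral_ge0 => x _; rewrite lee_fin mono_density_ge0.
apply/lee_addgt0Pr => eps eps0; rewrite add0e.
(* The value wanted for [d ^ (1 - p)], making the cut-off term at most [eps / 2]. The exponent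
   [1 - p] is negative, so a small [tau] means a large [d]. [|B| + 1] bounds [B] and is positive
   whatever the sign of [B]. *)
pose tau := eps / 2 / (2 * D2 * (`|B| + 1)).
have B1 : 0 < `|B| + 1 by rewrite ltr_wpDl.
have tau0 : 0 < tau by rewrite !divr_gt0// !mulr_gt0.
pose d := tau `^ ((1 - p)^-1).
have d0 : 0 < d by exact: powR_gt0.
have dE : d `^ (1 - p) = tau.
  rewrite /d -powRrM mulVf; first by rewrite powRr1// ltW.
  by rewrite subr_eq0 lt_eqF.
have e2 : 0 < eps / 2 / (D2 * d) by rewrite !divr_gt0// mulr_gt0.
have [N NN tailN] := integral_tail (maxn N0 NH) mfuv fuv0 Efuv e2.
have [eta [Ceta ceta eta01 etaG etaB]] := exh N.
have HG : H `<=` G N.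
  by move=> x /HN; apply: ndG; apply: leq_trans NN; exact: leq_maxr.
apply: (@le_trans _ _ (\int[vol]_(x in D `&` G N) (mono_density x)%:E)%E).
  apply: (ge0_subset_integral vol (measurableI _ _ mD (mG N0)) (measurableI _ _ mD (mG N))).
  - apply/measurable_EFinP.
    exact: (measurable_funS mD (@subIsetl _ _ _) measurable_mono_density).
  - by move=> x _; rewrite lee_fin mono_density_ge0.
  - move=> x [Dx Gx]; split=> //; apply: ndG Gx.
    by apply: leq_trans NN; exact: leq_maxl.
apply: le_trans (comparison_estimate D20 d0 AD HG Ceta ceta eta01 etaG) _.
rewrite dE [eps]splitr EFinD; apply: leeD.
  apply: (@le_trans _ _ ((2 * D2 * tau)%:E * (`|B| + 1)%:E)%E).
    apply: lee_wpmul2l.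
      by rewrite lee_fin ltW// mulr_gt0// mulr_gt0.
    apply: (le_trans etaB); rewrite lee_fin.
    have := ler_norm B; lra.
  rewrite -EFinM lee_fin le_eqVlt; apply/orP; left; apply/eqP.
  by rewrite /tau; field; rewrite !gt_eqF.
apply: (@le_trans _ _ ((D2 * d)%:E * (eps / 2 / (D2 * d))%:E)%E).
  apply: lee_wpmul2l; last exact: tailN.
  by rewrite lee_fin ltW// mulr_gt0.
rewrite -EFinM lee_fin le_eqVlt; apply/orP; left; apply/eqP.
by rewrite mulrC divfK// gt_eqF// mulr_gt0.
Qed.

(** Where the gradients differ and the excess is strict, [mono_density] is positive, and these
    conditions are open by continuity. The zero integral puts the open set [U] inside a null set,
    against the positivity of the volume. *)
Lemma comparison_grad x : D x -> e < u x - v x -> grad u x = grad v x.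
Proof.
move=> Dx ex; apply: contrapT => guv.
have [N GN] := G_cover x.
pose g y := tnorm y (grad (fun x => u x - v x) y).
have cg y : D y -> {for y, continuous g} by move=> Dy; exact: (tnorm_grad_continuous oD Dy Cuv).
have cuv y : D y -> {for y, continuous (fun x => u x - v x)}.
  by move=> Dy; exact: Ck_on_continuous Cuv Dy.
pose U := [set y | [/\ D y, G N y, e < u y - v y & 0 < g y]].
have oU : open U.
  rewrite openE => y [Dy Gy ey gy].
  have n1 : nbhs y [set z | e < u z - v z].
    exact: (cuv y Dy _ (open_nbhs_nbhs (conj (@open_gt R e) ey))).
  have n2 : nbhs y [set z | 0 < g z].
    exact: (cg y Dy _ (open_nbhs_nbhs (conj (@open_gt R 0) gy))).
  have n3 : nbhs y D by apply: open_nbhs_nbhs.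
  have n4 : nbhs y (G N) by apply: open_nbhs_nbhs.
  by apply: filterS (filterI (filterI n3 n4) (filterI n1 n2)) => z [[? ?] [? ?]].
have Ux : U x.
  split => //; rewrite lt_def tnorm_ge0 andbT; apply/eqP.
  by rewrite /g (gradB oD Cu Cv Dx) => /tnorm_eq0/eqP; rewrite subr_eq0 => /eqP.
have mpos y : U y -> 0 < mono_density y.
  move=> [Dy _ ey gy]; apply: mulr_gt0; first exact: truncation'_gt0.
  rewrite lt_def (flux_mono_ge0 hA) andbT; apply/eqP => /(flux_mono_eq0 hA) E.
  by move: gy; rewrite /g (gradB oD Cu Cv Dy) E subrr tnorm0 ltxx.
have mU : measurable (U : set (borel M)) by exact: open_borel.
have UD : U `<=` D `&` G N by move=> y [].
have mm : measurable_fun (D `&` G N : set (borel M)) (EFin \o mono_density).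
  apply/measurable_EFinP.
  exact: (measurable_funS mD (@subIsetl _ _ _) measurable_mono_density).
have : (\int[vol]_(x in D `&` G N) `|(EFin \o mono_density) x| = 0)%E.
  rewrite -[RHS](mono_density_integral0 N); apply: eq_integral => y _ /=.
  by rewrite ger0_norm// mono_density_ge0.
move/(ae_eq_integral_abs vol (measurableI _ _ mD (mG N)) mm) => [Z [mZ Z0 HZ]].
have UZ : U `<=` Z.
  move=> y Uy; apply: HZ => /= /(_ (UD y Uy)) [] E.
  by have := mpos y Uy; rewrite E ltxx.
have := volume_open_gt0 hvol oU Ux; apply/negP; rewrite -leNgt -Z0.
by apply: le_measure; rewrite ?inE.
Qed.

End comparison.

End exhaustion.

#[local] Transparent powR Ck_on grad tinner tnorm flux truncation truncation' patch.

(** * Smooth cut-offs *)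

Section bump_profile.
Context {R : realType}.
Implicit Types (s t : R) (p : {poly R}).

(** For [m > 0], raise [s / m <= expR (s / m)] to the power [m]. *)
Lemma exprn_le_expR m s : 0 <= s -> s ^+ m <= m%:R ^+ m * expR s.
Proof.
move=> s0; case: m => [|m].
  by rewrite !expr0 mul1r; have := expR_ge1Dx s; lra.
have m0 : 0 < m.+1%:R :> R by [].
have -> : expR s = expR (s / m.+1%:R) ^+ m.+1.
  by rewrite -expRM_natl mulrC divfK// gt_eqF.
rewrite -exprMn; apply: lerXn2r; rewrite ?nnegrE//.
rewrite mulrC -ler_pdivrMr//; apply: le_trans (expR_ge1Dx _).
by rewrite lerDr.
Qed.

Lemma poly_le_expR p : exists2 C, 0 <= C & forall s, 0 <= s -> `|p.[s]| <= C * expR s.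
Proof.
exists (\sum_(i < size p) `|p`_i| * i%:R ^+ i).
  by apply: sumr_ge0 => i _; rewrite mulr_ge0// exprn_ge0.
move=> s s0; rewrite horner_coef mulr_suml.
apply: le_trans (ler_norm_sum _ _ _) _; apply: ler_sum => i _.
by rewrite normrM (ger0_norm (exprn_ge0 _ s0)) -mulrA ler_wpM2l// exprn_le_expR.
Qed.

(* Allowing every polynomial [p] makes this family stable under derivation. *)
Definition flat_exp p t := if 0 < t then p.[t^-1] * expR (- t^-1) else 0.

(** For [t > 0] the derivatives of [1 / t] and [- 1 / t] both produce a factor [t^-2], whence the
    polynomial ['X^2 * (p - p')]. At 0 the exponential dominates ['X^2 * p], which amounts to a
    bound of the values by [C * t^2]. *)
Lemma is_derive_flat_exp p t :
  is_derive t 1 (flat_exp p) (flat_exp ('X^2 * (p - p^`())) t).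
Proof.
have [t0|t0|->] := ltgtP t 0.
- have -> : flat_exp ('X^2 * (p - p^`())) t = 0.
    by rewrite /flat_exp ltNge (ltW t0).
  apply: (near_eq_is_derive _ (is_derive_cst (0 : R) t 1)).
  near=> s; rewrite /flat_exp ltNge; have -> // : s <= 0.
  by apply: ltW; near: s; exact: lt_nbhsl.
- have tn0 : t != 0 by rewrite gt_eqF.
  have di := is_derive_inv tn0.
  have dp := is_derive_comp1 (@ex_derive _ _ _ _ _ _ _ di) (is_derive_poly p t^-1).
  have dn : is_derive t 1 (fun s => - s^-1) (t^-1 * t^-1).
    by have H := is_deriveN di; apply: is_derive_eq H _; rewrite opprK.
  have de := is_derive_comp1 (@ex_derive _ _ _ _ _ _ _ dn) (is_derive_expR (- t^-1)).
  have dm := is_deriveM dp de.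
  apply: (@near_eq_is_derive _ _ _ ((horner p \o (fun s => s^-1)) * (expR \o (fun s => - s^-1)))).
    near=> s; rewrite /flat_exp; have -> // : 0 < s.
    by near: s; exact: lt_nbhsr.
  apply: is_derive_eq dm _; rewrite !derive_val /flat_exp t0 /=.
  rewrite !hornerE/= -![_ *: _]/(_ * _); ring.
- rewrite {2}/flat_exp ltxx.
  have [C C0 HC] := poly_le_expR ('X^2 * p).
  apply: (@quadratic_is_derive _ _ C) => h.
  rewrite addr0 mulr0 subr0 {2}/flat_exp ltxx subr0 /flat_exp.
  case: ifPn => h0; last by rewrite normr0 mulr_ge0// sqr_ge0.
  have := HC h^-1; rewrite invr_ge0 => /(_ (ltW h0)).
  rewrite hornerM hornerXn normrM ger0_norm ?exprn_ge0 ?invr_ge0 ?(ltW h0)// => H.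
  rewrite normrM (ger0_norm (expR_ge0 _)) expRN ler_pdivrMr ?expR_gt0//.
  move: H; rewrite exprVn mulrC ler_pdivrMr ?exprn_gt0// mulrAC.
  by [].
Unshelve. all: by end_near. Qed.

Lemma flat_exp_stable : derivation_stable (range flat_exp).
Proof.
move=> _ [p _ <-]; exists (flat_exp ('X^2 * (p - p^`()))); first by exists ('X^2 * (p - p^`())).
by move=> t; exact: is_derive_flat_exp.
Qed.

Definition flat_profile := flat_exp 1.

Lemma flat_profile_range : range flat_exp flat_profile.
Proof. by exists 1. Qed.

Lemma flat_profile_gt0 t : 0 < t -> 0 < flat_profile t.
Proof. by move=> t0; rewrite /flat_profile /flat_exp t0 hornerC mul1r expR_gt0. Qed.

Lemma flat_profile_le0 t : t <= 0 -> flat_profile t = 0.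
Proof. by move=> t0; rewrite /flat_profile /flat_exp ltNge t0. Qed.

Lemma flat_profile_ge0 t : 0 <= flat_profile t.
Proof.
have [/flat_profile_le0->//|/flat_profile_gt0/ltW//] := leP t 0.
Qed.

End bump_profile.

(** * From flat profiles to cut-offs on the manifold *)

Section cutoffs.
Context {R : realType} {n : nat} (M : riemannianManifold R n).
Implicit Types (c d : chart M) (x : M) (D U C : set M) (f g : M -> R).

Lemma suppD f g : supp (fun x => f x + g x) `<=` supp f `|` supp g.
Proof.
rewrite [X in _ `<=` X](closure_id _).1; last first.
  by apply: closedU; exact: closed_closure.
apply: closure_subset => x /= fg.
have [fx|fx] := eqVneq (f x) 0; last by left; exact: subset_closure.
right; apply: subset_closure => /=; apply: contra fg => /eqP ->.
by rewrite fx addr0.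
Qed.

Lemma compact_sub (A B : set M) : closed A -> compact B -> A `<=` B -> compact A.
Proof. by move=> cA cB AB; exact: (subclosed_compact cA cB AB). Qed.

(** A product over the coordinates fits the sup norm on rows: it is positive exactly on the open
    cube of half-side [r], and smooth although the norm is not. *)
Definition cube_profile (z0 : 'rV[R]_n) (r : R) (z : 'rV[R]_n) : R :=
  \prod_(i < n) (flat_profile (r - (z 0 i - z0 0 i)) * flat_profile (r + (z 0 i - z0 0 i))).

Lemma cube_profile_ge0 z0 r z : 0 <= cube_profile z0 r z.
Proof. by apply: prodr_ge0 => i _; rewrite mulr_ge0 ?flat_profile_ge0. Qed.

Lemma cube_profile_gt0 z0 r : 0 < r -> 0 < cube_profile z0 r z0.
Proof.
by move=> r0; apply: prodr_gt0 => i _; rewrite subrr subr0 addr0 mulr_gt0// flat_profile_gt0.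
Qed.

Lemma cube_profile_neq0 z0 r z i : cube_profile z0 r z != 0 ->
  z0 0 i - r <= z 0 i <= z0 0 i + r.
Proof.
move=> /prodf_neq0 /(_ i isT) z0r; apply/andP; split; rewrite leNgt; apply/negP => H.
  move/eqP: z0r; apply; rewrite (@flat_profile_le0 _ (r + (z 0 i - z0 0 i))) ?mulr0//; lra.
move/eqP: z0r; apply; rewrite flat_profile_le0 ?mul0r//; lra.
Qed.

Lemma is_Ck_cube_profile k (V : set 'rV[R]_n) (T : 'rV[R]_n -> 'rV[R]_n) z0 r :
  open V -> is_Ck k V T -> is_Ck k V (cube_profile z0 r \o T).
Proof.
move=> oV CT.
have CTi i : is_Ck k V (fun z => T z 0 i) by exact: is_Ck_coord.
have CF (f : 'rV[R]_n -> R) : is_Ck k V f -> is_Ck k V (flat_profile \o f).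
  move=> Cf.
  exact: (is_Ck_comp oV flat_exp_stable flat_profile_range Cf).
apply: (is_Ck_prod _ oV) => i; apply: (is_CkM oV); apply: CF.
  have := is_CkD oV (is_Ck_cst k V (r + z0 0 i : R)) (is_CkM oV (is_Ck_cst k V (-1 : R)) (CTi i)).
  by apply: is_Ck_eq => // y _ /=; ring.
have := is_CkD oV (is_Ck_cst k V (r - z0 0 i : R)) (CTi i).
by apply: is_Ck_eq => // y _ /=; ring.
Qed.

Lemma compact_cube (z0 : 'rV[R]_n) (r : R) :
  compact [set z : 'rV[R]_n | forall i, z0 0 i - r <= z 0 i <= z0 0 i + r].
Proof.
have := @rV_compact R n (fun i => `[z0 0 i - r, z0 0 i + r]%classic)
  (fun i => @segment_compact R _ _).
by congr compact; apply/seteqP; split => z /= H i; have := H i; rewrite /= in_itv.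
Qed.

Lemma smooth_bump U x : open U -> U x -> exists b : M -> R,
  [/\ smooth_on setT b, compact (supp b), supp b `<=` U, forall y, 0 <= b y & 0 < b x].
Proof.
move=> oU Ux; have cx := dom_chart_at x; set c := chart_at x in cx *.
pose z0 := coord c x.
have Uz : nbhs z0 (coord c @` (dom c `&` U)).
  by apply: open_nbhs_nbhs; split; [exact: open_coord_image|exact: coord_image].
move: Uz => /nbhs_ballP[e /= e0 ze].
pose r := e / 2; have r0 : 0 < r by rewrite divr_gt0.
pose Q := [set z : 'rV[R]_n | forall i, z0 0 i - r <= z 0 i <= z0 0 i + r].
have QI : Q `<=` coord c @` (dom c `&` U).
  move=> z Qz; apply: ze; rewrite -ball_normE/=.
  apply: (@le_lt_trans _ _ r); last by rewrite /r; lra.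
  apply: rV_norm_le; first exact: ltW.
  move=> i; rewrite !mxE ler_norml; have := Qz i; move=> /andP[? ?].
  by apply/andP; split; lra.
pose b y := patch (fun=> 0) (dom c) (cube_profile z0 r \o coord c) y.
have bE y : dom c y -> b y = cube_profile z0 r (coord c y).
  by move=> cy; rewrite /b patchE mem_set.
have bN y : ~ dom c y -> b y = 0 by move=> cy; rewrite /b patchE memNset.
have b0 y : 0 <= b y.
  have [cy|cy] := pselect (dom c y); first by rewrite bE ?cube_profile_ge0.
  by rewrite bN.
(* The image of the closed cube is compact, hence closed in the Hausdorff space [M]. It therefore
   contains the support of [b], which stays inside [dom c], and the extension by 0 is smooth. *)
have cK : compact (param c @` Q).
  apply: continuous_compact; last exact: compact_cube.
  apply: continuous_in_subspaceT => z /set_mem /QI [y [cy _] <-].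
  exact: param_continuous_at.
have KU : param c @` Q `<=` dom c `&` U.
  by move=> _ [z /QI [y [cy Uy] <-] <-]; rewrite coordK.
have sb : supp b `<=` param c @` Q.
  rewrite [X in _ `<=` X](closure_id _).1; last exact: compact_closed_manifold.
  apply: closure_subset => y /=.
  have [cy|cy] := pselect (dom c y); last by rewrite bN// eqxx.
  rewrite bE// => by0; exists (coord c y); last exact: coordK.
  by move=> i; exact: cube_profile_neq0 by0.
exists b; split => //.
- move=> k; apply: (@Ck_on_supp _ _ _ _ (dom c)); last first.
    by move=> y /sb /KU[].
  move=> d.
  have oI : open (coord d @` (dom d `&` dom c)) by exact/open_coord_image/dom_open.
  have CT := @transition_smooth _ _ M d c k.
  apply: is_Ck_eq (is_Ck_cube_profile z0 r oI CT) => //.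
  by move=> _ [y [dy cy] <-] /=; rewrite coordK// bE.
- by apply: compact_sub cK sb; exact: closed_closure.
- by move=> y /sb /KU[].
- by rewrite bE//; exact: cube_profile_gt0.
Qed.

Lemma smooth_positive_on_compact C U : compact C -> open U -> C `<=` U ->
  exists f : M -> R, [/\ smooth_on setT f, compact (supp f), supp f `<=` U,
    forall y, 0 <= f y & forall y, C y -> 0 < f y].
Proof.
move=> cC oU CU.
(* Positivity at [x] is conditional on [U x], so that every point has a witness (0 outside [U]) and
   choice gives a total family. *)
pose P x (b : M -> R) := [/\ smooth_on setT b, compact (supp b), supp b `<=` U,
  forall y, 0 <= b y & U x -> 0 < b x].
have exP x : exists b, P x b.
  have [Ux|Ux] := pselect (U x).
    by have [b [? ? ? ? ?]] := smooth_bump oU Ux; exists b.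
  exists (cst 0); split => //; first by move=> k; exact: Ck_on_cst.
    by rewrite /supp (_ : [set _ | _] = set0) ?closure0//; [exact: compact0|];
      apply/seteqP; split => // y /=; rewrite eqxx.
  rewrite /supp (_ : [set _ | _] = set0) ?closure0//.
  by apply/seteqP; split => // y /=; rewrite eqxx.
have [b bP] := choice exP.
have /(_ M setT (fun x => [set y | 0 < b x y])) : cover_compact C.
  by rewrite -compact_cover.
case=> [x _|x Cx|J _ CJ].
- rewrite openE => y /= by0; have [Cb _ _ _ _] := bP x.
  have cb : {for y, continuous (b x)} by exact: Ck_on_continuous (Cb 0) (Logic.I : setT y).
  exact: (cb _ (open_nbhs_nbhs (conj (@open_gt R 0) by0))).
- by exists x => //=; have [_ _ _ _ bx] := bP x; apply: bx; exact: CU.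
suff H (s : seq M) : exists f : M -> R, [/\ smooth_on setT f, compact (supp f), supp f `<=` U,
    forall y, 0 <= f y & forall y x, x \in s -> 0 < b x y -> 0 < f y].
  have [f [Cf cf sf f0 fs]] := H J; exists f.
  split; [exact: Cf|exact: cf|exact: sf|exact: f0|move=> y Cy].
  by have [x Jx bxy] := CJ y Cy; exact: fs bxy.
elim: s => [|x s [f [Cf cf sf f0 fs]]].
  exists (cst 0); split => //; first by move=> k; exact: Ck_on_cst.
    by rewrite /supp (_ : [set _ | _] = set0) ?closure0//; [exact: compact0|];
      apply/seteqP; split => // y /=; rewrite eqxx.
  rewrite /supp (_ : [set _ | _] = set0) ?closure0//.
  by apply/seteqP; split => // y /=; rewrite eqxx.
have [Cb cb sb b0 _] := bP x.
exists (fun y => b x y + f y); split.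
- by move=> k; exact: Ck_onD openT (Cb k) (Cf k).
- apply: (@compact_sub _ (supp (b x) `|` supp f)); [exact: closed_closure| |exact: suppD].
  exact: compactU.
- by move=> y /suppD[/sb|/sf].
- by move=> y; rewrite addr_ge0.
- move=> y z; rewrite inE => /predU1P[->|zs] bz; first by rewrite ltr_pwDl.
  by rewrite ltr_wpDl// (fs y z).
Qed.

(** The classical quotient [F g / (F g + F (1 - g))] with the flat profile [F]: as [g] and [1 - g]
    are never both nonpositive, the denominator is positive, and the quotient is 1 as soon as
    [g > 1]. *)
Lemma smooth_cutoff C U : compact C -> open U -> C `<=` U ->
  exists (f : M -> R) (V : set M), [/\ smooth_on setT f, compact (supp f), supp f `<=` U,
    forall y, 0 <= f y <= 1 & [/\ open V, C `<=` V & forall y, V y -> f y = 1]].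
Proof.
move=> cC oU CU; have [f [Cf cf sf f0 fC]] := smooth_positive_on_compact cC oU CU.
have cff y : {for y, continuous f} by exact: Ck_on_continuous (Cf 0) (Logic.I : setT y).
have [m m0 mf] : exists2 m, 0 < m & forall y, C y -> m <= f y.
  have [[x0 Cx0]|/nonemptyPn C0] := pselect (C !=set0); last first.
    by exists 1 => // y; rewrite C0.
  have cw : {within C, continuous f} by apply: continuous_in_subspaceT => x _; exact: cff.
  have [|x Cx H] := @compact_EVT_min M R f C _ cC cw; first by exists x0.
  exists (f x); first by apply: fC; exact/set_mem.
  by move=> y Cy; apply: H; exact/mem_set.
(* [f >= m] on [C], so the factor 2 gives [g >= 2] there, and [{1 < g}] is an open neighbourhood of
   [C]. *)
pose g y := 2 / m * f y.
have Cg k : Ck_on k setT g.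
  exact: (Ck_onM openT (@Ck_on_cst _ _ M k setT (2 / m)) (Cf k)).
have Cg1 k : Ck_on k setT (fun y => 1 + (-1) * g y).
  exact: (Ck_onD openT (@Ck_on_cst _ _ M k setT 1)
    (Ck_onM openT (@Ck_on_cst _ _ M k setT (-1)) (Cg k))).
have CF k (h : M -> R) : Ck_on k setT h -> Ck_on k setT (flat_profile \o h).
  move=> Ch; exact: (Ck_on_comp openT flat_exp_stable flat_profile_range Ch).
pose den y := flat_profile (g y) + flat_profile (1 + (-1) * g y).
have den0 y : 0 < den y.
  have [g0|g0] := ltP 0 (g y).
    by rewrite ltr_pwDl ?flat_profile_gt0 ?flat_profile_ge0.
  by rewrite ltr_wpDl ?flat_profile_gt0 ?flat_profile_ge0//; lra.
pose eta y := flat_profile (g y) * (den y)^-1.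
have seta : supp eta `<=` supp f.
  apply: closure_subset => y /=; apply: contra_neq => fy.
  by rewrite /eta /g fy mulr0 flat_profile_le0// mul0r.
exists eta, [set y | 1 < g y]; split.
- move=> k; apply: (Ck_onM openT (CF k g (Cg k))).
  apply: (Ck_onV openT) => [x _|]; first by rewrite gt_eqF.
  exact: (Ck_onD openT (CF k g (Cg k)) (CF k _ (Cg1 k))).
- by apply: compact_sub cf seta; exact: closed_closure.
- by move=> y /seta /sf.
- move=> y; rewrite divr_ge0 ?flat_profile_ge0 ?(ltW (den0 y))//=.
  by rewrite ler_pdivrMr// mul1r lerDl flat_profile_ge0.
split.
- rewrite openE => y /= gy.
  have cg : {for y, continuous g} by exact: Ck_on_continuous (Cg 0) (Logic.I : setT y).
  exact: (cg _ (open_nbhs_nbhs (conj (@open_gt R 1) gy))).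
- move=> y /mf my; rewrite /= /g; have : 2 / m * m <= 2 / m * f y.
    by rewrite ler_wpM2l// divr_ge0// ltW.
  by rewrite divfK ?gt_eqF//; lra.
- move=> y /= gy; rewrite /eta /den (@flat_profile_le0 _ (1 + _)); last lra.
  by rewrite addr0 mulfV// gt_eqF// flat_profile_gt0// (lt_trans ltr01).
Qed.

End cutoffs.

(** * Curves, distance and the Hopf-Rinow theorem *)

Section curves.
Context {R : realType} {n : nat} (M : riemannianManifold R n).
Implicit Types (c d : chart M) (x y z : M) (h : M -> R) (g : R -> M) (a b t l : R).

Definition speed g t : R := tnorm (g t) (velocity g t).

Lemma derive_coord_transition c d g t : dom c (g t) -> dom d (g t) ->
  {for t, continuous g} -> derivable (coord c \o g) t 1 ->
  is_derive t (1 : R) (coord d \o g)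
    ('D_1 (coord c \o g) t *m 'J (coord d \o param c) (coord c (g t))).
Proof.
move=> cg dg gt dcg; have [_ dT _] := transition_at cg dg.
have [dTg E] := @is_derive_comp_diff _ _ _ _ (coord c \o g) (coord d \o param c)
  t 1 dcg dT.
have nE : \forall s \near t, ((coord d \o param c) \o (coord c \o g)) s =
    (coord d \o g) s.
  have : \forall s \near t, dom c (g s) by exact: gt _ (nbhs_dom cg).
  by apply: filterS => s cs /=; rewrite coordK.
apply: (near_eq_is_derive nE); split => //.
by rewrite E -deriveE// deriveEjacobian.
Qed.

(** [velocity] uses the chart chosen at [g t], which may jump with [t]; in a fixed chart the speed
    has a formula that is visibly continuous in [t]. *)
Lemma speed_chart c g t : dom c (g t) -> {for t, continuous g} ->
  derivable (coord c \o g) t 1 ->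
  let w := derive1 (coord c \o g) t in
  speed g t = Num.sqrt ((w *m metric c (coord c (g t)) *m w^T) 0 0).
Proof.
move=> cg gt dcg w; have dg := dom_chart_at (g t).
have [_ _ gE] := transition_at cg dg.
have [_ E] := derive_coord_transition cg dg gt dcg.
rewrite /speed /tnorm /tinner /velocity /gram gE derive1E E -derive1E -/w.
by rewrite trmx_mul !mulmxA.
Qed.

Lemma is_derive_along c g h t : dom c (g t) -> {for t, continuous g} ->
  derivable (coord c \o g) t 1 -> Ck_on 1 setT h ->
  is_derive t (1 : R) (h \o g)
    ((derive1 (coord c \o g) t *m (partials c h (g t))^T) 0 0).
Proof.
move=> cg gt dcg Ch.
have Ig : (coord c @` (dom c `&` setT)) (coord c (g t)) by exact: coord_image.
have [dh dhE] := is_Ck1_differential (open_coord_image openT) (Ch c) Ig.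
have [dhg E] := @is_derive_comp_diff _ _ _ _ (coord c \o g) (h \o param c) t 1 dcg dh.
have nE : \forall s \near t, ((h \o param c) \o (coord c \o g)) s = (h \o g) s.
  have : \forall s \near t, dom c (g s) by exact: gt _ (nbhs_dom cg).
  by apply: filterS => s cs /=; rewrite coordK.
apply: (near_eq_is_derive nE); split => //.
by rewrite E dhE mxE -derive1E; apply: eq_bigr => i _; rewrite !mxE.
Qed.

Lemma derive1_along h g t : {for t, continuous g} ->
  derivable (coord (chart_at (g t)) \o g) t 1 -> Ck_on 1 setT h ->
  derive1 (h \o g) t = tinner (g t) (grad h (g t)) (velocity g t).
Proof.
move=> gt dg Ch; have [_ E] := is_derive_along (dom_chart_at _) gt dg Ch.
by rewrite derive1E E tinner_grad mxE; apply: eq_bigr => i _; rewrite !mxE.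
Qed.

(** Continuity through local models: formulas in a fixed chart hold only near a given time and only
    for times of the interval, so the model [F] may vary with [t]. *)
Lemma within_continuous_near (A : set R) (f : R -> R) :
  (forall t, A t -> exists F, {for t, continuous F} /\
     \forall s \near t, A s -> F s = f s) ->
  {within A, continuous f}.
Proof.
move=> H; apply/subspace_continuousP => t At; have [F [cF EF]] := H _ At.
have Eft : F t = f t := nbhs_singleton EF At.
move=> B Bft; have {}cF : \forall s \near t, B (F s).
  by apply: (cF B); rewrite /= Eft.
change (\forall s \near t, A s -> B (f s)).
by apply: filterS2 cF EF => s BFs As_ As; rewrite -As_.
Qed.

Lemma C1_curve_near c g a b t : C1_curve g a b -> a <= t <= b -> dom c (g t) ->
  \forall s \near t, a <= s <= b ->
    [/\ {for s, continuous g}, dom c (g s) & derivable (coord c \o g) s 1].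
Proof.
move=> Cg abt ct; have [gt /(_ c ct)[dg _]] := Cg _ abt.
have := gt _ (nbhs_dom ct); move: dg; apply: filterS2 => s ds cs abs.
by split => //; have [] := Cg _ abs.
Qed.

Lemma continuous_metric_entry c x i j : dom c x ->
  {for coord c x, continuous (fun w => metric c w i j)}.
Proof.
move=> cx; apply: is_Ck_continuous (is_Ck_coord _ _ _ (metric_smooth c 0)) _.
  exact: coord_open.
exact: coord_image_dom.
Qed.

Lemma speed_continuous g a b : C1_curve g a b -> {within `[a, b], continuous (speed g)}.
Proof.
move=> Cg; apply: within_continuous_near => t /=; rewrite in_itv/= => abt.
set c := chart_at (g t); have ct : dom c (g t) by exact: dom_chart_at.
pose w s := derive1 (coord c \o g) s.
have [gt /(_ c ct)[dg cw]] := Cg _ abt.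
exists (fun s => Num.sqrt ((w s *m metric c (coord c (g s)) *m (w s)^T) 0 0)); split.
  have cwi i j : {for t, continuous (fun s => w s i j)} by exact: continuous_entry_for cw.
  apply: (@continuous_comp _ _ _ (fun s =>
    (w s *m metric c (coord c (g s)) *m (w s)^T) 0 0) Num.sqrt); last exact: sqrt_continuous.
  apply: (@continuous_mulmx_for _ _ _ _ _ (fun s => w s *m metric c (coord c (g s)))
    (fun s => (w s)^T)) => i j; last first.
    by apply: continuous_for_ext (cwi j i) => s; rewrite mxE.
  apply: (@continuous_mulmx_for _ _ _ _ _ w (fun s => metric c (coord c (g s)))) => {}i {}j.
    exact: cwi.
  have cgt : {for t, continuous (coord c \o g)}.
    by apply: continuous_comp => //; exact: Defs.coord_continuous.
  exact: (@continuous_comp _ _ _ _ (fun q => metric c q i j) t cgt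
    (continuous_metric_entry ct)).
have := C1_curve_near Cg abt ct; apply: filterS => s H; rewrite in_itv/= => abs.
by have [gs cs ds] := H abs; rewrite (speed_chart cs gs ds).
Qed.

Lemma derive1_along_continuous g h a b : C1_curve g a b -> Ck_on 1 setT h ->
  {within `[a, b], continuous (derive1 (h \o g))}.
Proof.
move=> Cg Ch; apply: within_continuous_near => t /=; rewrite in_itv/= => abt.
set c := chart_at (g t); have ct : dom c (g t) by exact: dom_chart_at.
pose w s := derive1 (coord c \o g) s.
have [gt /(_ c ct)[dg cw]] := Cg _ abt.
exists (fun s => (w s *m (partials c h (g s))^T) 0 0); split.
  apply: (@continuous_mulmx_for _ _ _ _ _ w (fun s => (partials c h (g s))^T)) => i j.
    exact: continuous_entry_for cw.
  rewrite (_ : (fun s => _) =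
    (fun q => 'D_(delta_mx 0 i) (h \o param c) q) \o (coord c \o g)); last first.
    by apply/funext => s /=; rewrite !mxE.
  apply: continuous_comp.
    by apply: continuous_comp => //; exact: Defs.coord_continuous.
  have Ig : (coord c @` (dom c `&` setT)) (coord c (g t)) by exact: coord_image.
  by have [_ _] := (is_Ck1P _ _).1 (Ch c) _ Ig; exact.
have := C1_curve_near Cg abt ct; apply: filterS => s H; rewrite in_itv/= => abs.
have [gs cs ds] := H abs; have [_ E] := is_derive_along cs gs ds Ch.
by rewrite [RHS]derive1E E.
Qed.

Lemma segment_integrable (f : R -> R) a b : {within `[a, b], continuous f} ->
  lebesgue_measure.-integrable `[a, b] (EFin \o f).
Proof. by move=> cf; apply: continuous_compact_integrable => //; exact: segment_compact. Qed.

Lemma curve_length_ge0 g a b : 0 <= curve_length g a b.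
Proof. by apply: Rintegral_ge0 => t _; exact: tnorm_ge0. Qed.

(** The fundamental theorem of calculus along the curve, then Cauchy-Schwarz on the integrand. It
    bounds lengths from below, and thereby shows that small distance balls are small in the
    topology. *)
Lemma curve_variation g h a b (L : R) : a <= b -> C1_curve g a b -> Ck_on 1 setT h ->
  0 <= L -> (forall x, tnorm x (grad h x) <= L) ->
  `|h (g b) - h (g a)| <= L * curve_length g a b.
Proof.
rewrite le_eqVlt => /predU1P[<-|ab] Cg Ch L0 hL.
  by rewrite subrr normr0 mulr_ge0// curve_length_ge0.
have cd t : t \in `[a, b] -> derivable (h \o g) t 1.
  rewrite in_itv/= => abt; have [gt /(_ _ (dom_chart_at _))[dg _]] := Cg _ abt.
  by have [] := is_derive_along (dom_chart_at _) gt (nbhs_singleton dg) Ch.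
have ch t : t \in `[a, b] -> {for t, continuous (h \o g)}.
  move=> abt; apply: differentiable_continuous; apply/derivable1_diffP; exact: cd.
have cD := derive1_along_continuous Cg Ch.
have cs := speed_continuous Cg.
have iD := segment_integrable cD.
have LR : derivable_oo_LRcontinuous (h \o g) a b.
  split=> [t /subset_itv_oo_cc||]; first exact: cd.
    by apply: cvg_at_right_filter; apply: ch; rewrite in_itv/= lexx ltW.
  by apply: cvg_at_left_filter; apply: ch; rewrite in_itv/= lexx ltW.
have := continuous_FTC2 ab cD LR (fun _ _ => erefl).
rewrite -EFinB => /(congr1 fine)/= <-.
apply: (le_trans (le_normr_Rintegral _ iD)); first exact: measurable_itv.
rewrite /curve_length -RintegralZl//; last exact: segment_integrable.
apply: le_Rintegral => //.
- exact: integrable_norm.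
- rewrite (_ : EFin \o _ = fun t => (L%:E * (speed g t)%:E)%E).
    by apply: integrableZl => //; exact: segment_integrable.
  by apply/funext => t; rewrite /= EFinM.
move=> t /=; rewrite in_itv/= => abt.
have [gt /(_ _ (dom_chart_at _))[dg _]] := Cg _ abt.
rewrite (derive1_along gt (nbhs_singleton dg) Ch).
apply: le_trans (tinner_CS _ _ _) _.
by apply: ler_wpM2r (hL _); exact: tnorm_ge0.
Qed.

Lemma piecewise_variation h x y l (L : R) : Ck_on 1 setT h -> 0 <= L ->
  (forall x, tnorm x (grad h x) <= L) -> piecewise_C1_length x y l ->
  `|h y - h x| <= L * l.
Proof.
move=> Ch L0 hL; elim=> [{}x|g a b {}y {}l ab Cg _ ih].
  by rewrite subrr normr0 mulr0.
rewrite (_ : h y - _ = (h y - h (g b)) + (h (g b) - h (g a))); last by rewrite addrA subrK.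
rewrite mulrDr addrC; apply: le_trans (ler_normD _ _) _.
by apply: lerD => //; exact: curve_variation.
Qed.

Lemma piecewise_length_ge0 x y l : piecewise_C1_length x y l -> 0 <= l.
Proof. by elim=> // g a b {}y {}l _ _ _ l0; rewrite addr_ge0// curve_length_ge0. Qed.

Lemma piecewise_cat x y z l l' : piecewise_C1_length x y l ->
  piecewise_C1_length y z l' -> piecewise_C1_length x z (l + l').
Proof.
move=> xy; elim: xy z l' => [{}x|g a b {}y {}l ab Cg _ ih] z l' yz.
  by rewrite add0r.
by rewrite -addrA; apply: piecewise_C1_cons => //; exact: ih.
Qed.

End curves.

(** * Reversing and splitting curves *)

Section curve_surgery.
Context {R : realType} {n : nat} (M : riemannianManifold R n).
Implicit Types (c d : chart M) (x y : M) (h : M -> R) (g : R -> M) (a b t l : R).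

Lemma is_derive_rev (f : R -> 'rV[R]_n) (s : R) : derivable f (- s) 1 ->
  is_derive s (1 : R) (f \o -%R) (- 'D_1 f (- s)).
Proof.
move=> df; have df' : differentiable f (- s) by apply/derivable1_diffP.
have dN : is_derive s (1 : R) -%R (-1 : R) by exact: is_deriveNid.
have [dfN E] := @is_derive_comp_diff _ _ _ _ (-%R : R -> R) f s 1 (@ex_derive _ _ _ _ _ _ _ dN) df'.
split=> //; rewrite E; case: dN => _ ->.
by rewrite raddfN (deriveE _ df').
Qed.

Lemma near_opp (P : R -> Prop) t :
  (\forall s \near - t, P s) -> \forall s \near t, P (- s).
Proof. by move=> H; exact: (@opp_continuous R t) _ H. Qed.

Lemma C1_curve_rev g a b : C1_curve g a b -> C1_curve (g \o -%R) (- b) (- a).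
Proof.
move=> Cg t; rewrite lerNl lerNr andbC => abt.
have cN : {for t, continuous (-%R : R -> R)} by exact: opp_continuous.
have [gt H] := Cg _ abt; split; first exact: continuous_comp.
move=> c /H[dg cg].
have dg' := near_opp dg.
split.
  by apply: filterS dg' => s ds; have [dr _] := is_derive_rev ds; exact: dr.
apply: (@continuous_near_eq _ _ (fun s => - derive1 (coord c \o g) (- s))).
  apply: filterS dg' => s ds; have [_ E] := is_derive_rev ds.
  by rewrite !derive1E -E.
apply: (@continuous_comp _ _ _ (fun s => derive1 (coord c \o g) (- s)) -%R);
  last exact: opp_continuous.
exact: (@continuous_comp _ _ _ -%R (derive1 (coord c \o g))).
Qed.

Lemma speed_rev g t : derivable (coord (chart_at (g (- t))) \o g) (- t) 1 ->
  speed (g \o -%R) t = speed g (- t).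
Proof.
move=> dg; have [_ E] := is_derive_rev dg.
rewrite /speed /velocity /= derive1E (_ : 'D_1 _ t = - velocity g (- t)).
  by rewrite -[- velocity _ _]scaleN1r tnormZ normrN1 mul1r.
by rewrite compA E /velocity derive1E.
Qed.

Lemma curve_length_rev g a b : a <= b -> C1_curve g a b ->
  curve_length (g \o -%R) (- b) (- a) = curve_length g a b.
Proof.
move=> ab Cg; have Cg' := C1_curve_rev Cg.
have E t : a <= t <= b -> speed (g \o -%R) (- t) = speed g t.
  move=> abt; have [_ /(_ _ (dom_chart_at _))[dg _]] := Cg _ abt.
  by rewrite speed_rev opprK//; exact: nbhs_singleton dg.
have I := integration_by_substitution_oppr ab (speed_continuous Cg').
apply: (congr1 fine); apply: etrans I _; apply: eq_integral => t tab.
by apply: (congr1 EFin); apply: E; move: tab; rewrite inE/= in_itv.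
Qed.

Lemma piecewise_rev x y l : piecewise_C1_length x y l -> piecewise_C1_length y x l.
Proof.
elim=> [{}x|g a b {}y {}l ab Cg _ ih]; first exact: piecewise_C1_nil.
rewrite addrC; apply: piecewise_cat ih _.
rewrite -[curve_length _ _ _]addr0 -(curve_length_rev ab Cg).
have := @piecewise_C1_cons _ _ M (g \o -%R) (- b) (- a) (g a) 0.
rewrite /= !opprK lerN2; apply => //; first exact: C1_curve_rev.
exact: piecewise_C1_nil.
Qed.

(** If the first piece is longer than [s], the intermediate value theorem applied to the length
    travelled finds the cutting time; otherwise the cut lies in a later piece. *)
Lemma piecewise_split x y l s : piecewise_C1_length x y l -> 0 <= s <= l ->
  exists2 z, piecewise_C1_length x z s & piecewise_C1_length z y (l - s).
Proof.
move=> P; elim: P s => [{}x|g a b {}y {}l ab Cg P ih] s /andP[s0 sl].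
  have -> : s = 0 by apply/eqP; rewrite eq_le s0 sl.
  by rewrite subrr; exists x; exact: piecewise_C1_nil.
have [ls|sl'] := leP (curve_length g a b) s.
  have [|z xz zy] := ih (s - curve_length g a b); first by rewrite subr_ge0 ls/= lerBlDl.
  exists z; last by rewrite (_ : _ - s = l - (s - curve_length g a b))//; ring.
  by rewrite -(subrK (curve_length g a b) s) addrC; exact: piecewise_C1_cons.
have is' := segment_integrable (speed_continuous Cg).
have cL := parameterized_integral_continuous ab is'.
have La : parameterized_integral lebesgue_measure a a (speed g) = 0.
  by rewrite /parameterized_integral set_itv1 Rintegral_set1.
have [|t tab Et] := IVT ab cL (v := s).
  by rewrite La ge_min s0/= le_max (ltW sl') orbT.
move: tab; rewrite in_itv/= => /andP[at_ tb].
have sub a' b' : a <= a' -> b' <= b -> C1_curve g a' b'.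
  move=> aa bb r /andP[ar rb]; apply: Cg.
  by rewrite (le_trans aa ar) (le_trans rb bb).
have Eb : curve_length g t b = curve_length g a b - s.
  rewrite -Et /parameterized_integral /curve_length Rintegral_itvB//.
  apply/esym/Rintegral_itv_obnd_cbnd; apply: integrableS is' => //.
  by apply: subset_itvr; rewrite bnd_simp.
exists (g t); last first.
  rewrite addrAC -Eb; apply: piecewise_C1_cons P => //; exact: sub.
rewrite -[s]addr0 -{1}Et; apply: piecewise_C1_cons => //; first exact: sub.
exact: piecewise_C1_nil.
Qed.

End curve_surgery.

(** * Straight segments in a chart *)

Section segments.
Context {R : realType} {n : nat} (M : riemannianManifold R n).
Implicit Types (c d : chart M) (x y : M) (t l : R) (q w : 'rV[R]_n).

(** A directional derivative written with the partial derivatives, whose continuity is what C^1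
    regularity provides. *)
Let dir (f : 'rV[R]_n -> 'rV[R]_n) w q : 'rV[R]_n :=
  \sum_i w 0 i *: 'D_(delta_mx 0 i) f q.

Lemma derive_dir (f : 'rV[R]_n -> 'rV[R]_n) w q :
  differentiable f q -> 'D_w f q = dir f w q.
Proof.
move=> df; rewrite deriveEjacobian// {1}[w]row_sum_delta mulmx_suml.
by apply: eq_bigr => i _; rewrite -scalemxAl deriveEjacobian.
Qed.

Lemma continuous_line q w t : {for t, continuous (fun s : R => s *: w + q)}.
Proof.
apply: cvgD; last exact: cvg_cst.
by apply: (@cvgZr_tmp _ _ _ _ _ id); exact: cvg_id.
Qed.

Lemma segment_C1 c q w :
  (forall t, 0 <= t <= 1 -> (coord c @` dom c) (t *: w + q)) ->
  C1_curve (fun t => param c (t *: w + q)) 0 1 /\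
  forall t, 0 <= t <= 1 ->
    speed (fun t => param c (t *: w + q)) t =
    Num.sqrt ((w *m metric c (t *: w + q) *m w^T) 0 0).
Proof.
move=> cI.
have line t : {for t, continuous (fun s : R => s *: w + q)} by exact: continuous_line.
have C1 : C1_curve (fun t => param c (t *: w + q)) 0 1.
  move=> t t01; have ct := cI _ t01; split.
    by apply: (@continuous_comp _ _ _ (fun s : R => s *: w + q)) => //; exact: param_continuous.
  move=> d dt; pose f := coord d \o param c.
  have U : (coord c @` (dom c `&` dom d)) (t *: w + q).
    by case: ct => y cy E; exists y => //; split=> //; rewrite -(coordK cy) E.
  have oU : open (coord c @` (dom c `&` dom d)) by apply: open_coord_image; exact: dom_open.
  have Cf := transition_smooth c d 1.
  have nU : \forall s \near t, (coord c @` (dom c `&` dom d)) (s *: w + q).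
    exact: (line t) _ (open_nbhs_nbhs (conj oU U)).
  have df : \forall s \near t, differentiable f (s *: w + q).
    by apply: filterS nU => s Us; exact: is_Ck1_differentiable_mx oU Cf Us.
  have D : \forall s \near t, is_derive (s : R) (1 : R)
      (fun r : R => f (r *: w + q)) (dir f w (s *: w + q)).
    apply: filterS df => s ds; rewrite -derive_dir//.
    by apply: is_derive_line; exact: diff_derivable.
  split; first by apply: filterS D => s [].
  have cF : {for t, continuous (fun s : R => dir f w (s *: w + q))}.
    apply: (@continuous_comp _ _ _ (fun s : R => s *: w + q)); first exact: line.
    have Fq : Filter (nbhs (t *: w + q)) := nbhs_filter _.
    apply: (@cvg_big _ _ +%R 0 xpredT _ _ _ _ (fun i p => w 0 i *: 'D_(delta_mx 0 i) f p)
      (fun i => w 0 i *: 'D_(delta_mx 0 i) f (t *: w + q))) => [|i _].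
      exact: add_continuous.
    apply: cvgZl_tmp.
    by have [_ _] := (is_Ck1P _ _).1 Cf _ U; exact.
  apply: continuous_near_eq cF.
  by apply: filterS D => s [_ E]; rewrite derive1E -E.
split=> // t t01; have [y cy E] := cI _ t01.
have gt : dom c (param c (t *: w + q)) by rewrite -E coordK.
have [cg /(_ c gt)[dg _]] := C1 _ t01.
rewrite (speed_chart gt cg (nbhs_singleton dg)).
have -> : coord c (param c (t *: w + q)) = t *: w + q.
  by rewrite -E coordK.
suff -> : derive1 (coord c \o (fun t => param c (t *: w + q))) t = w by [].
have D : is_derive t (1 : R) (fun s : R => s *: w + q) w.
  have := @is_derive_line R _ _ id q w t; rewrite /=.
  by rewrite derive_id; apply; exact: derivable_id.
case: D => _ {2}<-; rewrite derive1E; apply: near_eq_derive.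
have : \forall s \near t, (coord c @` dom c) (s *: w + q).
  exact: (line t) _ (open_nbhs_nbhs (conj (@coord_open _ _ M c) (cI _ t01))).
by apply: filterS => s [z cz Ez] /=; rewrite -Ez coordK.
Qed.

(** Join [x] to [y] by a segment in a chart. Near [q] the metric entries are bounded, with sum of
    bounds [B], so the squared speed is at most [B] times the square of the size [m] of the
    displacement. *)
Lemma short_curves x (e : R) : 0 < e ->
  \forall y \near x, exists2 l, l < e & piecewise_C1_length x y l.
Proof.
move=> e0; pose c := chart_at x; have cx : dom c x by exact: dom_chart_at.
pose q := coord c x.
pose B := \sum_i \sum_j (`|metric c q i j| + 1).
have B0 : 0 <= B by do 2!apply: sumr_ge0 => ? _; rewrite addr_ge0.
have nB : \forall p \near q, forall i j, `|metric c p i j| <= `|metric c q i j| + 1.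
  apply: (@filter_forall _ _ (fun i p => forall j, `|metric c p i j| <= `|metric c q i j| + 1)
    _ (nbhs_filter q)) => i.
  apply: (@filter_forall _ _ (fun j p => `|metric c p i j| <= `|metric c q i j| + 1)
    _ (nbhs_filter q)) => j.
  have : {for q, continuous (fun p => `|metric c p i j|)}.
    apply: (@continuous_comp _ _ _ (fun p => metric c p i j) Num.norm).
      exact: continuous_metric_entry.
    exact: norm_continuous.
  move=> cn; have L : `|metric c q i j| < `|metric c q i j| + 1 by rewrite ltrDl.
  have : \forall p \near q, `|metric c p i j| < `|metric c q i j| + 1.
    exact: cn _ (open_nbhs_nbhs (conj (@open_lt R _) L)).
  by apply: (@filterS _ _ (nbhs_filter q)) => p /ltW.
have : \forall p \near q, (coord c @` dom c) p /\
    forall i j, `|metric c p i j| <= `|metric c q i j| + 1.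
  have Iq : \forall p \near q, (coord c @` dom c) p.
    by apply: open_nbhs_nbhs; split; [exact: coord_open|exact: coord_image_dom].
  by apply: (@filterS2 _ _ (nbhs_filter q)) nB Iq => p.
move/nbhs_ballP => [r /= r0 rq].
(* Since [B <= (1 + B)^2], this gives [B * m^2 <= (m * (1 + B))^2 <= (e / 2)^2]; using [1 + B]
   avoids a square root and a zero denominator. *)
pose m := Num.min r (e / (2 * (1 + B))).
have m0 : 0 < m by rewrite lt_min r0 divr_gt0// mulr_gt0// ltr_pwDl.
have : \forall y \near x, ball q m (coord c y).
  by apply: near_coord => //; exact: nbhsx_ballx.
apply: filterS2 (nbhs_dom cx) => y cy.
rewrite -ball_normE /= distrC ; set w := coord c y - q => wm.
have wE : w + q = coord c y by rewrite /w subrK.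
clearbody w.
have sq t : 0 <= t <= 1 -> (coord c @` dom c) (t *: w + q) /\
    forall i j, `|metric c (t *: w + q) i j| <= `|metric c q i j| + 1.
  move=> /andP[t0 t1]; apply: rq; rewrite -ball_normE /=.
  rewrite opprD addrCA subrr addr0 normrN normrZ ger0_norm//.
  apply: le_lt_trans (_ : `|w| < r); first by rewrite ler_piMl.
  by apply: lt_le_trans wm _; rewrite ge_min lexx.
have [C1 spd] := @segment_C1 c q w (fun t t01 => (sq t t01).1).
exists (curve_length (fun t => param c (t *: w + q)) 0 1); last first.
  have := @piecewise_C1_cons _ _ M _ 0 1 _ 0 ler01 C1 (piecewise_C1_nil _).
  rewrite scale0r add0r scale1r wE addr0 /q !coordK//.
have le_e t : 0 <= t <= 1 -> speed (fun t => param c (t *: w + q)) t <= e / 2.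
  move=> t01; rewrite spd//; have [_ HB] := sq _ t01.
  rewrite -[leRHS]ger0_norm ?divr_ge0 ?(ltW e0)// -sqrtr_sqr; apply: ler_wsqrtr.
  apply: le_trans (ler_norm _) _.
  have wm' : `|w| <= m by exact: ltW.
  apply: (@le_trans _ _ (B * m ^+ 2)).
    rewrite mxE; apply: le_trans (ler_norm_sum _ _ _) _.
    rewrite [B]exchange_big mulr_suml /=; apply: ler_sum => j _.
    rewrite normrM !mxE.
    rewrite expr2 mulrA; apply: ler_pM => //; last exact: le_trans (rV_coord_le _ _) wm'.
    apply: le_trans (ler_norm_sum _ _ _) _.
    rewrite mulr_suml; apply: ler_sum => i _; rewrite normrM mulrC.
    by apply: ler_pM => //; exact: le_trans (rV_coord_le _ _) wm'.
  have m1 : m <= e / (2 * (1 + B)) by rewrite ge_min lexx orbT.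
  have B1 : 0 < 1 + B by rewrite ltr_pwDl.
  have m2 : m * (1 + B) <= e / 2.
    by rewrite -ler_pdivlMr// -mulrA -invfM.
  apply: (@le_trans _ _ ((m * (1 + B)) ^+ 2)); last first.
    by rewrite ler_sqr ?nnegrE ?divr_ge0 ?mulr_ge0// ltW.
  rewrite exprMn mulrC ler_wpM2l ?sqr_ge0//.
  by rewrite expr2 mulrDl mul1r; nra.
have : curve_length (fun t => param c (t *: w + q)) 0 1 <= e / 2.
  apply: (@le_trans _ _ (\int[lebesgue_measure]_(t in `[0, 1]) (e / 2))).
    apply: le_Rintegral => //.
    - exact/segment_integrable/speed_continuous.
    - by apply: segment_integrable; apply: continuous_subspaceT => ?; exact: cvg_cst.
  have E1 : lebesgue_measure (`[0, 1]%classic : set R) = 1%:E.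
    by rewrite lebesgue_measure_itv/= lte_fin ltr01 oppr0 adde0.
  rewrite Rintegral_cst; first by rewrite [X in fine X]E1 mulr1.
  exact: measurable_itv.
by move/le_lt_trans; apply; rewrite ltr_pdivrMr// ltr_pMr// ltr1n.
Qed.

End segments.

(** * The Riemannian distance and relative compactness of balls *)

Section distance.
Context {R : realType} {n : nat} (M : riemannianManifold R n).
Implicit Types (x y z o : M) (l r s e : R).

(** Points that can be reached form an open set by short curves, and so do the others, by reversing
    short curves. The set of lengths is thus nonempty, and [gdist] never falls back on the default
    value of [inf] at the empty set. *)
Lemma piecewise_connected x y : exists l, piecewise_C1_length x y l.
Proof.
pose S := [set y | exists l, piecewise_C1_length x y l].
suff : S = setT by move=> E; have : S y by rewrite E.
apply: (@manifold_connected _ _ M).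
- by exists x, 0; exact: piecewise_C1_nil.
- exists S; rewrite ?setTI// openE => z [l xz].
  apply: filterS (short_curves z ltr01) => w [l' _ zw].
  by exists (l + l'); exact: piecewise_cat xz zw.
- exists S; rewrite ?setTI// -openC openE => z Sz.
  apply: filterS (short_curves z ltr01) => w [l' _ zw] [l xw].
  by apply: Sz; exists (l + l'); exact: piecewise_cat xw (piecewise_rev zw).
Qed.

Lemma gdist_le x y l : piecewise_C1_length x y l -> gdist x y <= l.
Proof. by move=> xy; apply: ge_inf => //; exists 0 => k; exact: piecewise_length_ge0. Qed.

Lemma gdist_ltP x y e : gdist x y < e -> exists2 l, l < e & piecewise_C1_length x y l.
Proof.
move=> xye; have [l xyl le] := inf_lt (piecewise_connected x y) xye.
by exists l.
Qed.

Lemma gdist_ge0 x y : 0 <= gdist x y.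
Proof.
apply: lb_le_inf; first exact: piecewise_connected.
by move=> l; exact: piecewise_length_ge0.
Qed.

Lemma gdist_sym x y : gdist x y = gdist y x.
Proof.
by congr inf; apply/seteqP; split=> l; exact: piecewise_rev.
Qed.

Lemma gdist_triangle x y z : gdist x z <= gdist x y + gdist y z.
Proof.
apply/ler_addgt0Pl => e e0; have e2 : 0 < e / 2 by rewrite divr_gt0.
have [|l xye xy] := @gdist_ltP x y (gdist x y + e / 2); first by rewrite ltrDl.
have [|l' yze yz] := @gdist_ltP y z (gdist y z + e / 2); first by rewrite ltrDl.
by apply: le_trans (gdist_le (piecewise_cat xy yz)) _; lra.
Qed.

Lemma gdist_near x e : 0 < e -> \forall y \near x, gdist x y < e.
Proof.
move=> /(short_curves x); apply: filterS => y [l le xy].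
exact: le_lt_trans (gdist_le xy) le.
Qed.

Lemma gball_open x r : open (gball x r).
Proof.
rewrite openE => y xy; have yr : 0 < r - gdist x y by rewrite subr_gt0.
apply: filterS (gdist_near y yr) => z yz; rewrite /gball/=.
by apply: le_lt_trans (gdist_triangle x y z) _; rewrite addrC -ltrBrDr.
Qed.

Lemma gball_center x r : 0 < r -> gball x r x.
Proof.
move=> r0; apply: le_lt_trans r0; apply: gdist_le; exact: piecewise_C1_nil.
Qed.

Lemma closure_gball x r s : r < s -> closure (gball x r) `<=` gball x s.
Proof.
move=> rs y cy.
have sr : 0 < s - r by rewrite subr_gt0.
have [z [xz yz]] := cy _ (gdist_near y sr).
apply: le_lt_trans (gdist_triangle x z y) _.
by rewrite (gdist_sym z); move: xz yz; rewrite /gball/=; lra.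
Qed.

Lemma gball_sub x y r s : gdist x y + r <= s -> gball y r `<=` gball x s.
Proof.
move=> H z yz; apply: le_lt_trans (gdist_triangle x y z) _.
by apply: lt_le_trans H; rewrite ltrD2l.
Qed.

Lemma variation_gdist (h : M -> R) (L : R) x y : Ck_on 1 setT h -> 0 < L ->
  (forall x, tnorm x (grad h x) <= L) -> `|h y - h x| <= L * gdist x y.
Proof.
move=> Ch L0 hL; rewrite mulrC -ler_pdivrMr//.
apply: lb_le_inf; first exact: piecewise_connected.
move=> l xy; rewrite ler_pdivrMr// mulrC.
by apply: piecewise_variation xy => //; exact: ltW.
Qed.

Definition relatively_compact (A : set M) := exists2 C, compact C & A `<=` C.

Lemma relatively_compact_sub (A B : set M) : A `<=` B ->
  relatively_compact B -> relatively_compact A.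
Proof. by move=> AB [C cC BC]; exists C => //; exact: subset_trans AB BC. Qed.

Lemma relatively_compact_bigcup (I : choiceType) (J : {fset I}) (A : I -> set M) :
  (forall i, i \in J -> relatively_compact (A i)) ->
  relatively_compact (\bigcup_(i in [set` J]) A i).
Proof.
elim/finSet_rect: J => J ih H.
have [J0|/fset0Pn[i iJ]] := eqVneq J fset0.
  by exists set0; [exact: compact0|move=> x [i]; rewrite /= J0].
have [|j|C1 cC1 H1] := ih (J `\ i)%fset; first exact: fproperD1.
  by rewrite in_fsetD1 => /andP[_]; exact: H.
have [C2 cC2 H2] := H _ iJ.
exists (C1 `|` C2); first exact: compactU.
move=> x [k /= kJ Akx]; have [ki|ki] := eqVneq k i; first by right; apply: H2; rewrite -ki.
by left; apply: H1; exists k => //=; rewrite in_fsetD1 ki.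
Qed.

Lemma compact_closure (A : set M) : relatively_compact A -> compact (closure A).
Proof.
move=> [C cC AC]; apply: (subclosed_compact _ cC); first exact: closed_closure.
have /closure_id -> := compact_closed_manifold cC; exact: closure_subset.
Qed.

(* A bump at [x] cannot vanish before the distance [b x / L] from [x]. *)
Lemma small_ball x : exists2 s, 0 < s & relatively_compact (gball x s).
Proof.
have [b [Cb cb _ b0 bx]] := smooth_bump openT (Logic.I : setT x).
have [L L0 bL] : exists2 L, 0 < L & forall y, tnorm y (grad b y) <= L.
  have ct y : {for y, continuous (fun y => tnorm y (grad b y))}.
    exact: (tnorm_grad_continuous openT (Logic.I : setT y) (Cb 1)).
  have [C C0 HC] := compact_continuous_bounded cb (fun y _ => ct y).
  exists (C + 1) => [|y]; first by rewrite ltr_wpDl.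
  have [sy|sy] := pselect (supp b y); first by apply: le_trans (HC y sy) _; rewrite lerDl.
  by rewrite grad_supp// tnorm0 addr_ge0.
exists (b x / L); first by rewrite divr_gt0.
exists (supp b) => // y; rewrite /gball/= => xy; apply: subset_closure => /=.
apply/eqP => by0; have := variation_gdist x y (Cb 1) L0 bL.
rewrite by0 sub0r normrN ger0_norm ?(ltW bx)// leNgt => /negP; apply.
by rewrite mulrC -ltr_pdivlMr.
Qed.

(* Otherwise [gball x (r / 2)] has compact closure, covered by finitely many
   balls of radius [r / 4]; splitting a curve of length less than [r] at distance
   [r / 2] from its end shows that the concentric balls of radius [3 / 4 * r]
   cover [gball x r]. *)
Lemma not_relatively_compact_step x r : 0 < r -> ~ relatively_compact (gball x r) ->
  exists2 y, gdist x y < r & ~ relatively_compact (gball y (3 / 4 * r)).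
Proof.
move=> r0 nr; have [cr|nr2] := pselect (relatively_compact (gball x (r / 2))); last first.
  exists x; first exact: gball_center.
  move=> H; apply: nr2; apply: relatively_compact_sub H.
  by apply: gball_sub; rewrite (_ : gdist x x = 0); [lra|apply/eqP; rewrite eq_le gdist_ge0 andbT;
    apply: gdist_le; exact: piecewise_C1_nil].
apply: contrapT => H; apply: nr.
have {}H y : gdist x y < r -> relatively_compact (gball y (3 / 4 * r)).
  by move=> xy; apply: contrapT => ny; apply: H; exists y.
have r4 : 0 < r / 4 by rewrite divr_gt0.
have r2 : 0 < r / 2 by rewrite divr_gt0.
have : cover_compact (closure (gball x (r / 2))).
  by rewrite -compact_cover; exact: compact_closure.
case/(_ M (closure (gball x (r / 2))) (fun y => gball y (r / 4))).
- by move=> y _; exact: gball_open.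
- by move=> y cy; exists y => //; exact: gball_center.
move=> J Jc Jcov.
apply: (@relatively_compact_sub _ (\bigcup_(y in [set` J]) gball y (3 / 4 * r))); last first.
  apply: relatively_compact_bigcup => y /Jc; rewrite inE => cy; apply: H.
  by have := @closure_gball x (r / 2) r _ y cy; apply; lra.
move=> z /gdist_ltP[l lr xz].
pose s := Num.max 0 (l - r / 2).
have l0 := piecewise_length_ge0 xz.
have [|w xw wz] := piecewise_split (s := s) xz.
  by rewrite le_max lexx/= ge_max l0/=; lra.
have xw2 : gball x (r / 2) w.
  apply: le_lt_trans (gdist_le xw) _; rewrite gt_max r2/=; lra.
have wz2 : gdist w z <= r / 2.
  have : l - r / 2 <= s by rewrite le_max lexx orbT.
  by move=> sl; apply: le_trans (gdist_le wz) _; lra.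
have [y yJ yw] := Jcov _ (subset_closure xw2).
exists y => //; apply: le_lt_trans (gdist_triangle y w z) _.
by move: yw; rewrite /gball/=; lra.
Qed.

Lemma hopf_rinow (hM : metrically_complete M) x r : relatively_compact (gball x r).
Proof.
apply: contrapT => nxr.
have r0 : 0 < r.
  rewrite ltNge; apply/negP => r0; apply: nxr; exists set0; first exact: compact0.
  by move=> y; rewrite /gball/= ltNge (le_trans r0)// gdist_ge0.
pose q : R := 3 / 4.
pose P (k : nat) y := ~ relatively_compact (gball y (r * q ^+ k)).
(* The premise [P k y] sits under the existential so that choice yields a total function; the junk
   value is [y] itself. *)
have stepP (k : nat) y : exists z, P k y -> gdist y z < r * q ^+ k /\ P k.+1 z.
  have [Py|nPy] := pselect (P k y); last by exists y.
  have rk : 0 < r * q ^+ k by rewrite mulr_gt0// exprn_gt0// /q; lra.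
  have [z yz nz] := not_relatively_compact_step rk Py.
  by exists z => _; split => //; rewrite /P exprS mulrCA.
have [F HF] := choice (fun ky : nat * M => stepP ky.1 ky.2).
pose a := fix a (k : nat) := if k is k'.+1 then F (k', a k') else x.
have aP k : P k (a k).
  by elim: k => [|k ih]; [rewrite /P expr0 mulr1|exact: (HF (k, a k) ih).2].
have a1 k : gdist (a k) (a k.+1) < r * q ^+ k by exact: (HF (k, a k) (aP k)).1.
(* [4 = 1 / (1 - q)] sums the geometric series. The induction runs on the exact partial sum, with
   [q ^+ i - q ^+ (i + j)] in place of [q ^+ i]. *)
have aD i j : gdist (a i) (a (i + j)%N) <= 4 * r * q ^+ i.
  suff : gdist (a i) (a (i + j)%N) <= 4 * r * (q ^+ i - q ^+ (i + j)).
    move/le_trans; apply; rewrite ler_wpM2l ?mulr_ge0 ?(ltW r0)// gerBl.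
    by rewrite exprn_ge0// /q; lra.
  elim: j => [|j ih].
    rewrite addn0 subrr mulr0; apply: gdist_le; exact: piecewise_C1_nil.
  rewrite addnS; apply: le_trans (gdist_triangle _ (a (i + j)%N) _) _.
  apply: le_trans (lerD ih (ltW (a1 _))) _.
  rewrite exprS; move: (q ^+ (i + j)) (q ^+ i) => A B; rewrite /q; lra.
have q0 e : 0 < e -> exists N, forall k, (N <= k)%N -> 4 * r * q ^+ k < e.
  move=> e0; have q1 : `|q| < 1 by rewrite ger0_norm /q; lra.
  have cq : 4 * r * q ^+ k @[k --> \oo] --> 4 * r * 0 by apply: cvgMl_tmp; exact: cvg_expr.
  move: cq; rewrite mulr0 => /cvgrPdist_lt/(_ _ e0)[N _ HN].
  exists N => k /HN; rewrite /= sub0r normrN.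
  by move/(le_lt_trans (ler_norm _)).
have [e e0|y ay] := hM a.
  have [N HN] := q0 _ e0; exists N => i j Ni Nj.
  wlog ij : i j Ni Nj / (i <= j)%N.
    by move=> W; case/orP: (leq_total i j) => ij; [|rewrite gdist_sym]; exact: W.
  by rewrite -(subnKC ij); apply: le_lt_trans (aD _ _) (HN _ Ni).
(* Some ball around the limit is relatively compact and, for large [k], contains the ball around
   [a k], against [aP]. *)
have [s s0 cs] := small_ball y.
have s2 : 0 < s / 2 by rewrite divr_gt0.
have [N HN] := q0 _ s2.
move/cvgrPdist_lt : ay => /(_ _ s2)[N' _ HN'].
pose k := maxn N N'.
have := HN' k (leq_maxr _ _); rewrite /= sub0r normrN ger0_norm ?gdist_ge0// => aky.
apply: (aP k); apply: relatively_compact_sub cs; apply: gball_sub.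
rewrite gdist_sym; have := HN k (leq_maxl _ _).
have : 0 <= r * q ^+ k by rewrite mulr_ge0 ?(ltW r0)// exprn_ge0// /q; lra.
rewrite -mulrA; move: (r * q ^+ k) => A; lra.
Qed.

End distance.

(** * Cut-offs from the capacity bounds *)

#[local] Opaque powR Ck_on grad tinner tnorm flux patch.

Section capacity_cutoff.
Context {R : realType} {n : nat} (M : riemannianManifold R n).
Variable vol : {measure set (borel M) -> \bar R}.
Hypothesis hvol : is_riemannian_volume vol.
Hypothesis hcomplete : metrically_complete M.
Variables (o : M) (p : R).
Hypothesis hp : 1 < p.
Implicit Types (w f : M -> R) (r a b c : R).

Lemma gball_compact_closure r : compact (closure (gball o r)).
Proof. exact: compact_closure (hopf_rinow hcomplete o r). Qed.

Lemma integrable_energy f r : smooth_on setT f -> compact (supp f) ->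
  supp f `<=` gball o r ->
  vol.-integrable (gball o r) (EFin \o (fun x => tnorm x (grad f x) `^ p)).
Proof.
move=> Cf cf sf.
apply: (@integrable_powR _ _ _ vol hvol p hp _ (gball_open o r) (supp f)
  (fun x => tnorm x (grad f x)) cf sf).
- by move=> x _; exact: (tnorm_grad_continuous openT (Logic.I : setT x) (Cf 1%N)).
- by move=> x _; exact: tnorm_ge0.
- by move=> x _ fx; rewrite (grad_supp fx) tnorm0.
Qed.

(** The closure of the smaller ball is compact and contained in the larger ball, so a smooth cut-off
    between them is a competitor of finite energy. *)
Lemma capacity_finite (r1 r2 : R) : r1 < r2 ->
  exists2 c, 0 <= c & capacity_balls vol p o r1 r2 = c%:E.
Proof.
move=> r12.
have [f [V [Cf cf sf f01 [_ CV V1]]]] :=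
  smooth_cutoff (@gball_compact_closure r1) (@gball_open _ _ M o r2)
    (@closure_gball _ _ M o _ _ r12).
have If := integrable_energy Cf cf sf.
have c0 : (0 <= capacity_balls vol p o r1 r2)%E.
  apply/ereal_infP => _ [g _ <-]; apply: integral_ge0 => x _.
  by rewrite lee_fin; exact: powR_ge0.
have coo : (capacity_balls vol p o r1 r2 < +oo)%E.
  apply: (@le_lt_trans _ _ (\int[vol]_(x in gball o r2) (tnorm x (grad f x) `^ p)%:E)%E).
    apply: ereal_inf_lbound; exists f => //; split => // x xr.
    by apply: V1; apply: CV; exact: subset_closure.
  have := integrable_fin_num (open_borel (gball_open o r2)) If.
  by rewrite ge0_fin_numE//; apply: integral_ge0 => x _; rewrite lee_fin; exact: powR_ge0.
exists (fine (capacity_balls vol p o r1 r2)); first exact: fine_ge0.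
by rewrite fineK// ge0_fin_numE.
Qed.

(* The [maxe 0] only matters for an empty annulus, whose supremum is [-oo]. *)
Lemma annulus_bound (K : set M) w (r1 r2 : R) c :
  (forall x, ~ K x -> {for x, continuous w}) -> K `<=` gball o r1 ->
  0 <= c -> capacity_balls vol p o r1 r2 = c%:E ->
  exists a, [/\ 0 <= a, forall x, annulus o r1 r2 x -> `|w x| <= a &
    ((a `^ p * c)%:E <= maxe 0 (growth vol p o w r1 r2))%E].
Proof.
move=> cw Kr c0 cE.
have [[x0 Ax0]|/nonemptyPn A0] := pselect (annulus o r1 r2 !=set0); last first.
  exists 0; split => // [x|]; first by rewrite A0.
  by rewrite powR0 ?mul0r ?le_max ?lexx// gt_eqF// (lt_trans ltr01).
(* A compact set containing the annulus and avoiding [K], because [K] lies in the inner ball;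
   continuity of [w] on it makes the supremum finite. *)
pose C := closure (gball o r2) `\` gball o r1.
have cC : compact C.
  apply: (@subclosed_compact _ _ (closure (gball o r2))) (@subIsetl _ _ _).
    apply: closedI; first exact: closed_closure.
    exact/open_closedC/gball_open.
  exact: gball_compact_closure.
have AC : annulus o r1 r2 `<=` C.
  move=> x [x2 x1]; split; first exact: subset_closure.
  by move=> /(@subset_closure _ _ _).
have [b b0 wb] : exists2 b, 0 <= b & forall x, C x -> `|w x| <= b.
  apply: compact_continuous_bounded cC _ => x [_ xr].
  apply: (@continuous_comp _ _ _ w Num.norm); last exact: norm_continuous.
  by apply: cw => /Kr.
pose S := ereal_sup [set `|w x|%:E | x in annulus o r1 r2].
have Sx x : annulus o r1 r2 x -> (`|w x|%:E <= S)%E.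
  by move=> Ax; apply: ereal_sup_ubound; exists x.
have Sb : (S <= b%:E)%E.
  by apply: ub_ereal_sup => _ [x /AC Cx <-]; rewrite lee_fin; exact: wb.
have S0 : (0 <= S)%E by apply: le_trans (Sx _ Ax0); rewrite lee_fin.
have SE : (fine S)%:E = S by rewrite fineK// ge0_fin_numE// (le_lt_trans Sb)// ltry.
exists (fine S); split; first exact: fine_ge0.
  by move=> x Ax; rewrite -lee_fin SE; exact: Sx.
by rewrite /growth -/S -SE cE poweR_EFin -EFinM le_max lexx orbT.
Qed.

Lemma eq0_on_closure (g : M -> R) (S : set M) x : {for x, continuous g} ->
  (forall y, S y -> g y = 0) -> closure S x -> g x = 0.
Proof.
move=> cg g0 Sx; apply/eqP; apply: contrapT => /negP gx.
have nx : nbhs x [set y | g y != 0].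
  exact: cg _ (open_nbhs_nbhs (conj (@open_neq R 0) gx)).
by have [y [/g0 Sy /eqP]] := Sx _ nx.
Qed.

Lemma powR4_le (U X a b Y : R) : 0 <= U -> U <= a + b -> 0 <= a -> 0 <= b ->
  0 <= X -> X <= 4 * Y -> 0 <= Y ->
  (U * X) `^ p <= 2 `^ p * 4 `^ p * (a `^ p + b `^ p) * Y `^ p.
Proof.
move=> U0 Uab a0 b0 X0 XY Y0; have p0 : 0 <= p by rewrite ltW// (lt_trans ltr01).
apply: (@le_trans _ _ (((a + b) * (4 * Y)) `^ p)).
  apply: ge0_ler_powR; rewrite ?nnegrE ?mulr_ge0 ?addr_ge0//.
  by apply: ler_pM.
rewrite powRM ?addr_ge0 ?mulr_ge0// powRM// mulrA [2 `^ p * 4 `^ p * _]mulrAC.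
apply: ler_wpM2r; first exact: powR_ge0.
apply: ler_wpM2r; first exact: powR_ge0.
exact: powRD_le.
Qed.

(** [eta] is the step of an almost optimal competitor [f]. Its gradient vanishes outside the
    annulus, where [h] is not controlled, and is at most 4 times that of [f] inside; the slack [d]
    replaces a minimiser, which need not exist. *)
Lemma cutoff_energy (D : set M) (h : M -> R) (r1 r2 : R) a b c (d : R) : open D ->
  (forall x, 0 <= h x) -> 0 <= a -> 0 <= b -> 0 < d ->
  (forall x, annulus o r1 r2 x -> h x <= a + b) ->
  capacity_balls vol p o r1 r2 = c%:E ->
  exists eta, [/\ Ck_on 1 setT eta, compact (supp eta), forall x, 0 <= eta x <= 1,
    forall x, gball o r1 x -> eta x = 1 &
    (\int[vol]_(x in D) ((h x * tnorm x (grad eta x)) `^ p)%:E <=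
       (2 `^ p * 4 `^ p * (a `^ p + b `^ p) * (c + d))%:E)%E].
Proof.
move=> oD h0 a0 b0 d0 hab cE.
have p0 : p != 0 by rewrite gt_eqF// (lt_trans ltr01).
have : (capacity_balls vol p o r1 r2 < (c + d)%:E)%E by rewrite cE lte_fin ltrDl.
move=> /ereal_inf_lt[_ [f [Cf cf f1 sf] <-] fc].
pose eta := step \o f.
have Ceta : Ck_on 1 setT eta.
  by apply: (C1_on_comp openT _ _ (Cf 1%N)); [exact: is_derive_step|exact: continuous_step'].
have sub : supp eta `<=` supp f.
  apply: closure_subset => x /=; apply: contraNneq => fx; rewrite /eta/= fx.
  by apply/eqP; exact: step_le0.
have gE x : grad eta x = step' (f x) *: grad f x.
  exact: (@grad_comp _ _ _ f step (step' (f x)) setT x (Cf 1%N) Logic.I (is_derive_step (f x))).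
have cg x : {for x, continuous (fun y => tnorm y (grad eta y))}.
  exact: (tnorm_grad_continuous openT (Logic.I : setT x) Ceta).
have eta1 x : gball o r1 x -> eta x = 1.
  by move=> /f1 fx; rewrite /eta/= fx step_ge1.
(* The annulus omits the closure of the inner ball, so the gradient must vanish on that closure too;
   continuity carries this over from the open ball, where [eta] is constant. *)
have g0 x : closure (gball o r1) x -> tnorm x (grad eta x) = 0.
  apply: (eq0_on_closure (cg x)) => y yr.
  rewrite (_ : grad eta y = 0) ?tnorm0// -(grad_cst 1 y); apply: grad_near_eq.
  by apply: filterS (open_nbhs_nbhs (conj (gball_open o r1) yr)) => z /eta1.
exists eta; split => //.
- by apply: compact_sub sub => //; exact: closed_closure.
- by move=> x; exact: step_itv.
pose k := 2 `^ p * 4 `^ p * (a `^ p + b `^ p).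
have k0 : 0 <= k by rewrite !mulr_ge0 ?addr_ge0 ?powR_ge0.
have mG := open_borel (gball_open o r2).
apply: (@le_trans _ _ (\int[vol]_(x in gball o r2) (k%:E * (tnorm x (grad f x) `^ p)%:E))%E).
  (* The two integrals run over different sets; after extension by 0 they are compared pointwise. *)
  rewrite [leLHS]integral_mkcond [leRHS]integral_mkcond.
  apply: ge0_le_integral_nomeas => x _.
    apply: erestrict_ge0 => y _; rewrite lee_fin; exact: powR_ge0.
  have rhs0 y : (0 <= k%:E * (tnorm y (grad f y) `^ p)%:E)%E.
    by rewrite -EFinM lee_fin; apply: mulr_ge0 => //; exact: powR_ge0.
  have lhs0 : tnorm x (grad eta x) = 0 -> (h x * tnorm x (grad eta x)) `^ p = 0.
    by move=> ->; rewrite mulr0 powR0.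
  rewrite !patchE; case: (boolP (x \in D)) => [/set_mem Dx|_]; last first.
    by case: ifP => // _; exact: rhs0.
  have [x1|x1] := pselect (closure (gball o r1) x).
    by rewrite (lhs0 (g0 x x1)); case: ifP => // _; exact: rhs0.
  case: (boolP (x \in gball o r2)) => [/set_mem x2|/negP x2]; last first.
    rewrite lhs0// gE grad_supp ?scaler0 ?tnorm0// => /sf x2'.
    by apply: x2; exact: mem_set.
  rewrite -EFinM lee_fin; apply: powR4_le => //; try exact: tnorm_ge0.
    by apply: hab; split.
  rewrite gE tnormZ; apply: ler_wpM2r; first exact: tnorm_ge0.
  exact: step'_le.
rewrite ge0_integralZl_EFin//; last 2 first.
  - by move=> x _; rewrite lee_fin; exact: powR_ge0.
  - exact: measurable_int (integrable_energy Cf cf sf).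
rewrite -/k [leRHS]EFinM; apply: lee_wpmul2l; first by rewrite lee_fin.
exact: ltW.
Qed.

End capacity_cutoff.

#[local] Transparent powR Ck_on grad tinner tnorm flux patch.

(** * Functions with vanishing gradient *)

Section zero_gradient.
Context {R : realType} {n : nat} (M : riemannianManifold R n).
Implicit Types (D : set M) (f g : M -> R).

Lemma grad0_differential f x : grad f x = 0 -> differential f x = 0.
Proof.
have gu : gram x \in unitmx by apply: metric_unit; exact: dom_chart_at.
by rewrite /grad => /(congr1 (mulmx^~ (gram x))); rewrite mulmxKV// mul0mx.
Qed.

(** Each gradient is computed in the chart of its own point. The transition rule moves the vanishing
    to the single chart at [x], where the mean value theorem on a ball applies. *)
Lemma grad0_locally_constant D f x : open D -> Ck_on 1 D f ->
  (forall y, D y -> grad f y = 0) -> D x -> \forall y \near x, f y = f x.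
Proof.
move=> oD Cf f0 Dx; pose c := chart_at x; have cx : dom c x by exact: dom_chart_at.
have oU := open_coord_image (c := c) oD.
have p0 y : dom c y -> D y -> partials c f y = 0.
  move=> cy Dy; rewrite (partials_transition cy (dom_chart_at y) oD Dy Cf).
  by rewrite [partials _ _ _](grad0_differential (f0 _ Dy)) mul0mx.
have : nbhs (coord c x) (coord c @` (dom c `&` D)).
  by apply: open_nbhs_nbhs; split => //; exact: coord_image.
move=> /nbhs_ballP[e /= e0 eU].
have K0 z i : ball (coord c x) e z -> 'D_(delta_mx 0 i) (f \o param c) z = 0.
  move=> /eU[y [cy Dy] <-]; have /rowP/(_ i) := p0 y cy Dy.
  by rewrite !mxE.
have := near_coord cx (nbhsx_ballx (coord c x) _ e0).
apply: filterS2 (nbhs_dom cx) => y cy ye.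
have := zero_partials_cst oU (Cf c) eU K0 ye.
by rewrite /= !coordK.
Qed.

End zero_gradient.

#[local] Opaque powR Ck_on grad tinner tnorm flux patch.

(** * The geodesic balls of integer radius as exhaustion *)

Section exhaustion_by_capacity.
Context {R : realType} {n : nat} (M : riemannianManifold R n).
Variable vol : {measure set (borel M) -> \bar R}.
Hypothesis hvol : is_riemannian_volume vol.
Hypothesis hcomplete : metrically_complete M.
Variables (o : M) (K : set M) (p : R) (R1 R2 : nat -> R).
Hypotheses (hK : compact K) (hp : 1 < p).
Hypothesis hR : forall k, 0 < R1 k < R2 k.
Hypothesis hR1 : R1 @ \oo --> +oo.
Implicit Types (w : M -> R).

Let G (N : nat) : set M := gball o N%:R.

Lemma gball_nat_open N : open (G N). Proof. exact: gball_open. Qed.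

Lemma gball_nat_le i j : (i <= j)%N -> G i `<=` G j.
Proof. by move=> ij x; rewrite /G /gball/= => /lt_le_trans; apply; rewrite ler_nat. Qed.

Lemma gball_nat_cover x : exists N, G N x.
Proof. by exists (Num.truncn (gdist o x)).+1; exact: truncnS_gt. Qed.

Let growth_sup w := ereal_sup [set growth vol p o w (R1 k) (R2 k)
  | k in [set k | annulus o (R1 k) (R2 k) `<=` closure (~` K)]].

Lemma growth_bound w : (growth_sup w < +oo)%E -> exists2 B, 0 <= B &
  forall k, annulus o (R1 k) (R2 k) `<=` ~` K ->
    (maxe 0%E (growth vol p o w (R1 k) (R2 k)) <= B%:E)%E.
Proof.
(* Over an empty set of indices the supremum would be [-oo]; raising it to at least 0 turns the
   bound into a nonnegative real. *)
move=> hw; have B0 : (0 <= maxe 0%E (growth_sup w))%E by rewrite le_max lexx.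
have Boo : (maxe 0%E (growth_sup w) < +oo)%E by rewrite gt_max ltry.
exists (fine (maxe 0%E (growth_sup w) : \bar R)); first exact: fine_ge0.
move=> k Ak; rewrite fineK ?ge0_fin_numE//.
rewrite ge_max B0/= le_max; apply/orP; right.
by apply: ereal_sup_ubound; exists k => //= x /Ak; exact: subset_closure.
Qed.

(** As [R1] tends to infinity, some inner ball contains both [K] and the ball of radius [N]. Its
    annulus then avoids [K], the growth bounds apply to it, and they bound the energy of the cut-off
    independently of [N]. *)
Lemma cutoffs u v :
  (forall x, ~ K x -> {for x, continuous u}) ->
  (forall x, ~ K x -> {for x, continuous v}) ->
  (growth_sup u < +oo)%E -> (growth_sup v < +oo)%E ->
  exists B, forall N, exists eta, [/\ Ck_on 1 setT eta, compact (supp eta),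
    forall x, 0 <= eta x <= 1, forall x, G N x -> eta x = 1 &
    (\int[vol]_(x in ~` K)
      (((`|u x| + `|v x|) * tnorm x (grad eta x)) `^ p)%:E <= B%:E)%E].
Proof.
move=> cu cv gu gv.
have oK : open (~` K) by apply: closed_openC; exact: compact_closed_manifold.
have [Bu Bu0 HBu] := growth_bound gu.
have [Bv Bv0 HBv] := growth_bound gv.
exists (2 `^ p * 4 `^ p * (Bu + Bv + 1)) => N.
have [N0 KN0] := compact_sub_exhaustion gball_nat_open gball_nat_le gball_nat_cover hK.
have [k Rk] : exists k, (maxn N N0)%:R <= R1 k.
  have /cvgryPge/(_ (maxn N N0)%:R)[k _ Hk] := hR1.
  by exists k; exact: (Hk k (leqnn k)).
have GR : G (maxn N N0) `<=` gball o (R1 k).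
  by move=> x; rewrite /G /gball/= => /lt_le_trans; exact.
have KR : K `<=` gball o (R1 k).
  by move=> x /KN0/(gball_nat_le (leq_maxr N N0))/GR.
have AK : annulus o (R1 k) (R2 k) `<=` ~` K.
  by move=> x [_ x1] /KR/(@subset_closure _ _ _).
have /andP[_ R12] := hR k.
have [c c0 cE] := capacity_finite hvol hcomplete o hp R12.
have [a [a0 ua aB]] := annulus_bound hcomplete hp cu KR c0 cE.
have [b [b0 vb bB]] := annulus_bound hcomplete hp cv KR c0 cE.
have {aB HBu}aB : a `^ p * c <= Bu by rewrite -lee_fin (le_trans aB)// HBu.
have {bB HBv}bB : b `^ p * c <= Bv by rewrite -lee_fin (le_trans bB)// HBv.
pose s := a `^ p + b `^ p; have s0 : 0 <= s by rewrite addr_ge0 ?powR_ge0.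
(* The suprema [a] and [b] may grow with the radius, so the slack in the capacity has to shrink with
   them: [s * d <= 1] accounts for the [+ 1] in the bound. *)
pose d := (s + 1)^-1; have d0 : 0 < d by rewrite invr_gt0 ltr_wpDl.
have [eta [Ceta ceta eta01 eta1 etaE]] := @cutoff_energy _ _ M vol hvol o p hp (~` K)
  (fun x => `|u x| + `|v x|) _ _ a b c d oK
  (fun x => addr_ge0 (normr_ge0 _) (normr_ge0 _)) a0 b0 d0
  (fun x Ax => lerD (ua x Ax) (vb x Ax)) cE.
exists eta; split => //.
  by move=> x /(gball_nat_le (leq_maxl N N0))/GR/eta1.
apply: (le_trans etaE); rewrite lee_fin -/s -mulrA.
apply: ler_wpM2l; first by apply: mulr_ge0; exact: powR_ge0.
have sd : s * d <= 1 by rewrite ler_pdivrMr ?mul1r ?lerDl// ltr_wpDl.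
rewrite mulrDr; apply: lerD sd; rewrite /s mulrDl; exact: lerD.
Qed.

End exhaustion_by_capacity.

#[local] Transparent powR Ck_on grad tinner tnorm flux patch.

(** * Separation from the compact set, and the conclusion *)

Lemma within_continuousB (R : realType) (T : topologicalType) (A : set T) (u v : T -> R) :
  {within A, continuous u} -> {within A, continuous v} ->
  {within A, continuous (fun x => u x - v x)}.
Proof. by move=> cu cv x; exact: cvgB (cu x) (cv x). Qed.

(** A limit point lying in [K] would be in the closure of the complement, where [w] is continuous
    relatively to that closure; [w < e] would then persist at nearby points off [K], against [e < w]
    there. *)
Lemma closure_excess (R : realType) (T : topologicalType) (K : set T) (w : T -> R) (e : R) :
  {within closure (~` K), continuous w} -> 
  (forall x, K x -> closure (~` K) x -> w x < e) ->
  closure [set x | ~ K x /\ e < w x] `<=` ~` K.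
Proof.
move=> cw we y ye Ky.
have cy : closure (~` K) y by apply: closure_subset ye => x [].
have wy := we _ Ky cy.
have /subspace_continuousP/(_ y cy) := cw.
move=> /(_ _ (open_nbhs_nbhs (conj (@open_lt R e) wy))) => ny.
have {}ny : nbhs y [set x | closure (~` K) x -> w x < e] by exact: ny.
have [x [[nKx ex] /(_ (subset_closure nKx))]] := ye _ ny.
by rewrite ltNge (ltW ex).
Qed.

Theorem theorem2p4 (R : realType) (n : nat) (M : riemannianManifold R n)
    (vol : {measure set (borel M) -> \bar R})
    (hvol : is_riemannian_volume vol)
    (hcomplete : metrically_complete M)
    (hnoncompact : ~ compact [set: M])
    (o : M) (K : set M) (hK0 : K !=set0) (hK : compact K)
    (p : R) (hp : 1 < p)
    (A : R -> R) (hA : structure_conditions p A)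
    (u v : M -> R)
    (hu0 : {within closure (~` K), continuous u})
    (hv0 : {within closure (~` K), continuous v})
    (hu : weak_solution vol A (~` K) u)
    (hv : weak_solution vol A (~` K) v)
    (R1 R2 : nat -> R)
    (hR : forall k, 0 < R1 k < R2 k)
    (hR1 : R1 @ \oo --> +oo)
    (hgu : (ereal_sup [set growth vol p o u (R1 k) (R2 k)
              | k in [set k | annulus o (R1 k) (R2 k) `<=` closure (~` K)]]
            < +oo)%E)
    (hgv : (ereal_sup [set growth vol p o v (R1 k) (R2 k)
              | k in [set k | annulus o (R1 k) (R2 k) `<=` closure (~` K)]]
            < +oo)%E)
    (huv : forall x, boundary K x -> u x <= v x) :
  forall x, ~ K x -> u x <= v x.
Proof.
move=> x0 Kx0; rewrite leNgt; apply/negP => vu0.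
have oK : open (~` K) by apply: closed_openC; exact: compact_closed_manifold.
have [Cu _] := hu; have [Cv _] := hv.
have cu x : ~ K x -> {for x, continuous u} by exact: Ck_on_continuous Cu.
have cv x : ~ K x -> {for x, continuous v} by exact: Ck_on_continuous Cv.
have [B HB] := cutoffs hvol hcomplete hK hp hR hR1 cu cv hgu hgv.
(* [chi] is 1 on a neighbourhood of [K] and compactly supported, so [1 - chi] is the weight that
   hides the behaviour near [K]. *)
have [chi [V [Cchi cchi _ chi01 [oV KV chi1]]]] :=
  smooth_cutoff hK openT (@subsetT _ K).
pose zeta x := 1 - chi x.
have Czeta : Ck_on 1 setT zeta.
  exact: (Ck_onB openT (@Ck_on_cst _ _ M 1 setT 1) (Cchi 1%N)).
have zeta01 x : 0 <= zeta x <= 1.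
  by have := chi01 x; rewrite /zeta subr_ge0 gerBl andbC.
have zetaV x : V x -> zeta x = 0 by move=> /chi1 E; rewrite /zeta E subrr.
have zetaH x : ~ supp chi x -> zeta x = 1.
  move=> chix; rewrite /zeta (_ : chi x = 0) ?subr0//.
  by apply/eqP; apply: contra_notT chix => ?; exact: subset_closure.
have DV x : ~ (~` K) x -> V x by move=> /contrapT /KV.
have ch x : ~ K x -> {for x, continuous (fun x => `|u x| + `|v x|)}.
  move=> Kx; apply: continuousD_for.
    by apply: (@continuous_comp _ _ _ u Num.norm); [exact: cu|exact: norm_continuous].
  by apply: (@continuous_comp _ _ _ v Num.norm); [exact: cv|exact: norm_continuous].
have cuv := within_continuousB hu0 hv0.
have uvb x : K x -> closure (~` K) x -> u x - v x <= 0.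
  move=> Kx cKx; rewrite subr_le0; apply: huv; split; first exact: subset_closure.
  by rewrite closure_setC in cKx.
have excess e : 0 < e -> closure [set x | ~ K x /\ e < u x - v x] `<=` ~` K.
  move=> e0; apply: closure_excess cuv _ => x Kx cKx.
  exact: le_lt_trans (uvb x Kx cKx) e0.
pose c := u x0 - v x0.
have c0 : 0 < c by rewrite subr_gt0.
have e0 : 0 < c / 2 by rewrite divr_gt0.
have ec : c / 2 < c by rewrite ltr_pdivrMr// ltr_pMr// ltr1n.
pose E := [set x | ~ K x /\ c / 2 < u x - v x].
have Cuv := Ck_onB oK Cu Cv.
have cw x : ~ K x -> {for x, continuous (fun x => u x - v x)}.
  by exact: Ck_on_continuous Cuv.
have oE : open E.
  rewrite openE => x [Kx ex].
  have nx : nbhs x [set y | c / 2 < u y - v y].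
    exact: (cw x Kx _ (open_nbhs_nbhs (conj (@open_gt R (c / 2)) ex))).
  exact: filterI (open_nbhs_nbhs (conj oK Kx)) nx.
have E0 x : E x -> grad (fun x => u x - v x) x = 0.
  move=> [Kx ex]; rewrite (gradB oK Cu Cv Kx); apply/eqP; rewrite subr_eq0; apply/eqP.
  exact: (comparison_grad hvol oK (@gball_nat_open _ _ M o) (@gball_nat_le _ _ M o)
    (@gball_nat_cover _ _ M o) hp hA oV DV cchi Czeta zeta01 zetaV zetaH HB ch
    (ltW e0) hu hv (fun _ _ => lexx _) (excess _ e0) Kx ex).
(* A single level set rather than [E]: on [E] the difference is locally constant, so the level set
   is open. It is closed because the closure of [E] avoids [K], so that the difference is still
   continuous at its limit points. *)
pose S := [set x | ~ K x /\ u x - v x = c].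
have SE : S `<=` E by move=> x [Kx xc]; split=> //; rewrite xc.
have ST : S = setT.
  apply: (@manifold_connected _ _ M); first by exists x0.
  - exists S; rewrite ?setTI// openE => x Sx.
    have Ex := SE _ Sx.
    have EK : E `<=` ~` K by move=> y [].
    have := grad0_locally_constant oE (Ck_on_sub EK Cuv) E0 Ex.
    have : nbhs x (~` K) by apply: open_nbhs_nbhs; split => //; exact: Sx.1.
    by apply: filterS2 => y Ky yx; split => //; rewrite yx; exact: Sx.2.
  - exists S; rewrite ?setTI// => x Sx.
    have Kx : ~ K x by apply: (excess _ e0); exact: closure_subset SE x Sx.
    split => //; apply/eqP; rewrite -subr_eq0; apply/eqP.
    apply: (eq0_on_closure (g := fun x => u x - v x - c) _ _ Sx).
      by apply: continuousB_for; [exact: cw|exact: continuous_cst_for].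
    by move=> y [_ ->]; rewrite subrr.
have [k Kk] := hK0.
by have [] : S k by rewrite ST.
Qed.
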